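(* Let $1\le p<\infty$. Let $(X,d,\mu)$ be an unbounded complete metric measure space with $\mu$ doubling (constant $C_\mu$) and supporting a $p$-Poincaré inequality (constants $C_P,\lambda$); let $\Omega\subset X$ be an unbounded uniform domain (constant $C_U$) with $X=\overline\Omega$, whose boundary $\partial\Omega=X\setminus\Omega$ is unbounded, uniformly perfect with constant $\kappa$, and equipped with a Radon measure $\nu$ that is $\theta$-codimensional with respect to $\mu$ (constant $C_\theta$) for some $0<\theta<p$. Fix $b\in\partial\Omega$ and let $\rho:(0,\infty)\to(0,\infty)$ be a lower semicontinuous function satisfying conditions (A), (B), (C), (D) of the context. Then, as sets, \[HB^{1-\theta/p}_{p,p}(\partial\Omega,d,\nu)=B^{1-\theta/p}_{p,p}(\partial_\rho\Omega,d_\rho,\nu_\rho),\] and moreover there is a constant $C\ge1$, depending only on $C_U,C_\mu,p,\lambda,C_P,\theta,C_\theta,\kappa,C_A,C_B,C_C,C_D$, such that for each $u\in HB^{1-\theta/p}_{p,p}(\partial\Omega,d,\nu)$, \[\frac1C\|u\|_{B^{1-\theta/p}_{p,p}(\partial\Omega,d,\nu)}\le\|u\|_{B^{1-\theta/p}_{p,p}(\partial_\rho\Omega,d_\rho,\nu_\rho)}\le C\,\|u\|_{B^{1-\theta/p}_{p,p}(\partial\Omega,d,\nu)}.\]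
   Context: Balls $B(x,r)$ are open. Doubling: $0<\mu(B(x,2r))\le C_\mu\mu(B(x,r))<\infty$ for all $x$, $r>0$. $p$-Poincaré inequality: there are $C_P>0$, $\lambda\ge1$ with $\frac{1}{\mu(B)}\int_B|u-u_B|\,d\mu\le C_Pr\left(\frac1{\mu(\lambda B)}\int_{\lambda B}g^p\,d\mu\right)^{1/p}$ for every ball $B=B(x,r)$, measurable $u$, and upper gradient $g$ of $u$ (nonnegative Borel $g$ with $|u(x)-u(y)|\le\int_\gamma g\,ds$ for all nonconstant rectifiable curves $\gamma$ joining $x,y$). Uniform domain: $\Omega$ is locally compact, not complete, and every pair $x,y\in\Omega$ is joined by a rectifiable curve $\gamma\subset\Omega$ with $\ell(\gamma)\le C_Ud(x,y)$ and $\min\{\ell(\gamma_{[x,z]}),\ell(\gamma_{[z,y]})\}\le C_U\operatorname{dist}(z,X\setminus\Omega)$ for all $z\in\gamma$ ($\gamma_{[x,z]}$ a subarc of $\gamma$ between $x$ and $z$). Uniformly perfect with constant $\kappa>1$: for all $a\in\partial\Omega$, $r>0$ with $\partial\Omega\not\subset B(a,r)$, $(B(a,\kappa r)\setminus B(a,r))\cap\partial\Omega\ne\varnothing$. $\theta$-codimensional: $C_\theta^{-1}r^{-\theta}\mu(B(x,r))\le\nu(B(x,r))\le C_\theta r^{-\theta}\mu(B(x,r))$ for all $x\in\partial\Omega$, $0<r<2\operatorname{diam}(\partial\Omega)$. Write $|x|=d(x,b)$. Conditions on $\rho$: (A) there is $C_A>0$ with $\rho(r)\le C_A\rho(s)$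 whenever $0<r\le2s+1$ and $0<s\le2r+1$; (B) there is $C_B>0$ with $\int_r^\infty\rho(t)\,dt\le C_B(r+1)\rho(r)$ for all $r>0$; (C) there is $C_C>0$ with $\int_{\Omega\setminus B(b,r)}\rho(|x|)^p\,d\mu(x)\le C_C\rho(r)^p\mu(B(b,r+1))$ for all $r>0$; (D) there is $C_D>0$ with $\int_{\partial\Omega\setminus B(b,r)}\rho(|x|)^{p-\theta}\,d\nu(x)\le C_D\rho(r)^{p-\theta}\nu(B(b,r+1))$ for all $r>0$. Sphericalization: for $x,y\in\Omega$, $d_\rho(x,y)=\inf_\gamma\int_\gamma\rho(|\cdot|)\,ds$ over rectifiable curves $\gamma$ in $\Omega$ with end points $x,y$ (arc length with respect to $d$). $\overline\Omega^{d_\rho}$ is the metric completion of $(\Omega,d_\rho)$, with $d_\rho$ extended to it, and $\partial_\rho\Omega=\overline\Omega^{d_\rho}\setminus\Omega$. It is known that, under these assumptions, $\partial_\rho\Omega=\partial\Omega\cup\{\infty\}$ for a single additional point $\infty$. The measure $\nu_\rho$ on $\partial_\rho\Omega$ is $d\nu_\rho(x)=\rho(|x|)^{p-\theta}\,d\nu(x)$ on $\partial\Omega\setminus\{b\}$, with $\nu_\rho(\{b\})=\nu_\rho(\{\infty\})=0$. Since $\nu_\rho(\{\infty\})=0$ and $\nu,\nu_\rho$ have the same null subsets of $\partial\Omega$, measurable functions on $\partial\Omega$ and on $\partial_\rho\Omega$ (up to a.e. equality) are identified. Besov energy: for a metric measure space $(Z,d_Z,\mu_Z)$ and $0<\Theta<1$,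 $\|u\|_{B^\Theta_{p,p}(Z,d_Z,\mu_Z)}^p=\int_Z\int_Z\frac{|u(y)-u(x)|^p}{\mu_Z(B(x,d_Z(x,y)))\,d_Z(x,y)^{p\Theta}}\,d\mu_Z(y)\,d\mu_Z(x)$ for measurable $u$. $HB^\Theta_{p,p}(Z,d_Z,\mu_Z)$ is the set of measurable $u$ with finite Besov energy; $B^\Theta_{p,p}(Z,d_Z,\mu_Z)$ is the set of those which in addition satisfy $\int_Z|u|^p\,d\mu_Z<\infty$. *)

(* Defs.v *)
From HB Require Import structures.
From mathcomp Require Import all_boot all_order all_algebra.
From mathcomp Require Import all_classical all_reals all_analysis.
From mathcomp Require Import measurable_realfun.

Set Implicit Arguments.
Unset Strict Implicit.
Unset Printing Implicit Defensive.

Import Order.TTheory GRing.Theory Num.Theory.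
Import numFieldNormedType.Exports.

Local Open Scope classical_set_scope.
Local Open Scope ring_scope.

(* A subset A of a metric space, seen as the type [set_type A], already carries
   the induced topology and pseudometric; this adds the induced distance. *)
Section subset_metric.
Context {R : realType} {X : metricType R} (A : set X).

Let sub_mdist (x y : set_type A) : R := mdist (\val x) (\val y).

Let sub_mdist_ge0 x y : 0 <= sub_mdist x y.
Proof. exact: mdist_ge0. Qed.

Let sub_mdist_positivity x y : sub_mdist x y = 0 -> x = y.
Proof. by move=> /mdist_positivity xy; exact: val_inj. Qed.

Let sub_ballE (x : set_type A) d : ball x d = [set y | sub_mdist x y < d].
Proof.
rewrite (_ : ball x d = [set y | ball (\val x) d (\val y)]); last by [].
by apply/seteqP; split => y; rewrite /= ballEmdist.
Qed.

HB.instance Definition _ := @PseudoMetric_isMetric.Build R (set_type A)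
  sub_mdist sub_mdist_ge0 sub_mdist_positivity sub_ballE.

End subset_metric.

(* [borel z] is the space Z with its Borel sigma-algebra. Measurable types of
   the library are pointed, hence the point z; it plays no other role. *)
Definition borel {R : realType} {Z : metricType R} (z : Z) : Type := Z.

Section borel.
Context {R : realType} {Z : metricType R} (z : Z).

HB.instance Definition _ := Choice.on (borel z).
HB.instance Definition _ := isPointed.Build (borel z) z.

Let borelC (A : set (borel z)) : <<s @open Z >> A -> <<s @open Z >> (~` A).
Proof. by move=> sA; rewrite -setTD; exact: sigma_algebraCD. Qed.

HB.instance Definition _ := @isMeasurable.Build (sigma_display (@open Z))
  (borel z) <<s @open Z >> (@sigma_algebra0 _ setT (@open Z)) borelC
  (@sigma_algebra_bigcup _ setT (@open Z)).

End borel.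

Section metric_notions.
Context {R : realType} {X : metricType R}.
Implicit Types (A : set X).

Definition metric_complete A := forall u : nat -> X, (forall n, A (u n)) ->
  cauchy (u @ \oo) -> exists2 l, A l & u @ \oo --> l.

Definition diam A : \bar R :=
  ereal_sup [set (mdist x y)%:E | x in A & y in A].

Definition unbounded A := diam A = +oo%E.

Definition dist_to A (x : X) : R := inf [set mdist x y | y in A].

Definition uniformly_perfect (kappa : R) A := forall a r, A a -> 0 < r ->
  ~ (A `<=` ball a r) -> (ball a (kappa * r) `\` ball a r) `&` A !=set0.

End metric_notions.

(* Curves are continuous maps on [0, 1], given by functions on R whose values
   outside [0, 1] are irrelevant. *)
Section curves.
Context {R : realType} {X : metricType R}.
Implicit Types (gamma : R -> X) (g : X -> \bar R).

Definition curve_length gamma (a b : R) : \bar R :=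
  ereal_sup [set (\sum_(0 <= i < size s)
      mdist (gamma (nth b (a :: s) i)) (gamma (nth b (a :: s) i.+1)))%:E
    | s in [set s | itv_partition a b s]].

Definition rectifiable gamma :=
  {within `[0, 1], continuous gamma} /\ (curve_length gamma 0 1 < +oo)%E.

(* the parametrization of gamma by arc length, on [0, length of gamma] *)
Definition arc_param gamma (s : R) : X :=
  gamma (sup [set t | t \in `[0, 1] /\ (curve_length gamma 0 t <= s%:E)%E]).

(* integral of g along gamma with respect to arc length *)
Definition line_integral gamma g : \bar R :=
  (\int[lebesgue_measure]_(s in `[0%R, fine (curve_length gamma 0 1)])
     g (arc_param gamma s))%E.

Definition rect_curve_in (A : set X) (x y : X) : set (R -> X) :=
  [set gamma | [/\ rectifiable gamma, gamma 0 = x, gamma 1 = y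
    & forall t, t \in `[0, 1] -> A (gamma t)]].

End curves.

Section analysis_on_metric_spaces.
Context {R : realType} {X : metricType R} {x0 : X}.
Implicit Types (mu : {measure set (borel x0) -> \bar R}).

Definition doubling mu (Cmu : R) := forall (x : X) (r : R), 0 < r ->
  [/\ (0 < mu (ball x (2 * r)))%E,
      (mu (ball x (2 * r)) <= Cmu%:E * mu (ball x r))%E
    & (mu (ball x r) < +oo)%E].

Definition upper_gradient (u : X -> R) (g : X -> \bar R) :=
  [/\ measurable_fun setT (g : borel x0 -> \bar R), (forall x, (0 <= g x)%E)
    & forall x y gamma, rect_curve_in setT x y gamma ->
        (exists2 t, t \in `[0, 1] & gamma t <> gamma 0) ->
        (`|u x - u y|%:E <= line_integral gamma g)%E].

Definition average mu (B : set X) (f : X -> \bar R) : \bar R :=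
  ((mu B)^-1 * \int[mu]_(x in B) f x)%E.

(* If u is not integrable on the ball, its average is computed in \bar R (with
   +oo - oo = -oo), so it is infinite and so is the left-hand side. *)
Definition poincare mu (p CP lam : R) :=
  forall (x : X) (r : R) (u : X -> R) (g : X -> \bar R), 0 < r ->
    measurable_fun setT (u : borel x0 -> R) -> upper_gradient u g ->
    (average mu (ball x r)
       (fun y => `|(u y)%:E - average mu (ball x r) (EFin \o u)|)
     <= (CP * r)%:E *
        average mu (ball x (lam * r)) (fun y => g y `^ p) `^ p^-1)%E.

Definition radon mu :=
  [/\ forall K : set X, compact K -> (mu K < +oo)%E,
      forall A : set (borel x0), measurable A ->
        mu A = ereal_inf [set mu U | U in [set U : set X | open U /\ A `<=` U]]
    & forall U : set X, open U ->
        mu U = ereal_sup [set mu K | K in [set K : set X | compact K /\ K `<=` U]]].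

Definition uniform_domain (Omega : set X) (CU : R) :=
  [/\ locally_compact [set: set_type Omega], ~ metric_complete Omega
    & forall x y, Omega x -> Omega y -> exists2 gamma,
        rect_curve_in Omega x y gamma &
        (curve_length gamma 0 1 <= (CU * mdist x y)%:E)%E /\
        forall t, t \in `[0, 1] ->
          (mine (curve_length gamma 0 t) (curve_length gamma t 1)
           <= (CU * dist_to (~` Omega) (gamma t))%:E)%E].

End analysis_on_metric_spaces.

Section besov.
Context {R : realType} {Z : metricType R} {z : Z}.
Variables (mu : {measure set (borel z) -> \bar R}) (p Theta : R).
Implicit Types u : Z -> R.

(* On the diagonal the integrand is 0 * +oo = 0. *)
Definition besov_energy u : \bar R :=
  (\int[mu]_x \int[mu]_y
     ((`|u y - u x| `^ p)%:E *
      (mu (ball (x : Z) (mdist (x : Z) y)) *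
       (mdist (x : Z) y `^ (p * Theta))%:E)^-1))%E.

Definition besov_norm u : \bar R := (besov_energy u `^ p^-1)%E.

Definition hom_besov : set (Z -> R) :=
  [set u | measurable_fun setT (u : borel z -> R) /\
           (besov_energy u < +oo)%E].

Definition besov : set (Z -> R) :=
  [set u | hom_besov u /\ (\int[mu]_x (`|u x| `^ p)%:E < +oo)%E].

End besov.

Section domain.
Context {R : realType} {X : metricType R}.
Variables (Omega : set X).

Definition bdry : Type := set_type (~` Omega).

Variables (b : bdry) (mu : {measure set (borel (\val b)) -> \bar R})
  (nu : {measure set (borel b) -> \bar R}).

Definition codimensional (theta Ctheta : R) :=
  forall (x : bdry) (r : R), 0 < r ->
    (r%:E < 2%:E * diam [set: bdry])%E ->
    ((Ctheta^-1 * r `^ (- theta))%:E * mu (ball (\val x) r) <= nu (ball x r))%E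
    /\ (nu (ball x r) <= (Ctheta * r `^ (- theta))%:E * mu (ball (\val x) r))%E.

Variable rho : R -> R.

Definition absb (x : X) : R := mdist x (\val b).

Definition condA (CA : R) := forall r s : R,
  0 < r -> r <= 2 * s + 1 -> 0 < s -> s <= 2 * r + 1 -> rho r <= CA * rho s.

Definition condB (CB : R) := forall r : R, 0 < r ->
  (\int[lebesgue_measure]_(t in `[r, +oo[) (rho t)%:E
   <= (CB * (r + 1) * rho r)%:E)%E.

Definition condC (p CC : R) := forall r : R, 0 < r ->
  (\int[mu]_(x in Omega `\` ball (\val b) r) (rho (absb x) `^ p)%:E
   <= (CC * rho r `^ p)%:E * mu (ball (\val b) (r + 1)%R))%E.

Definition condD (p theta CD : R) := forall r : R, 0 < r ->
  (\int[nu]_(x in ~` ball b r) (rho (absb (\val x)) `^ (p - theta))%:E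
   <= (CD * rho r `^ (p - theta))%:E * nu (ball b (r + 1)%R))%E.

Definition d_rho (x y : X) : \bar R :=
  ereal_inf [set line_integral gamma (fun z => (rho (absb z))%:E)
            | gamma in rect_curve_in Omega x y].

(* (Y, iota) is the metric completion of (Omega, d_rho), determined up to a
   unique isometry. *)
Definition is_completion (Y : metricType R) (iota : set_type Omega -> Y) :=
  [/\ metric_complete [set: Y],
      forall x y, (mdist (iota x) (iota y))%:E = d_rho (\val x) (\val y)
    & closure (range iota) = [set: Y]].

Section spherical_boundary.
Variables (Y : metricType R) (iota : set_type Omega -> Y).

Definition bdry_rho : Type := set_type (~` range iota).

(* The identification of the spherical boundary with the disjoint union of the
   boundary and one point: a point x of the boundary corresponds to the limit in
   Y of the sequences of Omega that tend to x for the original distance, and the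
   additional point to the limit of those that tend to infinity. *)
Definition boundary_identification (j : bdry -> bdry_rho) (infty : bdry_rho) :=
  (forall (x : bdry) (w : nat -> set_type Omega),
     (fun n => \val (w n) : X) @ \oo --> (\val x : X) ->
     iota \o w @ \oo --> (\val (j x) : Y)) /\
  (forall w : nat -> set_type Omega,
     absb (\val (w n)) @[n --> \oo] --> +oo ->
     iota \o w @ \oo --> (\val infty : Y)).

(* d nu_rho = rho(|x|)^(p - theta) d nu away from b, and b and the point at
   infinity have no mass. *)
Definition is_nu_rho (p theta : R) (j : bdry -> bdry_rho) (infty : bdry_rho)
    (nu_rho : {measure set (borel infty) -> \bar R}) :=
  [/\ forall A : set (borel infty), measurable A -> ~ A (j b) -> ~ A infty ->
        nu_rho A =
        (\int[nu]_(x in j @^-1` A) (rho (absb (\val x)) `^ (p - theta))%:E)%E,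
      nu_rho [set j b] = 0%E
    & nu_rho [set infty] = 0%E].

End spherical_boundary.

End domain.

(* Main.v *)
Require Import Defs.
From HB Require Import structures.
From mathcomp Require Import all_boot all_order all_algebra.
From mathcomp Require Import all_classical all_reals all_analysis.
From mathcomp Require Import measurable_realfun.
From mathcomp Require Import ring lra.

Set Implicit Arguments.
Unset Strict Implicit.
Unset Printing Implicit Defensive.

Import Order.TTheory GRing.Theory Num.Theory.
Import numFieldNormedType.Exports.
Import metricType_numDomainType.

Local Open Scope classical_set_scope.
Local Open Scope ring_scope.

(** The theorem compares two double integrals over the boundary, with the kernels
    [K(x, y) = 1 / (nu (B(x, d)) d^s)], where [s = p - theta], and
    [K'(x, y)], the same expression for the deformed distance and measure. The
    comparison is direct: it takes place on the boundary, which is cut into the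
    annuli [S_k] of the points [x] whose height [|x| + 1] lies between [q^k] and
    [q^(k + 1)].

    On [S_k] the function [rho] is almost constant by condition (A), say
    [rho_k], so that the deformed measure is about [rho_k^s nu] there. Uniform
    curves show that the deformed distance of points in neighbouring annuli is
    about [rho_k d(x, y)] ([boundary_dist_le], [boundary_dist_ge]). Since the
    deformed energy integrates against the deformed measure twice, the powers of
    [rho_k] cancel, and on pairs of neighbouring annuli the two energies agree up
    to constants ([nu'_kernel_near]); here condition (D) rules out that a
    deformed ball which reaches infinity has too much mass.

    For annuli [i] and [k] with [i + 2 <= k] the kernels differ: [K] is governed
    by the outer annulus, with the weight [1 / (nu (S_k) q^(k s))], whereas [K']
    is governed by the inner one, as infinity is at finite deformed distance,
    comparable to [R_i = q^i rho_i] ([nu'_kernel_far]). Both energies are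
    nevertheless bounded by their common part on neighbouring annuli. Indeed the
    mean oscillation [a_ik] of a function between two annuli is bounded through
    the chain [i, i + 1, ..., k], and a discrete Hardy inequality ([hardy_sum])
    sums these bounds. It requires that the masses of the annuli on one side of a
    given one are summable and that the weights decay geometrically. For [K] the
    inner masses [nu (S_i)] are summable by doubling and uniform perfectness, and
    the decay is that of [q^(- k s)]. For [K'] the deformed masses of the outer
    annuli are summable by condition (D), and condition (B) gives the decay: the
    tails of the sum of the [R_i] decrease geometrically ([rad_tail]). The results
    are [far0_sum] and [far1_sum].

    The deformed boundary has finite deformed diameter and measure. Hence its
    kernel is bounded below, and a function of finite deformed energy has a
    finite integral to the power [p] ([energy1_fin_Lp]), which turns the
    homogeneous space on one side into the inhomogeneous one on the other. *)

(** * Integrals of nonnegative functions that need not be measurable *)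

(** The integral of a nonnegative function is the supremum of the integrals of
    the simple functions below it. Read in this way, the iterated integral that
    defines a Besov energy can be estimated before anything is known about the
    measurability of its integrand in the two variables jointly, or of the inner
    integral as a function of the outer variable. *)

Section lower_integral.
Local Open Scope ereal_scope.
Context d (T : measurableType d) (R : realType).
Variable mu : {measure set T -> \bar R}.
Implicit Types (f g : T -> \bar R).

Import HBNNSimple.

Lemma lower_integral_le (D : set T) f g : (forall x, D x -> 0 <= f x) ->
  (forall x, D x -> f x <= g x) ->
  \int[mu]_(x in D) f x <= \int[mu]_(x in D) g x.
Proof.
move=> f0 fg; have g0 x : D x -> 0 <= g x.
  by move=> Dx; rewrite (le_trans (f0 _ Dx))// fg.
rewrite !ge0_integralE//; apply: ge_ereal_sup => _ [h /= hf <-].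
apply: ereal_sup_ubound; exists h => //= x; apply: (le_trans (hf x)).
by rewrite /patch; case: ifPn => //; rewrite inE => /fg.
Qed.

Lemma lower_integral_lub f (c : \bar R) : (forall x, 0 <= f x) ->
  (forall h : {nnsfun T >-> R}, (forall x, (h x)%:E <= f x) ->
     \int[mu]_x (h x)%:E <= c) ->
  \int[mu]_x f x <= c.
Proof.
move=> f0 H; rewrite ge0_integralTE//; apply: ge_ereal_sup => _ [h /= hf <-].
by have := H _ hf; rewrite integralT_nnsfun.
Qed.

(** For a simple function [h] below [f + g], the positive part of [h - g] is
    measurable and lies below [f], and [h] lies below its sum with [g]. *)
Lemma lower_integralD f g : (forall x, 0 <= f x) -> (forall x, 0 <= g x) ->
  measurable_fun setT g ->
  \int[mu]_x (f x + g x) <= \int[mu]_x f x + \int[mu]_x g x.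
Proof.
move=> f0 g0 mg; apply: lower_integral_lub => [x|h hfg]; first exact: adde_ge0.
pose k x := maxe ((h x)%:E - g x) 0.
have mh : measurable_fun setT (fun x => (h x)%:E) by exact/measurable_EFinP.
have mk : measurable_fun setT k.
  apply: measurable_maxe; last exact: measurable_cst.
  by apply: emeasurable_funB.
have k0 x : 0 <= k x by rewrite /k le_max lexx orbT.
apply: (@le_trans _ _ (\int[mu]_x (k x + g x))).
  apply: lower_integral_le => x _; first by rewrite lee_fin fun_ge0.
  rewrite /k; have [gf|] := boolP (g x \is a fin_num).
    by rewrite -leeBlDr// le_max lexx.
  have kN : k x != -oo by rewrite gt_eqF// (lt_le_trans ltNy0 (k0 x)).
  by rewrite -/(k x) ge0_fin_numE// -leNgt leye_eq => /eqP ->; rewrite addey ?leey.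
rewrite ge0_integralD//; apply: leeD => //.
apply: lower_integral_le => x _ //; rewrite /k ge_max f0 andbT.
have [gf|] := boolP (g x \is a fin_num); first by rewrite leeBlDr.
by rewrite ge0_fin_numE// -leNgt leye_eq => /eqP ->; rewrite addeNy leNye.
Qed.

Lemma lower_integralZl f (k : R) : (0 < k)%R -> (forall x, 0 <= f x) ->
  \int[mu]_x (k%:E * f x) = k%:E * \int[mu]_x f x.
Proof.
have le (r : R) (e : T -> \bar R) : (0 < r)%R -> (forall x, 0 <= e x) ->
    \int[mu]_x (r%:E * e x) <= r%:E * \int[mu]_x e x.
  move=> r0 e0; apply: lower_integral_lub => [x|h he].
    by rewrite mule_ge0// lee_fin ltW.
  have mh : measurable_fun setT (fun x => (h x)%:E) by exact/measurable_EFinP.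
  rewrite -lee_pdivrMl// -ge0_integralZl_EFin//; last 2 first.
  - by move=> x _; rewrite lee_fin fun_ge0.
  - by rewrite invr_ge0 ltW.
  apply: lower_integral_le => x _.
    by rewrite -EFinM lee_fin mulr_ge0 ?invr_ge0 ?fun_ge0// ltW.
  by rewrite lee_pdivrMl.
move=> k0 f0; apply/eqP; rewrite eq_le le//= -lee_pdivlMl//.
apply: le_trans (le _ _ _ _); last 2 first.
- by rewrite invr_gt0.
- by move=> x; rewrite mule_ge0// lee_fin ltW.
apply: lower_integral_le => // x _.
by rewrite muleA -EFinM mulVf ?gt_eqF// mul1e.
Qed.

(** The inequality is tested on simple functions, which may be set to zero on
    the null set. *)
Lemma lower_integral_null f g (N : set T) : measurable N -> mu N = 0 ->
  (forall x, 0 <= f x) -> (forall x, 0 <= g x) ->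
  (forall x, ~ N x -> f x <= g x) ->
  \int[mu]_x f x <= \int[mu]_x g x.
Proof.
move=> mN N0 f0 g0 fg; apply: lower_integral_lub => // h hf.
have mh : measurable_fun setT (fun x => (h x)%:E) by exact/measurable_EFinP.
have h0 x : 0 <= (h x)%:E by rewrite lee_fin fun_ge0.
rewrite (@ge0_negligible_integral _ _ _ mu setT N)//.
rewrite integral_mkcond; apply: lower_integral_le => x _.
  by rewrite erestrict_ge0.
rewrite /patch; case: ifPn => //; rewrite inE setTD => Nx.
exact: le_trans (hf x) (fg x Nx).
Qed.

End lower_integral.

(** Sets suffice: a bound for the measures of sets passes to simple functions,
    and the integral of an arbitrary nonnegative function is a supremum over
    these. *)
Lemma lower_integral_transport d d' (T : measurableType d)
    (T' : measurableType d') (R : realType) (mu : {measure set T -> \bar R})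
    (mu' : {measure set T' -> \bar R}) (j : T -> T') (W : T -> \bar R) (C : R) :
  measurable_fun setT j -> measurable_fun setT W -> (forall x, 0 <= W x)%E ->
  0 < C ->
  (forall B, measurable B ->
     (mu' B <= C%:E * \int[mu]_(x in j @^-1` B) W x)%E) ->
  forall f, (forall x, 0 <= f x)%E ->
  (\int[mu']_x f x <= C%:E * \int[mu]_x (f (j x) * W x))%E.
Proof.
Import HBNNSimple.
move=> mj mW W0 C0 H f f0; apply: lower_integral_lub => // h hf.
pose A y := j @^-1` (h @^-1` [set y]).
have mA y : measurable (A y) by rewrite -[A y]setTI; exact: mj.
rewrite integralT_nnsfun sintegralE.
apply: (@le_trans _ _ (\sum_(y \in range h)
    \int[mu]_x (C%:E * y%:E * (W \_ (A y)) x)))%E.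
  apply: lee_fsum => // y [t _ <-].
  rewrite ge0_integralZl_EFin//; last 3 first.
  - by move=> x _; rewrite erestrict_ge0.
  - exact/(measurable_restrictT _ _).1/measurable_funTS.
  - by rewrite mulr_ge0 ?fun_ge0// ltW.
  rewrite -integral_mkcond EFinM muleAC muleC lee_wpmul2r ?lee_fin ?fun_ge0//.
  exact: H.
rewrite -ge0_integral_fsum//; last 2 first.
- move=> y; apply: measurable_funeM.
  exact/(measurable_restrictT _ _).1/measurable_funTS.
- move=> y x _; have [[t _ <-]|ny] := pselect (range h y).
    by rewrite mule_ge0 ?erestrict_ge0// -EFinM lee_fin mulr_ge0 ?fun_ge0// ltW.
  rewrite /patch memNset ?mule0// => Ay; apply: ny; exists (j x) => //.
rewrite -lower_integralZl//; last by move=> x; rewrite mule_ge0.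
apply: lower_integral_le => x _.
  rewrite fsume_ge0// => y [t _ <-].
  by rewrite mule_ge0 ?erestrict_ge0// -EFinM lee_fin mulr_ge0 ?fun_ge0// ltW.
rewrite -(fsbig_widen [set h (j x)] (range h))//=; last 2 first.
- by move=> _ ->; exists (j x).
- move=> y [_ /= /nesym yx]; rewrite /patch memNset ?mule0//.
rewrite fsbig_set1 /patch mem_set// -muleA lee_wpmul2l ?lee_fin ?(ltW C0)//.
by rewrite lee_wpmul2r.
Qed.

Lemma lower_integral_pieces d (T : measurableType d) (R : realType)
    (mu : {measure set T -> \bar R}) (D : set T) (F : nat -> set T)
    (c : nat -> R) (f : T -> \bar R) (M : nat) :
  (forall k, measurable (F k)) -> trivIset setT F -> (forall k, 0 <= c k) ->
  (forall x, D x -> 0 <= f x)%E ->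
  (forall k x, F k x -> D x /\ (c k)%:E <= f x)%E ->
  (\sum_(0 <= k < M) (c k)%:E * mu (F k) <= \int[mu]_(x in D) f x)%E.
Proof.
move=> mF tF c0 f0 H; rewrite integral_mkcond.
have mc k : measurable_fun setT (fun x => (c k)%:E * (\1_(F k) x)%:E)%E.
  by apply: measurable_funeM; exact/measurable_EFinP/measurable_indic.
have c1 k x : (0 <= (c k)%:E * (\1_(F k) x)%:E)%E by rewrite -EFinM lee_fin mulr_ge0.
have E k : ((c k)%:E * mu (F k) = \int[mu]_x ((c k)%:E * (\1_(F k) x)%:E))%E.
  rewrite ge0_integralZl_EFin//; last by exact/measurable_EFinP/measurable_indic.
  by rewrite integral_indic// setIT.
under eq_bigr do rewrite E.
rewrite -ge0_integral_sum//; apply: lower_integral_le => x _.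
  by rewrite sume_ge0.
have [[k [kM Fk]]|nF] := pselect (exists k, (k < M)%N /\ F k x).
  rewrite big_mkord (bigD1 (Ordinal kM))//= big1 ?adde0.
    by have [Dx cf] := H _ _ Fk; rewrite /patch mem_set// indicE mem_set// mule1.
  move=> [l lM] /= /eqP kl; rewrite indicE memNset ?mule0// => Fl; apply: kl.
  apply/val_inj => /=; apply: contrapT => /eqP lk.
  by have /trivIsetP/(_ l k I I lk)/seteqP[/(_ x) + _] := tF; apply; split.
rewrite big_mkord big1 ?erestrict_ge0// => -[k kM] _ /=.
by rewrite indicE memNset ?mule0// => Fk; apply: nF; exists k.
Qed.

(** * Functions comparable at comparable radii *)

Section comparable_radii.
Context {R : realType}.
Variables (rho : R -> R) (CA : R).
Hypothesis rho_gt0 : forall r, 0 < r -> 0 < rho r.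
Hypothesis rhoA : condA rho CA.

Lemma condA_ge1 : 1 <= CA.
Proof.
have : rho 1 <= CA * rho 1 by apply: rhoA; rewrite ?ltr01//; lra.
by rewrite ler_pMl// rho_gt0.
Qed.

(** Each doubling of [r + 1] costs one application of [condA], which compares
    the radii [s] and [2 * s + 1]; a larger radius is first cut at the largest
    radius within reach of the smaller one. *)
Lemma rho_le_exp n r s : 0 < r -> 0 < s ->
  r + 1 <= 2 ^+ n * (s + 1) -> s + 1 <= 2 ^+ n * (r + 1) ->
  rho r <= CA ^+ n * rho s.
Proof.
elim: n r s => [|n IHn] r s r0 s0; rewrite ?expr0 ?mul1r ?exprS.
  by move=> rs sr; rewrite (_ : r = s)//; lra.
have p1 : 1 <= 2 ^+ n :> R by rewrite exprn_ege1// ler1n.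
have CA1 := condA_ge1.
move=> rs sr; have [sr'|rs'] := leP s r.
- pose s' := Num.min r (2 * s + 1).
  have ss' : s <= s' by rewrite /s' le_min sr'; lra.
  have s'0 : 0 < s' by lra.
  have s'r : s' <= r by rewrite /s' ge_min lexx.
  have : rho r <= CA ^+ n * rho s'.
    apply: IHn => //; last by rewrite (@le_trans _ _ (r + 1)) ?ler_peMl//; lra.
    rewrite /s'; have [_|_] := leP r (2 * s + 1); first by rewrite ler_peMl//; lra.
    by apply: (le_trans rs); rewrite le_eqVlt; apply/orP; left; apply/eqP; ring.
  move/le_trans; apply; rewrite -mulrA mulrCA ler_wpM2l//.
    by rewrite exprn_ge0//; lra.
  by apply: rhoA => //; last lra; rewrite /s' ge_min lexx orbT.
- pose r' := Num.min s (2 * r + 1).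
  have rr' : r <= r' by rewrite /r' le_min ltW//=; lra.
  have r'0 : 0 < r' by lra.
  have r's : r' <= s by rewrite /r' ge_min lexx.
  have : rho r' <= CA ^+ n * rho s.
    apply: IHn => //; first by rewrite (@le_trans _ _ (s + 1)) ?ler_peMl//; lra.
    rewrite /r'; have [_|_] := leP s (2 * r + 1); first by rewrite ler_peMl//; lra.
    by apply: (le_trans sr); rewrite le_eqVlt; apply/orP; left; apply/eqP; ring.
  move=> r's'; apply: (@le_trans _ _ (CA * rho r')).
    by apply: rhoA => //; first lra; rewrite /r' ge_min lexx orbT.
  by rewrite -mulrA ler_wpM2l//; lra.
Qed.

End comparable_radii.

(** The ratio [K] is bridged by [truncn K + 1] doublings, as
    [K <= 2 ^ (truncn K + 1)]. *)
Definition cmp_cst {R : realType} (CA K : R) : R := CA ^+ (Num.truncn K).+1.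

Section cmp_cst.
Context {R : realType}.
Variables (rho : R -> R) (CA : R).
Hypothesis rho_gt0 : forall r, 0 < r -> 0 < rho r.
Hypothesis rhoA : condA rho CA.

Lemma rho_cmp K r s : 0 < r -> 0 < s ->
  r + 1 <= K * (s + 1) -> s + 1 <= K * (r + 1) ->
  rho r <= cmp_cst CA K * rho s.
Proof.
move=> r0 s0 rs sr.
have K0 : 0 <= K by rewrite -(@pmulr_lge0 _ (s + 1)); lra.
have K2 : K <= 2 ^+ (Num.truncn K).+1.
  have /andP[_ /ltW/le_trans] := truncn_itv K0; apply.
  by rewrite -natrX ler_nat ltnW// ltn_expl.
apply: (rho_le_exp rho_gt0 rhoA) => //.
  by apply: (le_trans rs); rewrite ler_wpM2r//; lra.
by apply: (le_trans sr); rewrite ler_wpM2r//; lra.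
Qed.

End cmp_cst.

Lemma cmp_cst_ge1 {R : realType} (CA K : R) : 1 <= CA -> 1 <= cmp_cst CA K.
Proof. by move=> CA1; rewrite exprn_ege1. Qed.

Section geometric_decay.
Context {R : realType}.
Variables (a : nat -> R) (C : R).
Hypothesis a_gt0 : forall i, 0 < a i.
Hypothesis tail : forall i M, \sum_(i <= m < M) a m <= C * a i.

Lemma tail_ge1 : 1 <= C.
Proof.
have := tail 0 1; rewrite big_nat1 => h.
by rewrite -(@ler_pM2r _ (a 0%N)) ?mul1r.
Qed.

(** Passing to the next tail removes the first term, which is a definite
    proportion of the whole. *)
Lemma tail_step i M : (i < M)%N ->
  \sum_(i.+1 <= m < M) a m <= (1 - C^-1) * \sum_(i <= m < M) a m.
Proof.
move=> iM; have C1 := tail_ge1; have C0 : 0 < C by lra.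
have := tail i M; rewrite big_ltn// mulrBl mul1r => h.
suff : C^-1 * (a i + \sum_(i.+1 <= m < M) a m) <= a i by lra.
by rewrite ler_pdivrMl//; lra.
Qed.

Lemma tail_decay i n : a (i + n) <= C * (1 - C^-1) ^+ n * a i.
Proof.
have C1 := tail_ge1; have C0 : 0 < C by lra.
have t0 : 0 <= 1 - C^-1 by rewrite subr_ge0 invf_le1.
have H k : (k <= n)%N ->
    \sum_(i + k <= m < (i + n).+1) a m <=
    (1 - C^-1) ^+ k * \sum_(i <= m < (i + n).+1) a m.
  elim: k => [|k IHk] kn; first by rewrite addn0 expr0 mul1r.
  rewrite addnS; apply: (le_trans (tail_step _)).
    by rewrite ltnS leq_add2l ltnW.
  by rewrite exprS -mulrA ler_wpM2l// IHk// ltnW.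
have := H n (leqnn _); rewrite big_nat1 => /le_trans; apply.
by rewrite [C * _]mulrC -mulrA ler_wpM2l// ?exprn_ge0.
Qed.

End geometric_decay.

(** * Curves *)

Section curves.
Context {R : realType} {X : metricType R}.
Implicit Types (gamma : R -> X) (g : X -> \bar R).

Lemma curve_length_ge_mdist gamma (s t : R) : s <= t ->
  ((mdist (gamma s) (gamma t))%:E <= curve_length gamma s t)%E.
Proof.
rewrite le_eqVlt => /predU1P[<-|st]; apply: ereal_sup_ubound.
- exists [::]; first by split => /=.
  by rewrite /= big_nil mdistxx.
- exists [:: t]; first by split => //=; rewrite andbT.
  by rewrite /= big_nat1.
Qed.

Lemma mdist_le_curve_length gamma (t : R) : t \in `[0, 1] ->
  ((mdist (gamma 0%R) (gamma t))%:E <= curve_length gamma 0 1)%E.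
Proof.
rewrite in_itv /= => /andP[]; rewrite le_eqVlt => /predU1P[<- _|t0].
  by rewrite mdistxx (le_trans _ (curve_length_ge_mdist _ ler01))// lee_fin mdist_ge0.
rewrite le_eqVlt => /predU1P[->|t1]; first exact: curve_length_ge_mdist ler01.
apply: (@le_trans _ _ (mdist (gamma 0) (gamma t) + mdist (gamma t) (gamma 1))%:E).
  by rewrite lee_fin lerDl mdist_ge0.
apply: ereal_sup_ubound; exists [:: t; 1]; first by split => //=; rewrite t0 t1.
by rewrite /= big_nat_recl// big_nat1.
Qed.

(** The supremum that defines the parametrization by arc length is a limit of
    parameters up to which the curve has length at most [s]; the continuity of
    the curve carries the resulting bound on the distance to the limit. *)
Lemma arc_paramP gamma (s : R) : {within `[0, 1], continuous gamma} -> 0 <= s ->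
  exists t, [/\ t \in `[0, 1], arc_param gamma s = gamma t &
    mdist (gamma 0) (gamma t) <= s].
Proof.
move=> cg s0; rewrite /arc_param; set A := (X in sup X).
have A0 : A 0.
  split; first by rewrite in_itv /= lexx ler01.
  apply: (@le_trans _ _ 0%E); last by rewrite lee_fin.
  apply: ge_ereal_sup => _ [[|u l] [/= +] /eqP ll <-] /=; first by rewrite big_nil.
  move=> /andP[u0 /(order_path_min lt_trans)/allP ul].
  have := mem_last u l; rewrite ll inE => /predU1P[u00|/ul/(lt_trans u0)].
    by move: u0; rewrite -u00 ltxx.
  by rewrite ltxx.
have A1 : ubound A 1 by move=> t [+ _]; rewrite in_itv => /andP[].
have hA : has_sup A by split; [exists 0|exists 1].
have T01 : sup A \in `[0, 1].
  by rewrite in_itv /= ub_le_sup ?ge_sup//=; [exists 0|exists 1].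
exists (sup A); split => //; rewrite leNgt; apply/negP => lt.
have e0 : 0 < mdist (gamma 0) (gamma (sup A)) - s by rewrite subr_gt0.
have /subspace_continuousP/(_ _ T01)/cvgrPdist_lt/(_ _ e0) := cg.
rewrite near_withinE => -[/= d d0 dT].
have [t At Tt] := sup_adherent d0 hA.
have tT : t <= sup A by apply: ub_le_sup => //; exists 1.
have t01 : t \in `[0, 1] by case: At.
have /= := dT t; rewrite ger0_norm ?subr_ge0// => /(_ _ t01).
rewrite ltrBlDl -ltrBlDr => /(_ Tt) dlt.
have : mdist (gamma 0) (gamma t) <= s.
  have := curve_length_ge_mdist gamma (_ : 0 <= t) => /(_ _)/le_trans.
  rewrite -lee_fin; apply; last by case: At.
  by move: t01; rewrite in_itv /= => /andP[].
have := metric_triangle (gamma 0) (gamma t) (gamma (sup A)).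
by rewrite (metric_sym (gamma t)); lra.
Qed.

End curves.

Lemma lower_integral_ge_cst d (T : measurableType d) (R : realType)
    (mu : {measure set T -> \bar R}) (D F : set T) (c : R) (f : T -> \bar R) :
  measurable F -> F `<=` D -> 0 <= c -> (forall x, D x -> 0 <= f x)%E ->
  (forall x, F x -> c%:E <= f x)%E ->
  (c%:E * mu F <= \int[mu]_(x in D) f x)%E.
Proof.
move=> mF FD c0 f0 cf.
have := @lower_integral_pieces _ _ _ mu D (fun k => if k is 0%N then F else set0)
  (fun=> c) f 1.
rewrite big_nat1; apply => //.
- by case.
- by apply/trivIsetP => -[|k] [|l] _ _ //= _; rewrite ?setI0 ?set0I.
- by case=> // x Fx; split; [exact: FD|exact: cf].
Qed.

(** * The deformed distance *)

(** With [c := Num.max CU 1], a uniform curve is at most [c] times longer than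
    the distance of its end points, and [2 * (1 + K) * (2 + c)] bounds the ratio
    of the heights of its points to the height of its origin. *)
Definition up_cst {R : realType} (CA CU K : R) : R :=
  cmp_cst CA (2 * (1 + K) * (2 + Num.max CU 1)) * Num.max CU 1.

Definition lo_cst {R : realType} (CA : R) : R := (2 * cmp_cst CA 4)^-1.

Section deformed_distance.
Context {R : realType} {X : metricType R} (Omega : set X) (b : bdry Omega).
Variables (rho : R -> R) (CA CU : R).
Hypothesis rho_gt0 : forall r, 0 < r -> 0 < rho r.
Hypothesis rhoA : condA rho CA.
Hypothesis OmegaU : uniform_domain Omega CU.

(** Adding 1 makes the ratios of heights the ratios for which [condA] compares
    the values of [rho], near the point [b] as well as far from it. *)
Definition height (x : X) : R := absb b x + 1.

Lemma height_ge1 x : 1 <= height x.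
Proof. by rewrite lerDr mdist_ge0. Qed.

Lemma height_gt0 x : 0 < height x.
Proof. exact: lt_le_trans (height_ge1 x). Qed.

Lemma height_le x y : height x <= height y + mdist x y.
Proof.
by rewrite addrAC lerD2r addrC; exact: metric_triangle.
Qed.

Lemma mdist_le_height x y : mdist x y <= height x + height y.
Proof.
have := metric_triangle x (val b) y; rewrite (metric_sym (val b) y) => h.
by rewrite /height /absb; lra.
Qed.

Lemma absb_gt0 x : Omega x -> 0 < absb b x.
Proof.
move=> Ox; rewrite mdist_gt0; apply/eqP => xb.
by have /set_mem := valP b; rewrite -xb.
Qed.

Lemma dist_to_compl x : dist_to (~` Omega) x <= absb b x.
Proof.
apply: ge_inf; first by exists 0 => _ [y _ <-]; exact: mdist_ge0.
by exists (val b) => //; exact: set_valP.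
Qed.

Lemma dist_to_compl_ge0 x : 0 <= dist_to (~` Omega) x.
Proof.
apply: lb_le_inf; first by exists (absb b x); exists (val b) => //; exact: set_valP.
by move=> _ [y _ <-]; exact: mdist_ge0.
Qed.

(** Along a uniform curve the height stays comparable to that of the end
    points: a point [z] of the curve is close to one of the end points compared
    with [dist_to (~` Omega) z], which is at most [absb b z]. Hence [rho] is
    almost constant on the curve. *)
Lemma d_rho_le K x y : 1 <= K -> Omega x -> Omega y ->
  height x <= K * height y -> height y <= K * height x ->
  (d_rho b rho x y <= (up_cst CA CU K * rho (height x) * mdist x y)%:E)%E.
Proof.
move=> K1 Ox Oy xy yx; rewrite /up_cst; set c := Num.max CU 1.
have c1 : 1 <= c by rewrite /c le_max lexx orbT.
have [_ _ /(_ x y Ox Oy)[gamma gxy [glen gdist]]] := OmegaU.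
have [[cg rg] g0 g1 gO] := gxy.
set K' := 2 * (1 + K) * (2 + c).
have A1 := @condA_ge1 _ _ _ rho_gt0 rhoA.
have Hx := height_ge1 x; have Hy := height_ge1 y.
have dxy : mdist x y <= (1 + K) * height x.
  by apply: (le_trans (mdist_le_height x y)); rewrite mulrDl mul1r lerD2l.
have d0 := mdist_ge0 x y.
have L0 : (0 <= curve_length gamma 0 1)%E.
  apply: le_trans (curve_length_ge_mdist gamma ler01); rewrite lee_fin.
  exact: mdist_ge0.
have Lc : (curve_length gamma 0 1 <= (c * mdist x y)%:E)%E.
  by apply: (le_trans glen); rewrite lee_fin ler_wpM2r// /c le_max lexx.
have gz t : t \in `[0, 1] -> rho (absb b (gamma t)) <= cmp_cst CA K' * rho (height x).
  move=> t01; have Oz := gO _ t01; set z := gamma t in Oz *.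
  have xz : mdist x z <= c * mdist x y.
    rewrite -lee_fin (le_trans _ Lc)// -g0; exact: mdist_le_curve_length.
  have zx : height z <= height x + c * mdist x y.
    by apply: (le_trans (height_le z x)); rewrite lerD2l metric_sym.
  have cd : c * mdist x y <= c * ((1 + K) * height x) by rewrite ler_wpM2l//; lra.
  have KH : 1 * height x <= K * height x by rewrite ler_wpM2r//; lra.
  have cz : c * dist_to (~` Omega) z <= c * absb b z.
    by rewrite ler_wpM2l ?dist_to_compl//; lra.
  have z0 := absb_gt0 Oz.
  have Ez : height z = absb b z + 1 by [].
  have xz' : height x <= K * (1 + c) * height z.
    have ht : ((Num.min (mdist x z) (mdist z y))%:E <= (c * dist_to (~` Omega) z)%:E)%E.
      apply: (@le_trans _ _ (CU * dist_to (~` Omega) z)%:E); last first.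
        by rewrite lee_fin ler_wpM2r ?dist_to_compl_ge0// /c le_max lexx.
      apply: le_trans (gdist t t01); move: (t01); rewrite in_itv /= => /andP[t0 t1].
      rewrite EFin_min; apply: (@le_trans _ _ (mine (mdist x z)%:E (mdist z y)%:E)) => //.
      have h0 : ((mdist x z)%:E <= curve_length gamma 0 t)%E.
        by rewrite -g0; exact: curve_length_ge_mdist.
      have h1 : ((mdist z y)%:E <= curve_length gamma t 1)%E.
        by rewrite -g1; exact: curve_length_ge_mdist.
      by rewrite le_min !ge_min h0 h1 orbT.
    have KcH : 0 <= (K - 1) * (1 + c) * height z.
      by rewrite !mulr_ge0 ?(ltW (height_gt0 _))//; lra.
    move: ht; rewrite lee_fin ge_min => /orP[] ht.
      have := height_le x z; rewrite Ez in KcH *; nra.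
    have := height_le y z; rewrite (metric_sym y z) => yz.
    have : height y <= (1 + c) * height z by rewrite Ez; rewrite Ez in yz; lra.
    move=> /(ler_wpM2l (_ : 0 <= K)) h; apply: (le_trans xy).
    by rewrite -mulrA; apply: h; lra.
  apply: (rho_cmp rho_gt0 rhoA) => //; rewrite -?Ez /K'.
  - exact: height_gt0.
  - apply: (le_trans zx); apply: (le_trans (lerD (lexx _) cd)); nra.
  - have : height x + 1 <= 2 * height x by lra.
    move=> /le_trans; apply; rewrite -!mulrA ler_wpM2l//.
    apply: (le_trans xz'); rewrite -!mulrA; nra.
rewrite /d_rho; apply: (@le_trans _ _
  (line_integral gamma (fun z => (rho (absb b z))%:E))).
  by apply: ereal_inf_lbound; exists gamma.
rewrite /line_integral; set L := fine _.
have LE : L%:E = curve_length gamma 0 1 by rewrite fineK// ge0_fin_numE.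
have L0' : 0 <= L by rewrite -lee_fin LE.
have arcP s : s \in `[0, L] -> exists2 t, t \in `[0, 1] & arc_param gamma s = gamma t.
  rewrite in_itv /= => /andP[s0 _].
  by have [t [? ? _]] := arc_paramP cg s0; exists t.
apply: (@le_trans _ _ (\int[lebesgue_measure]_(s in `[0%R, L])
    (cmp_cst CA K' * rho (height x))%:E)%E).
  apply: lower_integral_le => s /= /arcP[t t01 ->]; rewrite lee_fin.
    by rewrite ltW// rho_gt0//; apply: absb_gt0; exact: gO.
  exact: gz.
rewrite integral_cst//= lebesgue_measure_itv /= lte_fin.
have B0 : 0 <= cmp_cst CA K' * rho (height x).
  by rewrite mulr_ge0 ?(ltW (rho_gt0 (height_gt0 x)))// (le_trans ler01)// cmp_cst_ge1.
have E : L <= c * mdist x y by rewrite -lee_fin LE.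
have F : cmp_cst CA K' * rho (height x) * L <=
         cmp_cst CA K' * c * rho (height x) * mdist x y.
  rewrite (_ : _ * c * _ * _ = cmp_cst CA K' * rho (height x) * (c * mdist x y)); last by ring.
  by rewrite ler_wpM2l.
case: ifPn => [_|]; first by rewrite sube0 -EFinM lee_fin.
by rewrite mule0 lee_fin => _; apply: le_trans F; rewrite mulr_ge0.
Qed.

(** A curve that leaves [x] travels at least the distance
    [Num.min (mdist x y) (height x / 2)] among points of height comparable to
    that of [x]. *)
Lemma d_rho_ge x y : Omega x -> Omega y ->
  ((lo_cst CA * rho (height x) * Num.min (mdist x y) (height x))%:E <=
   d_rho b rho x y)%E.
Proof.
move=> Ox Oy; apply: le_ereal_inf_tmp => _ [gamma [[cg rg] g0 g1 gO] <-].
have A1 := @condA_ge1 _ _ _ rho_gt0 rhoA.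
have A4 : 1 <= cmp_cst CA 4 by exact: cmp_cst_ge1.
have Hx := height_ge1 x.
rewrite /line_integral; set L := fine _.
have L0 : (0 <= curve_length gamma 0 1)%E.
  apply: le_trans (curve_length_ge_mdist gamma ler01); rewrite lee_fin.
  exact: mdist_ge0.
have LE : L%:E = curve_length gamma 0 1 by rewrite fineK// ge0_fin_numE.
set dl := Num.min (mdist x y) (height x / 2).
have dlL : dl <= L.
  rewrite -lee_fin LE; apply: le_trans (curve_length_ge_mdist gamma ler01).
  by rewrite g0 g1 lee_fin /dl ge_min lexx.
have dl0 : 0 <= dl by rewrite /dl le_min mdist_ge0 divr_ge0//; lra.
set c := (cmp_cst CA 4)^-1 * rho (height x).
have c0 : 0 <= c.
  by rewrite mulr_ge0 ?invr_ge0 ?(ltW (rho_gt0 (height_gt0 x)))// (le_trans ler01).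
have arcP s : s \in `[0, L] -> exists t, [/\ t \in `[0, 1],
    arc_param gamma s = gamma t & mdist x (gamma t) <= s].
  by rewrite -g0 in_itv /= => /andP[s0 _]; exact: arc_paramP.
apply: (@le_trans _ _ (c%:E * lebesgue_measure (`[0%R, dl[%classic : set R)))%E.
  rewrite lebesgue_measure_itv /= lte_fin sube0.
  have : lo_cst CA * rho (height x) * Num.min (mdist x y) (height x) <= c * dl.
    have -> : lo_cst CA = (cmp_cst CA 4)^-1 / 2 by rewrite /lo_cst invfM mulrC.
    rewrite /c -!mulrA ler_wpM2l ?invr_ge0 ?(le_trans ler01)//.
    rewrite mulrCA ler_wpM2l ?(ltW (rho_gt0 (height_gt0 x)))//.
    have m1 : Num.min (mdist x y) (height x) <= mdist x y by rewrite ge_min lexx.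
    have m2 : Num.min (mdist x y) (height x) <= height x by rewrite ge_min lexx orbT.
    by have := mdist_ge0 x y; rewrite /dl le_min; lra.
  case: ifPn => [_ h|]; first by rewrite -EFinM lee_fin.
  rewrite -leNgt => dl0' h; rewrite mule0 lee_fin (le_trans h)//.
  by rewrite mulr_ge0_le0.
apply: lower_integral_ge_cst => //.
- move=> s; rewrite /= !in_itv /= => /andP[-> sd] /=.
  by rewrite ltW// (lt_le_trans sd).
- move=> s /= /arcP[t [t01 -> _]].
  by rewrite lee_fin ltW// rho_gt0//; apply: absb_gt0; exact: gO.
- move=> s sd; have sL : s \in `[0, L].
    move: sd; rewrite /= !in_itv /= => /andP[-> sd] /=.
    by rewrite ltW// (lt_le_trans sd).
  have [t [t01 -> xt]] := arcP _ sL; have Oz := gO _ t01.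
  have sH : s < height x / 2.
    by move: sd; rewrite /= in_itv /= /dl lt_min => /andP[_ /andP[]].
  have z0 := absb_gt0 Oz; have Ez : height (gamma t) = absb b (gamma t) + 1 by [].
  have := height_le x (gamma t); have := height_le (gamma t) x.
  rewrite (metric_sym (gamma t)) => zx xz.
  rewrite lee_fin /c mulrC ler_pdivrMr ?(lt_le_trans ltr01)// mulrC.
  by apply: (rho_cmp rho_gt0 rhoA) => //; lra.
Qed.

End deformed_distance.

Lemma mdist_val {R : realType} {X : metricType R} (A : set X) (x y : set_type A) :
  mdist x y = mdist (val x) (val y).
Proof. by []. Qed.

Lemma unbounded_height {R : realType} {X : metricType R} (Omega : set X)
    (b : bdry Omega) (A : set X) (M : R) :
  unbounded A -> exists2 x, A x & M < height b x.
Proof.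
move=> Aoo; apply: contrapT => nA.
have le x : A x -> height b x <= M.
  by move=> Ax; rewrite leNgt; apply/negP => Mx; apply: nA; exists x.
have : (diam A <= (M + M)%:E)%E.
  apply: ge_ereal_sup => _ [x Ax [y Ay <-]]; rewrite lee_fin.
  by apply: (le_trans (mdist_le_height b x y)); rewrite lerD// le.
by rewrite [diam A]Aoo leye_eq.
Qed.

(** A compact neighbourhood of [x] in [Omega] is closed in the whole space, so
    that by density it contains a ball around [x]. *)
Lemma locally_compact_dense_open {R : realType} {X : metricType R}
    (Omega : set X) :
  closure Omega = setT -> locally_compact [set: set_type Omega] -> open Omega.
Proof.
move=> cO lc; rewrite openE => x Ox.
have [U xU [cU _]] := lc (exist _ x (mem_set Ox)) I.
have /nbhs_ballP[e /= e0 xeU] : nbhs (exist _ x (mem_set Ox) : set_type Omega) U.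
  by move: xU; rewrite /= /within /=; apply: filterS => y; exact.
have vc : compact (val @` U : set X).
  apply: continuous_compact => //; apply: continuous_subspaceT.
  exact: initial_continuous.
have vcl : closed (val @` U : set X) by apply: compact_closed => //; exact: metric_hausdorff.
apply/nbhs_ballP; exists e => //= z xz.
have : closure (val @` U : set X) z.
  move=> B Bz; have : closure Omega z by rewrite cO.
  have Bxe : nbhs z (B `&` ball x e).
    apply: filterI => //; rewrite nbhs_ballP; exists (e - mdist x z).
      by move: xz; rewrite ballEmdist /= subr_gt0.
    move=> w; rewrite !ballEmdist /= ltrBrDl => h.
    exact: le_lt_trans (metric_triangle _ _ _) h.
  move=> /(_ _ Bxe)[w [Ow [Bw xw]]]; exists w; split => //.
  by exists (exist _ w (mem_set Ow)) => //; apply: xeU.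
by rewrite -(closure_id _).1// => -[w _ <-]; exact: set_valP.
Qed.

(** * The deformed distance on the boundary *)

Definition bup_cst {R : realType} (CA CU K : R) : R :=
  up_cst CA CU (4 * K) * cmp_cst CA 2.

Definition blo_cst {R : realType} (CA : R) : R := lo_cst CA / cmp_cst CA 2.

Section boundary_distance.
Context {R : realType} {X : metricType R} (Omega : set X) (b : bdry Omega).
Variables (rho : R -> R) (CA CU : R).
Variables (Y : metricType R) (iota : set_type Omega -> Y).
Variables (j : bdry Omega -> bdry_rho iota) (infty : bdry_rho iota).
Hypothesis rho_gt0 : forall r, 0 < r -> 0 < rho r.
Hypothesis rhoA : condA rho CA.
Hypothesis OmegaU : uniform_domain Omega CU.
Hypothesis OmegaD : closure Omega = [set: X].
Hypothesis Omegaoo : unbounded Omega.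
Hypothesis Xc : metric_complete [set: X].
Hypothesis iotaC : is_completion b rho iota.
Hypothesis jP : boundary_identification b j infty.

Local Notation H := (height b).
Implicit Types x y : bdry Omega.

Lemma condA_cst_ge1 : 1 <= CA.
Proof. exact: condA_ge1 rho_gt0 rhoA. Qed.

Lemma up_cst_gt0 K : 0 < up_cst CA CU K.
Proof.
rewrite mulr_gt0// ?(lt_le_trans ltr01) ?cmp_cst_ge1 ?condA_cst_ge1//.
by rewrite le_max lexx orbT.
Qed.

Lemma bup_cst_gt0 K : 0 < bup_cst CA CU K.
Proof.
by rewrite mulr_gt0 ?up_cst_gt0// (lt_le_trans ltr01) ?cmp_cst_ge1 ?condA_cst_ge1.
Qed.

Lemma lo_cst_gt0 : 0 < lo_cst CA.
Proof.
by rewrite invr_gt0 mulr_gt0// (lt_le_trans ltr01) ?cmp_cst_ge1 ?condA_cst_ge1.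
Qed.

Lemma blo_cst_gt0 : 0 < blo_cst CA.
Proof.
rewrite divr_gt0 ?lo_cst_gt0//.
by rewrite (lt_le_trans ltr01) ?cmp_cst_ge1 ?condA_cst_ge1.
Qed.

(** The distances on the boundary are limits of those in the domain: a
    boundary point is approached for both distances by the same points. *)
Lemma boundary_approx x (e : R) : 0 < e -> exists w : set_type Omega,
  mdist (val w) (val x) < e /\ mdist (iota w) (val (j x)) < e.
Proof.
move=> e0.
have ex n : exists w : set_type Omega, mdist (val x) (val w) < n.+1%:R^-1.
  have : closure Omega (val x) by rewrite OmegaD.
  move=> /(_ (ball (val x) n.+1%:R^-1)) [].
    by apply: nbhsx_ballx; rewrite invr_gt0.
  move=> w [Ow]; rewrite ballEmdist /= => xw.
  by exists (exist _ w (mem_set Ow)).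
have [w wP] := choice ex.
have wx : (fun n => val (w n) : X) @ \oo --> (val x : X).
  apply/cvgrPdist_lt => d d0; near=> n.
  apply: (lt_trans (wP n)); near: n.
  exact: near_infty_natSinv_lt (PosNum d0).
have := jP.1 x w wx => /cvgrPdist_lt/(_ _ e0) iw.
move/cvgrPdist_lt : wx => /(_ _ e0) wx.
near \oo => n; exists (w n); split; rewrite metric_sym.
- by near: n.
- by near: n.
Unshelve. all: by end_near. Qed.

Let iota_dist (w w' : set_type Omega) (r : R) :
  ((mdist (iota w) (iota w') <= r) = (d_rho b rho (val w) (val w') <= r%:E)%E).
Proof. by have [_ <- _] := iotaC; rewrite lee_fin. Qed.

Let iota_dist_ge (w w' : set_type Omega) (r : R) :
  ((r <= mdist (iota w) (iota w')) = (r%:E <= d_rho b rho (val w) (val w'))%E).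
Proof. by have [_ <- _] := iotaC; rewrite lee_fin. Qed.

Lemma rho_close (x y : X) : mdist x y <= 2^-1 ->
  rho (H x) <= cmp_cst CA 2 * rho (H y).
Proof.
move=> xy; have := height_le b x y; have := height_le b y x.
rewrite (metric_sym y x) => yx' xy'.
have := height_ge1 b x; have := height_ge1 b y => hx hy.
by apply: (rho_cmp rho_gt0 rhoA); lra.
Qed.

Lemma boundary_dist_le K x y : 1 <= K ->
  H (val x) <= K * H (val y) -> H (val y) <= K * H (val x) ->
  mdist (j x) (j y) <= bup_cst CA CU K * rho (H (val x)) * mdist x y.
Proof.
move=> K1 xy yx; rewrite !mdist_val; set B := _ * rho _.
have B0 : 0 <= B by rewrite mulr_ge0 ?(ltW (bup_cst_gt0 _)) ?ltW ?rho_gt0 ?height_gt0.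
apply/ler_addgt0Pr => e e0.
pose d := Num.min 2^-1 (e / (2 + 2 * B)).
have B2 : 0 < 2 + 2 * B by lra.
have d0 : 0 < d by rewrite /d lt_min invr_gt0 ltr0n divr_gt0.
have d1 : d <= 2^-1 by rewrite /d ge_min lexx.
have d2 : d * (2 + 2 * B) <= e by rewrite -ler_pdivlMr; [rewrite /d ge_min lexx orbT|lra].
have [w [wx wjx]] := boundary_approx x d0.
have [w' [wy wjy]] := boundary_approx y d0.
have Hw := height_ge1 b (val w); have Hw' := height_ge1 b (val w').
have Hx := height_ge1 b (val x); have Hy := height_ge1 b (val y).
have := height_le b (val w) (val x); have := height_le b (val x) (val w).
have := height_le b (val w') (val y); have := height_le b (val y) (val w').
rewrite (metric_sym (val x)) (metric_sym (val y)) => h1 h2 h3 h4.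
have wK : H (val w) <= 4 * K * H (val w').
  have : H (val w) <= 2 * (K * H (val y)) by lra.
  by move/le_trans; apply; rewrite -mulrA mulrCA [leRHS]mulrCA ler_wpM2l//; lra.
have wK' : H (val w') <= 4 * K * H (val w).
  have : H (val w') <= 2 * (K * H (val x)) by lra.
  by move/le_trans; apply; rewrite -mulrA mulrCA [leRHS]mulrCA ler_wpM2l//; lra.
have := d_rho_le rho_gt0 rhoA OmegaU (_ : 1 <= 4 * K) (set_valP w) (set_valP w') wK wK'.
rewrite -iota_dist => /(_ ltac:(lra)) dw.
have rw : rho (H (val w)) <= cmp_cst CA 2 * rho (H (val x)).
  by apply: rho_close; lra.
have dww : mdist (val w) (val w') <= mdist (val x) (val y) + 2 * d.
  have := metric_triangle (val w) (val x) (val w').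
  have := metric_triangle (val x) (val y) (val w').
  by rewrite (metric_sym (val y)); lra.
have : mdist (iota w) (iota w') <= B * (mdist (val x) (val y) + 2 * d).
  apply: (le_trans dw); apply: (@le_trans _ _ (B * mdist (val w) (val w'))).
    rewrite ler_wpM2r ?mdist_ge0// /B /bup_cst -mulrA ler_wpM2l//.
    exact/ltW/up_cst_gt0.
  by rewrite ler_wpM2l.
have := metric_triangle (val (j x)) (iota w) (val (j y)).
have := metric_triangle (iota w) (iota w') (val (j y)).
rewrite (metric_sym (val (j x)) (iota w)) => t1 t2 t3.
by lra.
Qed.

Lemma boundary_dist_ge x y :
  blo_cst CA * rho (H (val x)) * Num.min (mdist x y) (H (val x)) <=
  mdist (j x) (j y).
Proof.
rewrite !mdist_val; set B := _ * rho _.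
have B0 : 0 <= B by rewrite mulr_ge0 ?(ltW (blo_cst_gt0)) ?ltW ?rho_gt0 ?height_gt0.
apply/ler_addgt0Pr => e e0.
pose d := Num.min 2^-1 (e / (2 + 2 * B)).
have B2 : 0 < 2 + 2 * B by lra.
have d0 : 0 < d by rewrite /d lt_min invr_gt0 ltr0n divr_gt0.
have d1 : d <= 2^-1 by rewrite /d ge_min lexx.
have d2 : d * (2 + 2 * B) <= e by rewrite -ler_pdivlMr; [rewrite /d ge_min lexx orbT|lra].
have [w [wx wjx]] := boundary_approx x d0.
have [w' [wy wjy]] := boundary_approx y d0.
have := d_rho_ge b rho_gt0 rhoA (set_valP w) (set_valP w').
rewrite -iota_dist_ge => dw.
set m := Num.min (mdist (val x) _) _; set m' := Num.min _ _ in dw.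
have rw : rho (H (val x)) <= cmp_cst CA 2 * rho (H (val w)).
  by apply: rho_close; rewrite metric_sym; lra.
have m0 : 0 <= m' by rewrite le_min mdist_ge0 ltW// height_gt0.
have mm : m <= m' + 2 * d.
  have dww : mdist (val x) (val y) <= mdist (val w) (val w') + 2 * d.
    have := metric_triangle (val x) (val w) (val y).
    have := metric_triangle (val w) (val w') (val y).
    by rewrite (metric_sym (val x) (val w)); lra.
  have hx := height_le b (val x) (val w); rewrite (metric_sym (val x)) in hx.
  have ma : m <= mdist (val x) (val y) by rewrite ge_min lexx.
  have mb : m <= H (val x) by rewrite ge_min lexx orbT.
  by rewrite -lerBlDr le_min; lra.
have C1 : 1 <= cmp_cst CA 2 by rewrite cmp_cst_ge1// condA_cst_ge1.
have : B * m' <= mdist (iota w) (iota w').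
  apply: le_trans dw; rewrite ler_wpM2r// /B /blo_cst -mulrA.
  rewrite ler_wpM2l ?(ltW lo_cst_gt0)//.
  by rewrite ler_pdivrMl//; lra.
have BB : B * m <= B * (m' + 2 * d) by rewrite ler_wpM2l.
have := metric_triangle (iota w) (val (j x)) (iota w').
have := metric_triangle (val (j x)) (val (j y)) (iota w').
by rewrite (metric_sym (val (j y)) (iota w')) => t1 t2 t3; lra.
Qed.

(** Points of the domain near [x] stay at a definite deformed distance from
    all points of large height, by the lower bound for the deformed distance. *)
Lemma boundary_neq_infty x : j x <> infty.
Proof.
move=> jx; set B := blo_cst CA * rho (H (val x)).
have B0 : 0 < B by rewrite mulr_gt0 ?blo_cst_gt0 ?rho_gt0 ?height_gt0.
have ex n : exists w : set_type Omega, n%:R < H (val w).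
  have [w Ow nw] := unbounded_height b n%:R Omegaoo.
  by exists (exist _ w (mem_set Ow)).
have [w wP] := choice ex.
have woo : absb b (val (w n)) @[n --> \oo] --> +oo.
  apply/cvgryPge => M; near=> n.
  have : M + 1 <= n%:R by near: n; exact: nbhs_infty_ger.
  by have := wP n; rewrite /height; lra.
have := jP.2 w woo => /cvgrPdist_lt.
pose d := Num.min 2^-1 (B / 4).
have d0 : 0 < d by rewrite /d lt_min invr_gt0 ltr0n divr_gt0.
have d1 : d <= 2^-1 by rewrite /d ge_min lexx.
have d2 : d <= B / 4 by rewrite /d ge_min lexx orbT.
have [v [vx vjx]] := boundary_approx x d0.
move=> /(_ _ d0) wi.
near \oo => n.
have iw : mdist (val infty) (iota (w n)) < d by near: n.
have far : 2 * H (val v) <= n%:R by near: n; exact: nbhs_infty_ger.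
have := d_rho_ge b rho_gt0 rhoA (set_valP v) (set_valP (w n)).
rewrite -iota_dist_ge min_r; last first.
  have := height_le b (val (w n)) (val v); rewrite metric_sym.
  by have := wP n; lra.
have C1 : 1 <= cmp_cst CA 2 by rewrite cmp_cst_ge1// condA_cst_ge1.
have rw : rho (H (val x)) <= cmp_cst CA 2 * rho (H (val v)).
  by apply: rho_close; rewrite metric_sym; lra.
have BB : B <= lo_cst CA * rho (H (val v)).
  by rewrite /B /blo_cst -mulrA ler_wpM2l ?(ltW lo_cst_gt0)// ler_pdivrMl//; lra.
have Hv := height_ge1 b (val v).
have : B * 1 <= lo_cst CA * rho (H (val v)) * H (val v) by rewrite ler_pM// ltW.
have := metric_triangle (iota v) (val (j x)) (iota (w n)).
by rewrite {2}jx; lra.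
Unshelve. all: by end_near. Qed.

Lemma boundary_inj : injective j.
Proof.
move=> x y jxy; have := boundary_dist_ge x y.
rewrite jxy mdistxx => h; apply: mdist_positivity; apply/eqP.
rewrite eq_le mdist_ge0 andbT leNgt; apply/negP => xy.
have m0 : 0 < Num.min (mdist x y) (H (val x)) by rewrite lt_min xy height_gt0.
have r0 : 0 < rho (H (val x)) by rewrite rho_gt0// height_gt0.
have : 0 < blo_cst CA * rho (H (val x)) * Num.min (mdist x y) (H (val x)).
  by apply: mulr_gt0 => //; apply: mulr_gt0 => //; exact: blo_cst_gt0.
by move: h; rewrite leNgt => /negP.
Qed.

Lemma boundary_continuous : continuous j.
Proof.
move=> x; have FF : Filter (nbhs x) by exact: nbhs_filter.
apply/cvgrPdist_le => e e0.
set B := bup_cst CA CU 2 * rho (H (val x)).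
have B0 : 0 < B by rewrite mulr_gt0 ?bup_cst_gt0 ?rho_gt0 ?height_gt0.
have d0 : 0 < Num.min 2^-1 (e / B) by rewrite lt_min divr_gt0// andbT.
have := nbhsx_ballx x _ d0; apply: filterS => y; rewrite ballEmdist /= => xy.
have xy2 : mdist x y <= 2^-1 by apply: ltW; apply: (lt_le_trans xy); rewrite ge_min lexx.
have xy3 : mdist x y <= e / B by apply: ltW; apply: (lt_le_trans xy); rewrite ge_min lexx orbT.
have := height_le b (val x) (val y); have := height_le b (val y) (val x).
rewrite (metric_sym (val y)) -!mdist_val => h1 h2.
have := height_ge1 b (val x); have := height_ge1 b (val y) => hx hy.
apply: (le_trans (@boundary_dist_le 2 _ _ _ _ _)); rewrite ?ler1n//; try lra.
by rewrite -/B mulrC -ler_pdivlMr.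
Qed.

(** On sets of bounded height the two distances have the same Cauchy sequences,
    and these converge in the boundary, which is closed in a complete space. *)
Lemma boundary_closed_image (F : set (bdry Omega)) (M : R) :
  closed F -> (forall x, F x -> H (val x) <= M) -> closed (j @` F).
Proof.
move=> cF FM z /= clz.
have ex n : exists x, F x /\ mdist z (j x) < n.+1%:R^-1.
  have := clz (ball z n.+1%:R^-1) => [] [].
    by apply: nbhsx_ballx; rewrite invr_gt0.
  by move=> _ [[x Fx <-]]; rewrite ballEmdist /= => zx; exists x.
have [u uP] := choice ex.
have ujz : j \o u @ \oo --> z.
  apply/cvgrPdist_lt => d d0; near=> n.
  apply: (lt_trans (uP n).2); near: n.
  exact: near_infty_natSinv_lt (PosNum d0).
have M0 : 0 < M by have := FM _ (uP 0%N).1; have := height_ge1 b (val (u 0%N)); lra.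
pose c := blo_cst CA * (rho 1 / cmp_cst CA (2 * M)).
have C1 : 1 <= cmp_cst CA (2 * M) by rewrite cmp_cst_ge1// condA_cst_ge1.
have c0 : 0 < c by rewrite mulr_gt0 ?blo_cst_gt0// divr_gt0 ?rho_gt0//; lra.
have lb x y : F x -> Num.min (mdist x y) 1 <= c^-1 * mdist (j x) (j y).
  move=> Fx; rewrite mulrC ler_pdivlMr// mulrC.
  apply: le_trans (boundary_dist_ge x y).
  have Hx := height_ge1 b (val x); have HM := FM _ Fx.
  apply: ler_pM => //; first exact: ltW.
  - by rewrite le_min mdist_ge0 ler01.
  - rewrite /c ler_wpM2l ?(ltW blo_cst_gt0)// ler_pdivrMr; last by lra.
    by rewrite mulrC; apply: (rho_cmp rho_gt0 rhoA) => //; nra.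
  - rewrite le_min ge_min lexx /= ge_min Hx orbT //.
have Oo : open Omega by have [lc _ _] := OmegaU; exact: locally_compact_dense_open.
have cau : cauchy ((fun n => val (u n) : X) @ \oo).
  apply/cauchy_exP => e e0.
  pose d := Num.min e 2^-1 * c / 2.
  have d0 : 0 < d by rewrite divr_gt0// mulr_gt0// lt_min e0/= invr_gt0.
  move/cvgrPdist_lt : (ujz) => /(_ _ d0) [N _ Nd].
  exists (val (u N)); exists N => // n /= Nn.
  rewrite ballEmdist /= -mdist_val.
  have := lb (u N) (u n) (uP N).1.
  have := metric_triangle (j (u N)) z (j (u n)).
  have := Nd _ (leqnn N); have := Nd _ Nn.
  rewrite /= (metric_sym z (j (u N))) => z1 z2 z3.
  have : mdist (j (u N)) (j (u n)) < Num.min e 2^-1 * c.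
    by rewrite /d in z1 z2; lra.
  move=> h lbn.
  have : Num.min (mdist (u N) (u n)) 1 < Num.min e 2^-1.
    by apply: (le_lt_trans lbn); rewrite mulrC ltr_pdivrMr.
  rewrite lt_min => /andP[]; rewrite !gt_min => h1 /orP[h2|]; last by lra.
  by move: h1 => /orP[//|e1]; lra.
have [l _ ul] := Xc (fun n => I : [set: X] (val (u n))) cau.
have Ol : (~` Omega) l.
  apply: (closed_cvg (~` Omega) _ _ _ ul) => //; first exact: open_closedC.
  by apply: nearW => n; exact: set_valP.
pose x : bdry Omega := exist _ l (mem_set Ol).
have ux : u @ \oo --> x.
  apply/cvgrPdist_lt => d d0; move/cvgrPdist_lt : ul => /(_ _ d0).
  exact.
exists x.
  by apply: (closed_cvg F _ _ _ ux) => //; apply: nearW => n; exact: (uP n).1.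
apply: (@cvg_unique _ (@metric_hausdorff _ _) (j \o u @ \oo)) => //.
by apply: cvg_comp; [exact: ux|exact: boundary_continuous].
Unshelve. all: by end_near. Qed.

End boundary_distance.

(** * A doubling measure on annuli *)

Section annuli.
Context {R : realType} {Z : metricType R} (b : Z).
Variable nu : {measure set (borel b) -> \bar R}.
Variables (D kappa : R).
Hypothesis nu_gt0 : forall (x : Z) r, 0 < r -> (0 < nu (ball x r))%E.
Hypothesis nu_fin : forall (x : Z) r, 0 < r -> (nu (ball x r) < +oo)%E.
Hypothesis nuD : forall (x : Z) r, 0 < r ->
  (nu (ball x (2 * r)) <= D%:E * nu (ball x r))%E.
Hypothesis kappa_gt1 : 1 < kappa.
Hypothesis perfect : forall (a : Z) r, 0 < r -> exists z,
  r <= mdist a z /\ mdist a z < kappa * r.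

Lemma borel_open (A : set Z) : open A -> measurable (A : set (borel b)).
Proof. by move=> oA; exact: sub_sigma_algebra. Qed.

Lemma borel_closed (A : set Z) : closed A -> measurable (A : set (borel b)).
Proof.
move=> cA; rewrite -[A]setCK; apply: measurableC; apply: borel_open.
exact: closed_openC.
Qed.

Lemma borel_set1 (x : Z) : measurable ([set x] : set (borel b)).
Proof.
apply: borel_closed; apply: accessible_closed_set1.
exact/hausdorff_accessible/metric_hausdorff.
Qed.

Lemma borel_ball (x : Z) r : measurable (ball x r : set (borel b)).
Proof.
have [r0|r0] := ltP 0 r; last first.
  suff -> : ball x r = set0 by exact: measurable0.
  apply/seteqP; split => // y; rewrite ballEmdist /= => h.
  by have := mdist_ge0 x y; lra.
apply: borel_open; rewrite openE => y; rewrite ballEmdist /= => xy.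
apply/nbhs_ballP; exists (r - mdist x y); first by rewrite /= subr_gt0.
move=> z; rewrite !ballEmdist /= => yz.
by have := metric_triangle x y z; lra.
Qed.

Lemma continuous_measurable {Z' : metricType R} (z' : Z') (f : Z -> Z') :
  continuous f -> measurable_fun setT (f : borel b -> borel z').
Proof.
move=> cf; apply: (@measurability _ _ (borel b) (borel z') setT f (@open Z')) => //.
move=> _ [B oB <-]; rewrite setTI; apply: borel_open.
by apply: open_comp => // x _; exact: cf.
Qed.

Definition vol (x : Z) r : R := fine (nu (ball x r)).

Lemma volE x r : 0 < r -> (vol x r)%:E = nu (ball x r).
Proof. by move=> r0; rewrite /vol fineK// ge0_fin_numE// nu_fin. Qed.

Lemma vol_gt0 x r : 0 < r -> 0 < vol x r.
Proof. by move=> r0; rewrite -lte_fin volE// nu_gt0. Qed.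

Lemma le_ball_mdist (x y : Z) r r' : r + mdist x y <= r' -> ball x r `<=` ball y r'.
Proof.
move=> h z; rewrite !ballEmdist /= => xz.
by have := metric_triangle y x z; rewrite (metric_sym y x); lra.
Qed.

Lemma vol_le x y r r' : 0 < r -> r + mdist x y <= r' -> vol x r <= vol y r'.
Proof.
move=> r0 h; have r'0 : 0 < r' by have := mdist_ge0 x y; lra.
rewrite -lee_fin !volE//; apply: le_measure; rewrite ?inE; [exact: borel_ball..|].
exact: le_ball_mdist.
Qed.

Lemma doubling_ge1 : 1 <= D.
Proof.
have := nuD b (ltr01); rewrite -!volE// -EFinM lee_fin mulr1 => h.
have v1 := vol_gt0 b ltr01.
have : vol b 1 <= vol b 2 by apply: vol_le => //; rewrite mdistxx; lra.
by rewrite -(ler_pM2r v1) mul1r; lra.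
Qed.

Lemma vol_exp x r n : 0 < r -> vol x (2 ^+ n * r) <= D ^+ n * vol x r.
Proof.
move=> r0; elim: n => [|n IHn]; first by rewrite !expr0 !mul1r.
have p0 : 0 < 2 ^+ n * r by rewrite mulr_gt0// exprn_gt0.
rewrite !exprS -!mulrA; apply: (@le_trans _ _ (D * vol x (2 ^+ n * r))).
  by rewrite -lee_fin EFinM !volE ?mulr_gt0 ?exprn_gt0// nuD.
by rewrite ler_wpM2l//; have := doubling_ge1; lra.
Qed.

(** As for [rho], a ratio [K] is turned into [truncn K + 1] doublings. *)
Definition dbl_cst (K : R) : R := D ^+ (Num.truncn K).+1.

Lemma dbl_cst_ge1 K : 1 <= dbl_cst K.
Proof. by rewrite exprn_ege1// doubling_ge1. Qed.

Lemma dbl_cst_gt0 K : 0 < dbl_cst K.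
Proof. exact: lt_le_trans ltr01 (dbl_cst_ge1 K). Qed.

Lemma vol_cmp K x y r r' : 0 < r -> 0 < r' -> r' + mdist x y <= K * r ->
  vol y r' <= dbl_cst K * vol x r.
Proof.
move=> r0 r'0 h.
have K0 : 0 <= K.
  by rewrite -(pmulr_lge0 _ r0); have := mdist_ge0 x y; lra.
have K2 : K <= 2 ^+ (Num.truncn K).+1.
  have /andP[_ /ltW/le_trans] := truncn_itv K0; apply.
  by rewrite -natrX ler_nat ltnW// ltn_expl.
apply: le_trans (vol_exp x _ r0); apply: vol_le => //.
by rewrite metric_sym (le_trans h)// ler_wpM2r// ltW.
Qed.

(** With this ratio the annuli are so wide that, by uniform perfectness, each
    of them contains a ball of comparable radius around one of its points. *)
Definition q : R := 2 * kappa + 2.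

Lemma q_gt4 : 4 < q. Proof. by rewrite /q; have := kappa_gt1; lra. Qed.

Lemma q_gt0 : 0 < q. Proof. by have := q_gt4; lra. Qed.

Lemma qX_gt0 k : 0 < q ^+ k. Proof. exact/exprn_gt0/q_gt0. Qed.

Lemma qX_ge1 k : 1 <= q ^+ k.
Proof. by apply: exprn_ege1; have := q_gt4; lra. Qed.

Lemma ler_qX i k : (i <= k)%N -> q ^+ i <= q ^+ k.
Proof. by move=> ik; apply: ler_weXn2l => //; have := q_gt4; lra. Qed.

Definition hgt (x : Z) : R := mdist x b + 1.

Lemma hgt_ge1 x : 1 <= hgt x. Proof. by rewrite lerDr mdist_ge0. Qed.

Lemma hgt_gt0 x : 0 < hgt x. Proof. exact: lt_le_trans (hgt_ge1 x). Qed.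

Lemma hgt_le x y : hgt x <= hgt y + mdist x y.
Proof. by rewrite addrAC lerD2r addrC; exact: metric_triangle. Qed.

Lemma mdist_le_hgt x y : mdist x y + 2 <= hgt x + hgt y.
Proof.
have := metric_triangle x b y; rewrite (metric_sym b y) => h.
by rewrite /hgt; lra.
Qed.

Definition annulus (k : nat) : set Z := [set x | q ^+ k <= hgt x < q ^+ k.+1].

Lemma hgt_annulus x : exists k, annulus k x.
Proof.
have [n xn] : exists n, hgt x < q ^+ n.
  exists (Num.truncn (hgt x)).+1.
  have /andP[_ /lt_le_trans] := truncn_itv (ltW (hgt_gt0 x)); apply.
  apply: (@le_trans _ _ (2 ^+ (Num.truncn (hgt x)).+1)).
    by rewrite -natrX ler_nat ltnW// ltn_expl.
  have q2 : 2 <= q by have := q_gt4; lra.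
  by rewrite lerXn2r// nnegrE ltW// q_gt0.
elim: n xn => [|n IHn] xn; first by have := hgt_ge1 x; rewrite expr0 in xn; lra.
by have [/IHn//|h] := ltP (hgt x) (q ^+ n); exists n; rewrite /annulus /= h.
Qed.

Lemma annulus_le i k x y : annulus i x -> annulus k y -> hgt x <= hgt y -> (i <= k)%N.
Proof.
move=> /andP[ix _] /andP[_ yk] xy; rewrite leqNgt; apply/negP => ki.
by have := ler_qX ki; lra.
Qed.

Lemma annulus_inj i k x : annulus i x -> annulus k x -> i = k.
Proof.
move=> ix kx; apply/eqP; rewrite eqn_leq.
by rewrite (annulus_le ix kx)// (annulus_le kx ix).
Qed.

Lemma trivIset_annulus : trivIset setT annulus.
Proof. by move=> i k _ _ [x [ix kx]]; exact: annulus_inj ix kx. Qed.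

Lemma bigcup_annulus : \bigcup_k annulus k = setT.
Proof. by apply/seteqP; split => // x _; have [k kx] := hgt_annulus x; exists k. Qed.

Lemma hgt_continuous : continuous hgt.
Proof.
move=> x; have FF : Filter (nbhs x) by exact: nbhs_filter.
apply/pseudometric_normed_Zmodule.cvgrPdist_le => e e0; near=> y.
have xy : mdist x y < e.
  by near: y; have := nbhsx_ballx x e e0; rewrite ballEmdist.
have := hgt_le x y; have := hgt_le y x; rewrite (metric_sym y) => h1 h2.
by rewrite ler_norml; lra.
Unshelve. all: by end_near. Qed.

Lemma measurable_annulus k : measurable (annulus k : set (borel b)).
Proof.
rewrite (_ : annulus k = hgt @^-1` [set t | q ^+ k <= t] `&`
                         hgt @^-1` [set t | t < q ^+ k.+1]); last first.
  by apply/seteqP; split => x /=; [move=> /andP[]|move=> [h1 h2]; apply/andP].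
apply: measurableI.
  apply: borel_closed; apply: preimage_closed; last exact: closed_ge.
  by move=> x _; exact: hgt_continuous.
apply: borel_open; apply: open_comp; last exact: open_lt.
by move=> x _; exact: hgt_continuous.
Qed.

Definition mass (k : nat) : R := fine (nu (annulus k)).

Lemma annulus_sub_ball k : annulus k `<=` ball b (q ^+ k.+1).
Proof.
by move=> x /andP[_]; rewrite ballEmdist /= metric_sym /hgt; lra.
Qed.

Lemma massE k : (mass k)%:E = nu (annulus k).
Proof.
rewrite /mass fineK// ge0_fin_numE//.
apply: le_lt_trans (nu_fin b (qX_gt0 k.+1)).
apply: le_measure; rewrite ?inE; [exact: measurable_annulus|exact: borel_ball|].
exact: annulus_sub_ball.
Qed.

Lemma annulus_ball k : exists z, [/\ ball z (q ^+ k) `<=` annulus k,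
  annulus k z & mdist z b <= 2 * kappa * q ^+ k].
Proof.
have k1 := qX_ge1 k.
have [|z [z1 z2]] := @perfect b (2 * q ^+ k); first by lra.
have sub : ball z (q ^+ k) `<=` annulus k.
  move=> x; rewrite ballEmdist /= => zx.
  have := metric_triangle b x z; have := metric_triangle b z x.
  rewrite (metric_sym x z) (metric_sym b x) => h1 h2.
  rewrite /annulus /= /hgt exprS /q; apply/andP; split; first by lra.
  by rewrite mulrDl; rewrite -mulrA in z2 *; lra.
exists z; split => //.
  by apply: sub; rewrite ballEmdist /= mdistxx; lra.
by rewrite metric_sym; lra.
Qed.

Lemma vol_le_mass K k y r : 0 < r -> r + mdist y b <= K * q ^+ k ->
  vol y r <= dbl_cst (K + 2 * kappa) * mass k.
Proof.
move=> r0 h; have [z [zk _ zb]] := annulus_ball k.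
apply: (@le_trans _ _ (dbl_cst (K + 2 * kappa) * vol z (q ^+ k))).
  apply: vol_cmp => //; first exact: qX_gt0.
  by rewrite mulrDl; have := metric_triangle z b y; rewrite (metric_sym b y); lra.
rewrite ler_wpM2l ?(ltW (dbl_cst_gt0 _))// -lee_fin massE volE ?qX_gt0//.
apply: le_measure; rewrite ?inE; [exact: borel_ball|exact: measurable_annulus|].
exact: zk.
Qed.

Lemma mass_le_vol K k x r : 0 < r -> q ^+ k.+1 + mdist x b <= K * r ->
  mass k <= dbl_cst K * vol x r.
Proof.
move=> r0 h; apply: (@le_trans _ _ (vol b (q ^+ k.+1))).
  rewrite -lee_fin massE volE ?qX_gt0//.
  apply: le_measure; rewrite ?inE; [exact: measurable_annulus|exact: borel_ball|].
  exact: annulus_sub_ball.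
by apply: vol_cmp => //; exact: qX_gt0.
Qed.

Lemma mass_gt0 k : 0 < mass k.
Proof.
have := @vol_le_mass 1 k b (q ^+ k); rewrite mdistxx addr0 mul1r => h.
have := h (qX_gt0 k) (lexx _); rewrite -(pmulr_rgt0 _ (dbl_cst_gt0 (1 + 2 * kappa))).
by apply: lt_le_trans; exact/vol_gt0/qX_gt0.
Qed.

(** The measure of a ball around [b] exceeds that of a much smaller one by a
    fixed factor, as uniform perfectness places a disjoint ball of comparable
    measure inside. Hence the measure of small balls tends to zero. *)
Lemma nu_center : nu [set b : borel b] = 0%E.
Proof.
have kappa1 := kappa_gt1; pose c := (dbl_cst (2 * kappa + 1))^-1.
have c0 : 0 < c by rewrite invr_gt0 dbl_cst_gt0.
have step r : 0 < r -> (1 + c) * vol b r <= vol b (4 * kappa * r).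
  move=> r0; have kr : r < kappa * r by rewrite ltr_pMl.
  have [|z [z1 z2]] := @perfect b (2 * r); first by lra.
  have volz : vol b r <= dbl_cst (2 * kappa + 1) * vol z r.
    by apply: vol_cmp => //; rewrite metric_sym; lra.
  have cz : c * vol b r <= vol z r by rewrite ler_pdivrMl// dbl_cst_gt0.
  suff : vol b r + vol z r <= vol b (4 * kappa * r) by lra.
  have kr0 : 0 < 4 * kappa * r by lra.
  rewrite -lee_fin EFinD !volE// -measureU; [|exact: borel_ball..|]; last first.
    apply/seteqP; split => // y; rewrite !ballEmdist /= => -[by' zy].
    by have := metric_triangle b y z; rewrite (metric_sym y); lra.
  apply: le_measure; rewrite ?inE; [|exact: borel_ball|].
    by apply: measurableU; exact: borel_ball.
  move=> y [] h; apply: le_ball_mdist h; rewrite ?mdistxx; first by lra.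
  by rewrite metric_sym; lra.
have k4 : 0 < 4 * kappa by lra.
have iter n : (1 + c) ^+ n * vol b ((4 * kappa) ^- n) <= vol b 1.
  elim: n => [|n IHn]; first by rewrite !expr0 invr1 mul1r.
  apply: le_trans IHn; rewrite exprSr -mulrA ler_wpM2l ?exprn_ge0//; first by lra.
  have E : (4 * kappa) ^- n = 4 * kappa * (4 * kappa) ^- n.+1.
    by rewrite exprS invfM mulVKf// lt0r_neq0.
  rewrite [X in _ <= vol b X]E.
  by apply: step; rewrite invr_gt0 exprn_gt0.
have le r : 0 < r -> (nu [set b : borel b] <= nu (ball b r))%E.
  move=> r0; apply: le_measure; rewrite ?inE; [exact: borel_set1|exact: borel_ball|].
  by move=> _ ->; rewrite ballEmdist /= mdistxx.
have fb : (nu [set b : borel b] < +oo)%E by apply: le_lt_trans (nu_fin b ltr01); exact: le.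
pose t := fine (nu [set b : borel b]).
have tE : t%:E = nu [set b : borel b] by rewrite /t fineK// ge0_fin_numE.
have t0 : 0 <= t by rewrite -lee_fin tE.
rewrite -tE; congr EFin; apply/eqP; rewrite eq_le t0 andbT leNgt; apply/negP => tp.
have H n : (1 + c) ^+ n * t <= vol b 1.
  apply: le_trans (iter n); rewrite ler_wpM2l ?exprn_ge0//; first by lra.
  by rewrite -lee_fin tE volE ?le// invr_gt0 exprn_gt0.
have B n : 1 + n%:R * c <= (1 + c) ^+ n.
  elim: n => [|n IHn]; first by rewrite mul0r addr0 expr0.
  have n0 : 0 <= n%:R * c * c :> R by rewrite !mulr_ge0// ltW.
  have : (1 + c) * (1 + n%:R * c) <= (1 + c) * (1 + c) ^+ n by rewrite ler_wpM2l//; lra.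
  by rewrite exprS -[n.+1]addn1 natrD; lra.
pose n := (Num.truncn (vol b 1 / (c * t))).+1.
have : vol b 1 / (c * t) < n%:R.
  have v0 : 0 <= vol b 1 / (c * t) by rewrite divr_ge0 ?ltW ?mulr_gt0 ?vol_gt0.
  by have /andP[] := truncn_itv v0.
rewrite ltr_pdivrMr ?mulr_gt0// => h.
have : (1 + n%:R * c) * t <= (1 + c) ^+ n * t by rewrite ler_wpM2r.
by have := H n; lra.
Qed.

End annuli.

(** * A discrete Hardy inequality *)

(** Solving the recursion; the induction carries the term
    [eta / (1 - eta) * e n], the part of the geometric series still to come. *)
Lemma geometric_sum_le {R : realType} (e c : nat -> \bar R) (eta : R) (M : nat) :
  0 <= eta < 1 -> (forall k, 0 <= e k)%E -> (forall k, 0 <= c k)%E ->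
  e 0%N = 0%E -> (forall k, (k < M)%N -> e k.+1 <= eta%:E * e k + c k)%E ->
  (\sum_(0 <= k < M.+1) e k <= ((1 - eta)^-1)%:E * \sum_(0 <= k < M) c k)%E.
Proof.
move=> /andP[eta0 eta1] e0 c0 e00 H.
have i0 : 0 < 1 - eta by rewrite subr_gt0.
have nz : 1 - eta != 0 by rewrite lt0r_neq0.
pose z := eta / (1 - eta); have z0 : 0 <= z by rewrite divr_ge0// ltW.
have zE : 1 + z = (1 - eta)^-1 by rewrite /z; field.
have zE2 : (1 + z) * eta = z by rewrite zE /z mulrC.
suff main n : (n <= M)%N ->
    (\sum_(0 <= k < n.+1) e k + z%:E * e n <=
     ((1 - eta)^-1)%:E * \sum_(0 <= k < n) c k)%E.
  apply: le_trans (main M (leqnn _)); by rewrite leeDl// mule_ge0.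
elim: n => [_|n IHn nM]; first by rewrite !big_nat1 big_geq// e00 mule0 adde0 mule0.
rewrite big_nat_recr//= [X in (_ <= _ * X)%E]big_nat_recr//=.
rewrite ge0_muleDr ?sume_ge0//.
apply: le_trans (leeD (IHn (ltnW nM)) (lexx _)).
rewrite -addeA -[X in (_ + (X + _) <= _)%E]mul1e -ge0_muleDl ?lee_fin//.
rewrite -EFinD zE -addeA leeD2l//.
apply: (@le_trans _ _ (((1 - eta)^-1)%:E * (eta%:E * e n + c n))%E).
  by rewrite lee_wpmul2l ?H// lee_fin invr_ge0 ltW.
rewrite ge0_muleDr ?mule_ge0 ?lee_fin//.
by rewrite muleA -EFinM -zE zE2 leeD2r.
Qed.

Section hardy.
Context {R : realType}.
Variables (a : nat -> nat -> \bar R) (U Dw : nat -> R) (T CT C0 eta : R) (M : nat).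
Hypothesis a_ge0 : forall i k, (0 <= a i k)%E.
Hypothesis T_ge1 : 1 <= T.
Hypothesis CT_ge0 : 0 <= CT.
Hypothesis C0_ge0 : 0 <= C0.
Hypothesis eta01 : 0 <= eta < 1.
Hypothesis U_ge0 : forall k, 0 <= U k.
Hypothesis Dw_ge0 : forall k, 0 <= Dw k.
Hypothesis tri : forall i k, (i < k < M)%N ->
  (a i k.+1 <= T%:E * a i k + CT%:E * a k k.+1)%E.
Hypothesis U_sum : forall k, (k < M)%N -> \sum_(0 <= i < k) U i <= C0 * U k.
Hypothesis Dw_decay : forall k, (k < M)%N -> T * Dw k.+1 <= eta * Dw k.

(** The quantity [a i k] is thought of as the mean oscillation between the
    annuli [i] and [k]; the sum over all pairs is bounded by the sum over
    neighbours. By [tri] the column sums [P] satisfy an affine recursion, whose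
    factor [T] is compensated by the decay of the weights [Dw]. *)
Lemma hardy_sum :
  (\sum_(0 <= k < M.+1) \sum_(0 <= i < k) (U i * Dw k)%:E * a i k <=
   ((1 - eta)^-1 * (CT * C0 + 1))%:E *
     \sum_(0 <= k < M) (U k * Dw k)%:E * a k k.+1)%E.
Proof.
have T0 : 0 <= T by exact: le_trans ler01 T_ge1.
pose P k := (\sum_(0 <= i < k) (U i)%:E * a i k)%E.
have P0 k : (0 <= P k)%E by rewrite sume_ge0// => i _; rewrite mule_ge0// lee_fin.
have e0 k : (0 <= (Dw k)%:E * P k)%E by rewrite mule_ge0// lee_fin.
have [eta0 eta1] := andP eta01.
pose c k := ((CT * C0 + 1)%:E * ((U k * Dw k)%:E * a k k.+1))%E.
have step k : (k < M)%N ->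
    ((Dw k.+1)%:E * P k.+1 <= eta%:E * ((Dw k)%:E * P k) + c k)%E.
  move=> kM; have CU : 0 <= C0 * U k.
    by apply: le_trans (U_sum kM); rewrite sumr_ge0.
  have h : (P k.+1 <= T%:E * P k + (CT * (C0 * U k) + U k)%:E * a k k.+1)%E.
    rewrite /P big_nat_recr//= EFinD ge0_muleDl ?lee_fin ?mulr_ge0// addeA.
    apply: leeD => //.
    apply: (@le_trans _ _ (\sum_(0 <= i < k)
        (T%:E * ((U i)%:E * a i k) + (U i)%:E * (CT%:E * a k k.+1)))%E).
      rewrite !big_mkord; apply: lee_sum => i _.
      apply: (@le_trans _ _ ((U i)%:E * (T%:E * a i k + CT%:E * a k k.+1))%E).
        by rewrite lee_wpmul2l ?lee_fin// tri// ltn_ord.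
      by rewrite ge0_muleDr ?mule_ge0 ?lee_fin// muleCA.
    rewrite big_split/= -ge0_sume_distrr; last by move=> i _; rewrite mule_ge0 ?lee_fin.
    rewrite leeD2l// -ge0_sume_distrl; last by move=> i _; rewrite lee_fin.
    rewrite sumEFin muleA -EFinM; apply: lee_wpmul2r => //.
    by rewrite lee_fin mulrC ler_wpM2l// U_sum.
  apply: (@le_trans _ _ ((Dw k.+1)%:E *
      (T%:E * P k + (CT * (C0 * U k) + U k)%:E * a k k.+1))%E).
    by rewrite lee_wpmul2l ?lee_fin.
  rewrite ge0_muleDr; last 2 first.
  - by rewrite mule_ge0// lee_fin.
  - by rewrite mule_ge0// lee_fin addr_ge0// mulr_ge0.
  rewrite !muleA -!EFinM; apply: leeD.
    by rewrite lee_wpmul2r// lee_fin mulrC Dw_decay.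
  rewrite /c muleA -EFinM lee_wpmul2r// lee_fin.
  have Dk : Dw k.+1 <= Dw k.
    have := Dw_decay kM; have h1 : Dw k.+1 <= T * Dw k.+1 by rewrite ler_peMl.
    have : eta * Dw k <= Dw k by rewrite ler_piMl// ltW.
    by lra.
  rewrite (_ : (CT * C0 + 1) * (U k * Dw k) = Dw k * (CT * (C0 * U k) + U k)); last by ring.
  by rewrite ler_wpM2r// addr_ge0// mulr_ge0.
have c0 k : (0 <= c k)%E.
  by rewrite /c muleA -EFinM mule_ge0// lee_fin !mulr_ge0 ?addr_ge0 ?mulr_ge0.
apply: (@le_trans _ _ (\sum_(0 <= k < M.+1) (Dw k)%:E * P k)%E).
  apply: lee_sum => k _; rewrite /P ge0_sume_distrr; last first.
    by move=> i _; rewrite mule_ge0// lee_fin.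
  by apply: lee_sum => i _; rewrite muleA -EFinM mulrC.
have := @geometric_sum_le R (fun k => (Dw k)%:E * P k)%E c eta M eta01 e0 c0.
rewrite /P big_geq// mule0 => /(_ erefl step) h.
apply: (le_trans h); rewrite EFinM -muleA lee_wpmul2l//.
  by rewrite lee_fin invr_ge0; lra.
rewrite /c -ge0_sume_distrr//.
by move=> k _; rewrite mule_ge0// lee_fin mulr_ge0.
Qed.

End hardy.

(** * Mean oscillations over pairs of annuli *)

Lemma powR_le_mul {R : realType} (s x c y : R) : 0 <= s -> 0 <= x -> 0 <= c ->
  0 <= y -> x <= c * y -> x `^ s <= c `^ s * y `^ s.
Proof.
move=> s0 x0 c0 y0 xcy; rewrite -powRM//.
by apply: ge0_ler_powR => //; rewrite nnegrE// mulr_ge0.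
Qed.

(** Whichever of [x] and [y] dominates, up to the factor [e], dominates the
    sum. *)
Lemma powR_add_le {R : realType} (p e x y : R) : 0 <= p -> 0 < e -> 0 <= x -> 0 <= y ->
  (x + y) `^ p <= (1 + e) `^ p * x `^ p + (1 + e^-1) `^ p * y `^ p.
Proof.
move=> p0 e0 x0 y0; have ei : 0 < e^-1 by rewrite invr_gt0.
have [yx|xy] := leP y (e * x).
  apply: (@le_trans _ _ ((1 + e) `^ p * x `^ p)).
    apply: powR_le_mul => //; [exact: addr_ge0|lra|lra].
  by rewrite lerDl mulr_ge0 ?powR_ge0.
apply: (@le_trans _ _ ((1 + e^-1) `^ p * y `^ p)).
  apply: powR_le_mul => //; [exact: addr_ge0|lra|].
  have : x < e^-1 * y by rewrite ltr_pdivlMl.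
  by lra.
by rewrite lerDr mulr_ge0 ?powR_ge0.
Qed.

Section block_integrals.
Context d (T : measurableType d) (R : realType).
Variables (mu : {measure set T -> \bar R}) (S : nat -> set T) (V : nat -> R).
Variables (idx : T -> nat) (u : T -> R) (p : R).
Hypothesis mS : forall k, measurable (S k).
Hypothesis tS : trivIset setT S.
Hypothesis cS : \bigcup_k S k = setT.
Hypothesis VE : forall k, (V k)%:E = mu (S k).
Hypothesis V_gt0 : forall k, 0 < V k.
Hypothesis idxP : forall x, S (idx x) x.
Hypothesis mu_meas : measurable_fun setT u.
Hypothesis p_ge0 : 0 <= p.
Hypothesis p_neq0 : p != 0.

Local Open Scope ereal_scope.

Definition osc (x y : T) : \bar R := (`|u y - u x| `^ p)%:E.

Lemma osc_ge0 x y : 0 <= osc x y. Proof. by rewrite lee_fin powR_ge0. Qed.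

Lemma osc_sym x y : osc x y = osc y x. Proof. by rewrite /osc distrC. Qed.

Lemma oscxx x : osc x x = 0.
Proof. by rewrite /osc subrr normr0 powR0. Qed.

Lemma measurable_osc : measurable_fun setT (fun z : T * T => osc z.1 z.2).
Proof.
apply/measurable_EFinP; apply: (measurableT_comp (measurable_powR p)).
apply: measurableT_comp => //; apply: measurable_funB.
  exact: measurableT_comp.
exact: measurableT_comp.
Qed.

Lemma measurable_osc2 x : measurable_fun setT (osc x).
Proof.
apply/measurable_EFinP; apply: (measurableT_comp (measurable_powR p)).
apply: measurableT_comp => //; exact: measurable_funB.
Qed.

Lemma sigma_finite_pieces : sigma_finite setT mu.
Proof. by exists S => // k; split => //; rewrite -VE ltry. Qed.

(** Under this name the measure [mu] carries its sigma-finiteness, which the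
    exchange of the order of integration refers to. *)
Definition sf_mu : set T -> \bar R := mu.
HB.instance Definition _ := Measure.on sf_mu.
HB.instance Definition _ :=
  @Measure_isSigmaFinite.Build d T R sf_mu sigma_finite_pieces.

Definition block1 (k : nat) (x : T) : \bar R := \int[mu]_(y in S k) osc x y.
Definition block (i k : nat) : \bar R := \int[mu]_(x in S i) block1 k x.

Lemma block1_ge0 k x : 0 <= block1 k x.
Proof. by apply: integral_ge0 => y _; exact: osc_ge0. Qed.

Lemma block_ge0 i k : 0 <= block i k.
Proof. by apply: integral_ge0 => y _; exact: block1_ge0. Qed.

Let indicM (A : set T) (f : T -> \bar R) :
  \int[mu]_(x in A) f x = \int[mu]_x (f x * (\1_A x)%:E).
Proof.
rewrite integral_mkcond; apply: eq_integral => x _; rewrite /patch indicE.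
by case: ifPn => _; rewrite ?mule1 ?mule0.
Qed.

Let measurable_oscI (A B : set T) : measurable A -> measurable B ->
  measurable_fun setT
    (fun z : T * T => osc z.1 z.2 * (\1_B z.2)%:E * (\1_A z.1)%:E).
Proof.
move=> mA mB; apply: emeasurable_funM; [apply: emeasurable_funM|].
- exact: measurable_osc.
- apply/measurable_EFinP; apply: (measurableT_comp (measurable_indic mB)).
  exact: measurable_snd.
- apply/measurable_EFinP; apply: (measurableT_comp (measurable_indic mA)).
  exact: measurable_fst.
Qed.

Lemma measurable_block1 k : measurable_fun setT (block1 k).
Proof.
rewrite (_ : block1 k = fubini_F sf_mu
    (fun z : T * T => osc z.1 z.2 * (\1_(S k) z.2)%:E * (\1_setT z.1)%:E)).
  apply: measurable_fun_fubini_tonelli_F; first exact: measurable_oscI.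
  by move=> z; rewrite !mule_ge0 ?osc_ge0// lee_fin.
apply/funext => x; rewrite /block1 /fubini_F indicM.
by apply: eq_integral => y _ /=; rewrite indicT mule1.
Qed.

Lemma block_sym i k : block i k = block k i.
Proof.
pose f (z : T * T) := osc z.1 z.2 * (\1_(S k) z.2)%:E * (\1_(S i) z.1)%:E.
have f0 z : 0 <= f z by rewrite /f !mule_ge0 ?osc_ge0// lee_fin.
transitivity (\int[sf_mu]_x \int[sf_mu]_y f (x, y)).
  rewrite /block indicM; apply: eq_integral => x _.
  rewrite muleC /block1 indicM -ge0_integralZl//.
  - by apply: eq_integral => y _; rewrite muleC.
  - apply: emeasurable_funM; first exact: measurable_osc2.
    exact/measurable_EFinP/measurable_indic.
  - by move=> y _; rewrite mule_ge0 ?osc_ge0// lee_fin.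
rewrite (@fubini_tonelli _ _ _ _ _ sf_mu sf_mu f (measurable_oscI (mS i) (mS k)) f0).
rewrite /block indicM; apply: eq_integral => y _.
rewrite [RHS]muleC /block1 indicM -ge0_integralZl//.
- apply: eq_integral => x _; rewrite /f /= (osc_sym x).
  by rewrite muleAC [RHS]muleC.
- apply: emeasurable_funM; first exact: measurable_osc2.
  exact/measurable_EFinP/measurable_indic.
- by move=> x _; rewrite mule_ge0 ?osc_ge0// lee_fin.
Qed.

Let integral_cstS k (c : \bar R) : \int[mu]_(y in S k) c = (V k)%:E * c.
Proof. by rewrite integral_cst// -VE muleC. Qed.

Let mosc x k : measurable_fun (S k) (osc x).
Proof. exact/measurable_funTS/measurable_osc2. Qed.

Let moscM (r : \bar R) x k : measurable_fun (S k) (fun y => r * osc x y).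
Proof. exact/measurable_funTS/measurable_funeM/measurable_osc2. Qed.

Let mblock l k : measurable_fun (S k) (block1 l).
Proof. exact/measurable_funTS/measurable_block1. Qed.

Let mblockM (r : \bar R) l k : measurable_fun (S k) (fun y => r * block1 l y).
Proof. exact/measurable_funTS/measurable_funeM/measurable_block1. Qed.

(** The triangle inequality for the values of [u], averaged over a third
    piece. *)
Lemma block_triangle e i l k : (0 < e)%R ->
  (V l)%:E * block i k <= ((1 + e) `^ p * V k)%:E * block i l +
                          ((1 + e^-1) `^ p * V i)%:E * block l k.
Proof.
move=> e0; set Tc := ((1 + e) `^ p)%R; set Cc := ((1 + e^-1) `^ p)%R.
have Tc0 : (0 <= Tc)%R by exact: powR_ge0.
have Cc0 : (0 <= Cc)%R by exact: powR_ge0.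
have osc_tri x y z : osc x y <= Tc%:E * osc x z + Cc%:E * osc y z.
  rewrite /osc -!EFinM -EFinD lee_fin.
  apply: (@le_trans _ _ ((`|u z - u x| + `|u z - u y|) `^ p)%R).
    apply: ge0_ler_powR; rewrite ?nnegrE ?addr_ge0//.
    by rewrite [leRHS]addrC [X in (_ <= X + _)%R]distrC; exact: ler_distD.
  exact: powR_add_le.
have Vp j : (0 <= V j)%R by exact: ltW.
have st1 x y : (V l)%:E * osc x y <= Tc%:E * block1 l x + Cc%:E * block1 l y.
  rewrite -integral_cstS /block1 -!ge0_integralZl//; last first.
    all: try (by move=> z _; exact: osc_ge0).
    all: try exact: mosc.
    all: try by rewrite lee_fin.
  rewrite -ge0_integralD//; last first.
    all: try (by move=> z _; rewrite mule_ge0 ?osc_ge0).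
    all: try exact: moscM.
  apply: lower_integral_le => z _; [exact: osc_ge0|exact: osc_tri].
have mb1 := measurable_block1.
have st2 x : (V l)%:E * block1 k x <= (Tc * V k)%:E * block1 l x + Cc%:E * block k l.
  rewrite -ge0_integralZl//; last first.
    all: try (by move=> z _; exact: osc_ge0).
    all: try exact: mosc.
    all: try by rewrite lee_fin.
  apply: (@le_trans _ _ (\int[mu]_(y in S k) (Tc%:E * block1 l x + Cc%:E * block1 l y))).
    apply: lower_integral_le => y _; last exact: st1.
    by rewrite mule_ge0 ?osc_ge0// lee_fin.
  rewrite ge0_integralD//; last first.
    all: try (by move=> z _; rewrite mule_ge0 ?block1_ge0).
    all: try exact: mblockM.
  rewrite integral_cstS muleA -EFinM mulrC leeD2l//.
  rewrite ge0_integralZl//; last first.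
    all: try exact: mblock.
  by move=> y _; exact: block1_ge0.
rewrite -ge0_integralZl//; last first.
  all: try (by move=> z _; exact: block1_ge0).
  all: try exact: mblock.
  all: try by rewrite lee_fin.
apply: (@le_trans _ _ (\int[mu]_(x in S i) ((Tc * V k)%:E * block1 l x + Cc%:E * block k l))).
  apply: lower_integral_le => x _; last exact: st2.
  by rewrite mule_ge0 ?block1_ge0// lee_fin.
rewrite ge0_integralD//; last first.
  all: try (by move=> z _; rewrite mule_ge0 ?block_ge0).
  all: try (by move=> z _; rewrite mule_ge0 ?block1_ge0// lee_fin mulr_ge0).
  all: try exact: mblockM.
rewrite integral_cstS muleA -EFinM (block_sym k) [(V i * Cc)%R]mulrC leeD2r//.
rewrite ge0_integralZl//; last by rewrite lee_fin mulr_ge0.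
by move=> y _; exact: block1_ge0.
Qed.

Lemma measurable_idx (f : nat -> R) : measurable_fun setT (f \o idx).
Proof.
move=> _ B mB; rewrite setTI.
rewrite (_ : _ @^-1` B = \bigcup_(n in f @^-1` B) S n).
  by apply: bigcup_measurable => n _.
apply/seteqP; split => [x /= Bx|x [n /= Bn Sn]]; first by exists (idx x).
rewrite /= (_ : idx x = n)//; apply: (tS I I); exists x; split => //.
Qed.

Lemma idx_eq x n : S n x -> idx x = n.
Proof. by move=> Sn; apply: (tS I I); exists x. Qed.

Lemma integral_pieces (f : T -> \bar R) : measurable_fun setT f ->
  (forall x, 0 <= f x) -> \int[mu]_x f x = \sum_(k <oo) \int[mu]_(x in S k) f x.
Proof. by move=> mf f0; rewrite -[in LHS]cS ge0_integral_bigcup// cS. Qed.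

Variable c : nat -> nat -> R.
Hypothesis c_ge0 : forall i k, (0 <= c i k)%R.

Let inner x : \int[mu]_y (osc x y * (c (idx x) (idx y))%:E) =
  \sum_(k <oo) (c (idx x) k)%:E * block1 k x.
Proof.
have mo : measurable_fun setT (fun y => osc x y * (c (idx x) (idx y))%:E).
  apply: emeasurable_funM; first exact: measurable_osc2.
  by apply/measurable_EFinP; exact: (measurable_idx (c (idx x))).
rewrite integral_pieces//; last by move=> y; rewrite mule_ge0 ?osc_ge0 ?lee_fin.
apply: eq_eseriesr => k _; rewrite -ge0_integralZl//; last 2 first.
- by move=> y _; exact: osc_ge0.
- by rewrite lee_fin.
by apply: eq_integral => y /set_mem yk; rewrite (idx_eq yk) muleC.
Qed.

Let m_inner_piece k : measurable_fun setT (fun x => (c (idx x) k)%:E * block1 k x).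
Proof.
apply: emeasurable_funM; last exact: measurable_block1.
by apply/measurable_EFinP; exact: (measurable_idx (c ^~ k)).
Qed.

Let inner_piece_ge0 k x : 0 <= (c (idx x) k)%:E * block1 k x.
Proof. by rewrite mule_ge0 ?lee_fin ?block1_ge0. Qed.

Lemma measurable_inner :
  measurable_fun setT (fun x => \int[mu]_y (osc x y * (c (idx x) (idx y))%:E)).
Proof.
under eq_fun do rewrite inner.
exact: ge0_emeasurable_sum.
Qed.

(** Both integrals split over the pieces, on which the weight is constant. *)
Lemma integral_osc_idx :
  \int[mu]_x \int[mu]_y (osc x y * (c (idx x) (idx y))%:E) =
  \sum_(i <oo) \sum_(k <oo) (c i k)%:E * block i k.
Proof.
rewrite integral_pieces; last 2 first.
- exact: measurable_inner.
- by move=> x; apply: integral_ge0 => y _; rewrite mule_ge0 ?osc_ge0// lee_fin.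
apply: eq_eseriesr => i _.
rewrite (eq_integral (fun x => \sum_(k <oo) (c i k)%:E * block1 k x)); last first.
  by move=> x /set_mem xi; rewrite inner (idx_eq xi).
rewrite integral_nneseries//; last first.
  by move=> k x _; rewrite mule_ge0 ?lee_fin ?block1_ge0.
apply: eq_eseriesr => k _; rewrite ge0_integralZl//.
- by move=> x _; exact: block1_ge0.
- by rewrite lee_fin.
Qed.

End block_integrals.

(** With this choice the loss [(1 + e) ^ p] in the triangle inequality uses up
    only half of the decay: [(1 + e) ^ p * eta] is the square root of [eta],
    see [hardy_eP]. *)
Definition hardy_e {R : realType} (p eta : R) : R := eta `^ (- (2 * p)^-1) - 1.
Definition hardy_cst {R : realType} (p C0 eta : R) : R :=
  (1 - eta `^ 2^-1)^-1 * ((1 + (hardy_e p eta)^-1) `^ p * C0 + 1).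

Section hardy_exponent.
Context {R : realType}.
Variables (p C0 eta : R).
Hypothesis p_gt0 : 0 < p.
Hypothesis C0_ge0 : 0 <= C0.
Hypothesis eta01 : 0 < eta < 1.

Let eta0 : 0 < eta. Proof. by have /andP[] := eta01. Qed.
Let eta1 : eta < 1. Proof. by have /andP[] := eta01. Qed.

Lemma powR_lt1 r : 0 < r -> eta `^ r < 1.
Proof.
move=> r0; have n0 : eta \in Num.nneg by rewrite nnegrE ltW.
by have := gt0_ltr_powR r0 n0 (rpred1 _) eta1; rewrite powR1.
Qed.

Lemma hardy_e_gt0 : 0 < hardy_e p eta.
Proof.
rewrite subr_gt0 powRN invf_gt1 ?powR_gt0//.
by apply: powR_lt1; rewrite invr_gt0 mulr_gt0.
Qed.

Lemma hardy_eP : (1 + hardy_e p eta) `^ p * eta = eta `^ 2^-1.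
Proof.
rewrite /hardy_e addrC subrK -powRrM -[X in _ * X = _](powRr1 (ltW eta0)).
rewrite -powRD; last by rewrite lt0r_neq0// implybT.
congr powR; have := lt0r_neq0 p_gt0 => p0; field.
by rewrite p0.
Qed.

Lemma hardy_cst_gt0 : 0 < hardy_cst p C0 eta.
Proof.
rewrite mulr_gt0// ?invr_gt0 ?subr_gt0 ?powR_lt1 ?invr_gt0//.
by rewrite ltr_wpDl// mulr_ge0// powR_ge0.
Qed.

End hardy_exponent.

Section hardy_blocks.
Context {R : realType}.
Variables (a : nat -> nat -> \bar R) (p C0 eta : R) (M : nat).
Hypothesis p_gt0 : 0 < p.
Hypothesis C0_ge0 : 0 <= C0.
Hypothesis eta01 : 0 < eta < 1.
Hypothesis a_ge0 : forall i k, (0 <= a i k)%E.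
Hypothesis a_tri : forall e i l k, 0 < e ->
  (a i k <= ((1 + e) `^ p)%:E * a i l + ((1 + e^-1) `^ p)%:E * a l k)%E.
Variables (U Dw : nat -> R).
Hypothesis U_ge0 : forall k, 0 <= U k.
Hypothesis Dw_ge0 : forall k, 0 <= Dw k.

Lemma hardy_up :
  (forall k, (k < M)%N -> \sum_(0 <= i < k) U i <= C0 * U k) ->
  (forall k, (k < M)%N -> Dw k.+1 <= eta * Dw k) ->
  (\sum_(0 <= k < M.+1) \sum_(0 <= i < k) (U i * Dw k)%:E * a i k <=
   (hardy_cst p C0 eta)%:E * \sum_(0 <= k < M) (U k * Dw k)%:E * a k k.+1)%E.
Proof.
move=> HU HD; have e0 := hardy_e_gt0 p_gt0 eta01.
have T1 : 1 <= (1 + hardy_e p eta) `^ p.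
  apply: (@le_trans _ _ (1 `^ p)); first by rewrite powR1.
  by apply: ge0_ler_powR; rewrite ?nnegrE ?ltW//; lra.
apply: (hardy_sum (T := (1 + hardy_e p eta) `^ p)) => //.
- exact: powR_ge0.
- by rewrite powR_ge0 powR_lt1// invr_gt0.
- by move=> i k _; exact: a_tri.
- move=> k kM; rewrite -(hardy_eP p_gt0 eta01) -mulrA ler_wpM2l ?powR_ge0//.
  exact: HD.
Qed.

End hardy_blocks.

Section hardy_blocks_rev.
Context {R : realType}.
Variables (a : nat -> nat -> \bar R) (p C0 eta : R) (M : nat).
Hypothesis p_gt0 : 0 < p.
Hypothesis C0_ge0 : 0 <= C0.
Hypothesis eta01 : 0 < eta < 1.
Hypothesis a_ge0 : forall i k, (0 <= a i k)%E.
Hypothesis a_sym : forall i k, a i k = a k i.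
Hypothesis a_tri : forall e i l k, 0 < e ->
  (a i k <= ((1 + e) `^ p)%:E * a i l + ((1 + e^-1) `^ p)%:E * a l k)%E.
Variables (U Dw : nat -> R).
Hypothesis U_ge0 : forall k, 0 <= U k.
Hypothesis Dw_ge0 : forall k, 0 <= Dw k.

(** For weights that decay towards the small indices, the annuli up to [M] are
    numbered in the opposite order. *)
Lemma hardy_down :
  (forall i, (i <= M)%N -> \sum_(i <= k < M.+1) U k <= C0 * U i) ->
  (forall k, (k < M)%N -> Dw k <= eta * Dw k.+1) ->
  (\sum_(0 <= k < M.+1) \sum_(0 <= i < k) (U k * Dw i)%:E * a i k <=
   (hardy_cst p C0 eta)%:E * \sum_(0 <= k < M) (U k.+1 * Dw k.+1)%:E * a k k.+1)%E.
Proof.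
move=> HU HD.
have := @hardy_up R (fun n k => a (M - k)%N (M - n)%N) p C0 eta M p_gt0 C0_ge0 eta01
  (fun _ _ => a_ge0 _ _) _ (fun n => U (M - n)%N) (fun n => Dw (M - n)%N)
  (fun _ => U_ge0 _) (fun _ => Dw_ge0 _).
have tri' e i l k : 0 < e -> (a (M - k) (M - i) <=
    ((1 + e) `^ p)%:E * a (M - l) (M - i) +
    ((1 + e^-1) `^ p)%:E * a (M - k) (M - l))%E.
  move=> e0; rewrite (a_sym (M - k)) (a_sym (M - l)) (a_sym (M - k)).
  exact: a_tri.
move=> /(_ tri'); have HU' k : (k < M)%N ->
    \sum_(0 <= i < k) U (M - i)%N <= C0 * U (M - k)%N.
  move=> kM; apply: le_trans (HU _ (leq_subr _ _)).
  rewrite [leRHS](_ : _ = \sum_(0 <= i < k.+1) U (M - i)%N).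
    by rewrite big_nat_recr//= lerDl.
  have E : (M.+1 - (M - k) = k.+1)%N by rewrite subSn ?leq_subr// subKn// ltnW.
  have -> : \sum_(M - k <= m < M.+1) U m = \sum_(0 <= i < k.+1) U (i + (M - k))%N.
    by rewrite -{1}[(M - k)%N]add0n big_addn E.
  rewrite big_nat_rev /=; apply: eq_big_nat => i /= ik; congr U.
  by rewrite add0n subSS addnC addnBA// subnK// ltnW.
move=> /(_ HU'); have HD' k : (k < M)%N -> Dw (M - k.+1)%N <= eta * Dw (M - k)%N.
  move=> kM; have e : ((M - k.+1).+1 = M - k)%N by rewrite -subSn// subSS.
  by have := HD (M - k.+1)%N; rewrite e; apply; exact: leq_subr.
move=> /(_ HD') h.
have tr (f : nat -> nat -> \bar R) :
    (\sum_(0 <= k < M.+1) \sum_(0 <= i < k) f i k =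
     \sum_(k < M.+1) \sum_(i < M.+1 | (i < k)%N) f i k)%E.
  rewrite big_mkord; apply: eq_bigr => k _.
  by rewrite big_mkord (big_ord_widen M.+1 (fun i => f i k) (ltnW (ltn_ord k))).
have lhs : (\sum_(0 <= k < M.+1) \sum_(0 <= i < k) (U k * Dw i)%:E * a i k =
  \sum_(0 <= k < M.+1) \sum_(0 <= i < k)
     (U (M - i)%N * Dw (M - k)%N)%:E * a (M - k)%N (M - i)%N)%E.
  rewrite !tr [RHS](reindex_inj rev_ord_inj)/=.
  under [RHS]eq_bigr => k _ do rewrite (reindex_inj rev_ord_inj)/=.
  rewrite (exchange_big_dep xpredT)//=.
  apply: eq_bigr => k _; apply: eq_big => i.
    by rewrite ltn_sub2lE// ltnS.
  move=> ik; rewrite !subSS !subKn//.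
    by rewrite -ltnS ltn_ord.
  by rewrite -ltnS ltn_ord.
rewrite lhs; apply: (le_trans h); rewrite le_eqVlt; apply/orP; left; apply/eqP.
congr (_ * _)%E; rewrite big_nat_rev /=; apply: eq_big_nat => k /= kM.
have e : ((M - k.+1).+1 = M - k)%N by rewrite -subSn// subSS.
by rewrite add0n subKn// e subKn// ltnW.
Qed.

End hardy_blocks_rev.

Lemma nneseries_le_bound {R : realType} (f : nat -> \bar R) (B : \bar R) :
  (forall k, 0 <= f k)%E -> (forall n, \sum_(0 <= k < n) f k <= B)%E ->
  (\sum_(k <oo) f k <= B)%E.
Proof.
move=> f0 H; apply: lime_le; first exact: is_cvg_nneseries.
exact: nearW.
Qed.

(** The sum over a square of indices is twice the sum over the pairs below the
    diagonal. *)
Lemma symmetric_sum_le {R : realType} (x : nat -> nat -> \bar R) (B : \bar R) :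
  (forall i k, 0 <= x i k)%E -> (forall i k, x i k = x k i) ->
  (forall i, x i i = 0)%E ->
  (forall M, \sum_(0 <= k < M.+1) \sum_(0 <= i < k) x i k <= B)%E ->
  (\sum_(i <oo) \sum_(k <oo) x i k <= 2%:E * B)%E.
Proof.
move=> x0 xs xd H.
have square N : (\sum_(0 <= k < N) \sum_(0 <= i < N) x i k =
    2%:E * \sum_(0 <= k < N) \sum_(0 <= i < k) x i k)%E.
  elim: N => [|N IHN]; first by rewrite !big_geq// mule0.
  rewrite big_nat_recr//= (big_nat_recr N 0 (fun i => x i N) (leq0n _)) /= xd adde0.
  under eq_bigr => k _ do rewrite (big_nat_recr N)//=.
  rewrite big_split/= IHN [in RHS](big_nat_recr N)//=.
  rewrite ge0_muleDr ?sume_ge0// => [|k _]; last by rewrite sume_ge0.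
  rewrite -addeA; congr (_ + _)%E.
  under eq_bigr => k _ do rewrite xs.
  by rewrite -mule2n mule_natl.
apply: nneseries_le_bound => [i|n]; first exact: nneseries_ge0.
rewrite -nneseries_sum_nat//; apply: nneseries_le_bound => [k|m].
  exact: sume_ge0.
pose N := maxn n m.
apply: (@le_trans _ _ (\sum_(0 <= k < N) \sum_(0 <= i < N) x i k)%E).
  apply: (@le_trans _ _ (\sum_(0 <= k < m) \sum_(0 <= i < N) x i k)%E).
    apply: lee_sum => k _; apply: lee_sum_nneg_natr => //; exact: leq_maxl.
  apply: lee_sum_nneg_natr => [k _ _|]; last exact: leq_maxr.
  exact: sume_ge0.
rewrite square lee_wpmul2l ?lee_fin//.
apply: le_trans (H N); rewrite [leRHS]big_nat_recr//= leeDl// sume_ge0//.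
Qed.

(** * The deformed measure and distance on annuli *)

Lemma exprz_cvg0 {R : realType} (C t e : R) : 0 <= t < 1 -> 0 < e ->
  exists n, C * t ^+ n < e.
Proof.
move=> /andP[t0 t1] e0.
have : (fun n => C * t ^+ n) @ \oo --> (C * 0 : R).
  apply: cvgM; first exact: cvg_cst.
  by apply: cvg_expr; rewrite ger0_norm.
rewrite mulr0 => /pseudometric_normed_Zmodule.cvgrPdist_lt/(_ _ e0) [N _ NP].
exists N; have := NP N (leqnn N) => /=.
by rewrite sub0r normrN => /(le_lt_trans (ler_norm _)).
Qed.

Section scales.
Context {R : realType} {Z Z' : metricType R} (b : Z) (z' : Z').
Variables (nu : {measure set (borel b) -> \bar R}).
Variables (nu' : {measure set (borel z') -> \bar R}).
Variables (j : Z -> Z') (rho : R -> R).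
Variables (D kappa CA CB CD clo s : R) (Cup : R -> R).
Hypothesis nu_gt0 : forall (x : Z) r, 0 < r -> (0 < nu (ball x r))%E.
Hypothesis nu_fin : forall (x : Z) r, 0 < r -> (nu (ball x r) < +oo)%E.
Hypothesis nuD : forall (x : Z) r, 0 < r ->
  (nu (ball x (2 * r)) <= D%:E * nu (ball x r))%E.
Hypothesis kappa_gt1 : 1 < kappa.
Hypothesis perfect : forall (a : Z) r, 0 < r -> exists z,
  r <= mdist a z /\ mdist a z < kappa * r.
Hypothesis rho_gt0 : forall r, 0 < r -> 0 < rho r.
Hypothesis rhoA : condA rho CA.
Hypothesis rhoB : condB rho CB.
Hypothesis CB_gt0 : 0 < CB.
Hypothesis CD_gt0 : 0 < CD.
Hypothesis rhoD : forall r, 0 < r ->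
  (\int[nu]_(x in ~` ball b r) (rho (mdist (x : Z) b) `^ s)%:E
   <= (CD * rho r `^ s)%:E * nu (ball b (r + 1)%R))%E.
Hypothesis s_gt0 : 0 < s.
Hypothesis Cup_gt0 : forall K, 0 < Cup K.
Hypothesis clo_gt0 : 0 < clo.
Hypothesis jcont : continuous j.
Hypothesis jup : forall K (x y : Z), 1 <= K ->
  hgt b x <= K * hgt b y -> hgt b y <= K * hgt b x ->
  mdist (j x) (j y) <= Cup K * rho (hgt b x) * mdist x y.
Hypothesis jlo : forall x y : Z,
  clo * rho (hgt b x) * Num.min (mdist x y) (hgt b x) <= mdist (j x) (j y).
Hypothesis nu'E : forall B : set (borel z'), measurable B ->
  nu' B = (\int[nu]_(x in (j @^-1` B) `\ b) (rho (mdist (x : Z) b) `^ s)%:E)%E.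

Local Notation q := (q kappa).
Local Notation H := (hgt b).
Local Notation S := (annulus b kappa).
Local Notation V := (mass nu kappa).
Local Notation dbl := (dbl_cst D).
Local Notation cmp := (cmp_cst CA).

Let q4 : 4 < q. Proof. exact: q_gt4. Qed.
Let q1 : 1 <= q. Proof. by have := q4; lra. Qed.
Let qpos : 0 < q. Proof. exact: q_gt0. Qed.
Let CA1 : 1 <= CA. Proof. exact: condA_ge1 rho_gt0 rhoA. Qed.
Let cmp1 K : 1 <= cmp K. Proof. exact: cmp_cst_ge1. Qed.
Let cmp0 K : 0 < cmp K. Proof. exact: lt_le_trans ltr01 (cmp1 K). Qed.
Let dbl0 K : 0 < dbl K. Proof. exact: (dbl_cst_gt0 nu_gt0 nu_fin nuD). Qed.
Let dbl1 K : 1 <= dbl K. Proof. exact: (dbl_cst_ge1 nu_gt0 nu_fin nuD). Qed.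
Let qX0 k : 0 < q ^+ k. Proof. exact: qX_gt0. Qed.
Let qX1 k : 1 <= q ^+ k. Proof. exact: qX_ge1. Qed.
Let V0 k : 0 < V k. Proof. exact: (mass_gt0 nu_gt0 nu_fin nuD). Qed.
Let s0 : 0 <= s. Proof. exact: ltW. Qed.

Definition rhoq (k : nat) : R := rho (q ^+ k).
Definition wght (k : nat) : R := rhoq k `^ s.
(** The deformed size of an annulus, up to constants. *)
Definition rad (k : nat) : R := q ^+ k * rhoq k.

Lemma rhoq_gt0 k : 0 < rhoq k. Proof. exact: rho_gt0. Qed.
Lemma wght_gt0 k : 0 < wght k. Proof. exact/powR_gt0/rhoq_gt0. Qed.
Lemma rad_gt0 k : 0 < rad k. Proof. by rewrite mulr_gt0// rhoq_gt0. Qed.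

Lemma rhoq_cmp t k : q ^+ k <= t < q ^+ k.+1 ->
  rho t <= cmp q * rhoq k /\ rhoq k <= cmp q * rho t.
Proof.
move=> /andP[kt tk]; have k0 := qX0 k; have k1 := qX1 k.
by split; apply: (rho_cmp rho_gt0 rhoA) => //; rewrite exprS in tk;
  have := q4; nra.
Qed.

Lemma rhoq_annulus k x : S k x ->
  rho (H x) <= cmp q * rhoq k /\ rhoq k <= cmp q * rho (H x).
Proof. exact: rhoq_cmp. Qed.

Lemma rhoq_mdist K k (x : Z) : 1 <= K -> x <> b -> H x <= K * q ^+ k ->
  q ^+ k <= K * H x ->
  rho (mdist x b) <= cmp (2 * K) * rhoq k /\ rhoq k <= cmp (2 * K) * rho (mdist x b).
Proof.
move=> K1 /eqP xb; rewrite -(mdist_gt0) in xb => h1 h2.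
have k1 := qX1 k; rewrite /hgt in h1 h2.
by split; apply: (rho_cmp rho_gt0 rhoA) => //; nra.
Qed.

Lemma wght_mdist K k (x : Z) : 1 <= K -> x <> b -> H x <= K * q ^+ k ->
  q ^+ k <= K * H x ->
  rho (mdist x b) `^ s <= cmp (2 * K) `^ s * wght k /\
  wght k <= cmp (2 * K) `^ s * rho (mdist x b) `^ s.
Proof.
move=> K1 xb h1 h2; have [h3 h4] := rhoq_mdist K1 xb h1 h2.
have r0 : 0 < rho (mdist x b) by rewrite rho_gt0// mdist_gt0; apply/eqP.
by split; apply: powR_le_mul; rewrite ?(ltW r0) ?(ltW (rhoq_gt0 _)) ?(ltW (cmp0 _)).
Qed.

Lemma rhoq_index n i k : (i <= k)%N -> (k <= i + n)%N ->
  rhoq i <= cmp (q ^+ n) * rhoq k /\ rhoq k <= cmp (q ^+ n) * rhoq i.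
Proof.
move=> ik kin; have h1 := ler_qX kappa_gt1 ik.
have h2 := ler_qX kappa_gt1 kin; rewrite exprD mulrC in h2.
have qn := qX1 n; have := qX1 i; have := qX1 k => k1 i1.
by split; apply: (rho_cmp rho_gt0 rhoA) => //; nra.
Qed.

Lemma wght_index n i k : (i <= k)%N -> (k <= i + n)%N ->
  wght i <= cmp (q ^+ n) `^ s * wght k /\ wght k <= cmp (q ^+ n) `^ s * wght i.
Proof.
move=> ik kin; have [h1 h2] := rhoq_index ik kin.
by split; apply: powR_le_mul => //; try exact: ltW; exact/ltW/rhoq_gt0.
Qed.

Lemma mass_index i k : (i <= k)%N -> V i <= dbl (q + 2 * kappa) * V k.
Proof.
move=> ik; apply: (@le_trans _ _ (vol nu b (q ^+ i.+1))).
  rewrite -lee_fin (massE nu_fin)// (volE nu_fin)//.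
  apply: le_measure; rewrite ?inE; [exact: measurable_annulus|exact: borel_ball|].
  exact: annulus_sub_ball.
apply: (vol_le_mass nu_gt0 nu_fin nuD) => //.
rewrite mdistxx addr0 exprS ler_wpM2l//; first by have := q1; lra.
exact: ler_qX.
Qed.

Definition rad_cst : R := 2 * cmp q * CB.

(** The sum of the radii is an integral of [rho] over a half-line, which [condB]
    bounds by its first term. *)
Lemma rad_tail i M : \sum_(i <= m < M) rad m <= rad_cst * rad i.
Proof.
have [Mi|iM] := leqP M i.
  by rewrite big_geq// mulr_ge0 ?(ltW (rad_gt0 i))// !mulr_ge0// ltW.
pose F k : set R := `[q ^+ (i + k), q ^+ (i + k).+1[%classic.
have tF : trivIset setT F.
  move=> k l _ _ [t []]; rewrite /F /= !in_itv /= => /andP[t1 t2] /andP[t3 t4].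
  apply/eqP; rewrite eqn_leq -(leq_add2l i) -[(l <= k)%N](leq_add2l i).
  apply/andP; split; rewrite leqNgt; apply/negP => lt.
    by have := ler_qX kappa_gt1 lt; lra.
  by have := ler_qX kappa_gt1 lt; lra.
pose c k := (cmp q)^-1 * rhoq (i + k).
have := @lower_integral_pieces _ _ R lebesgue_measure `[q ^+ i, +oo[%classic F c
   (fun t => (rho t)%:E) (M - i).
have c0 k : 0 <= c k by rewrite mulr_ge0 ?invr_ge0 ?ltW ?rhoq_gt0.
move=> /(_ (fun k => measurable_itv _) tF c0) h.
have {h} : (\sum_(0 <= k < M - i) (c k)%:E * lebesgue_measure (F k) <=
    (CB * (q ^+ i + 1) * rho (q ^+ i))%:E)%E.
  apply: (le_trans (h _ _)); last exact: rhoB.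
  - move=> t /=; rewrite in_itv /= andbT => it; rewrite lee_fin ltW// rho_gt0//.
    exact: lt_le_trans it.
  - move=> k t; rewrite /F /= !in_itv /= andbT => tk; split.
      by move: tk => /andP[+ _]; apply: le_trans; apply: ler_qX => //; exact: leq_addr.
    by rewrite lee_fin /c ler_pdivrMl//; have [] := rhoq_cmp tk.
have E k : ((c k)%:E * lebesgue_measure (F k) =
    ((cmp q)^-1 * (q - 1) * rad (i + k))%:E)%E.
  rewrite lebesgue_measure_itv /= lte_fin ifT; last first.
    by rewrite exprS ltr_pMl//; have := q4; lra.
  by rewrite -EFinB -EFinM /c /rad exprS; congr EFin; ring.
under eq_bigr do rewrite E.
rewrite sumEFin lee_fin -mulr_sumr => h.
have {h} h : (q - 1) * \sum_(0 <= k < M - i) rad (i + k) <=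
    cmp q * (CB * (q ^+ i + 1) * rho (q ^+ i)).
  by rewrite -ler_pdivrMl// mulrA.
have -> : \sum_(i <= m < M) rad m = \sum_(0 <= k < M - i) rad (i + k).
  rewrite -{1}[i]add0n big_addn; apply: eq_bigr => k _; by rewrite addnC.
have sg : 0 <= \sum_(0 <= k < M - i) rad (i + k).
  by apply: sumr_ge0 => k _; exact/ltW/rad_gt0.
apply: (@le_trans _ _ ((q - 1) * \sum_(0 <= k < M - i) rad (i + k))).
  by rewrite ler_peMl//; have := q4; lra.
apply: (le_trans h); rewrite /rad_cst /rad -/(rhoq i).
have r0 := rhoq_gt0 i; have i1 := qX1 i.
have := mulr_gt0 (mulr_gt0 (cmp0 q) CB_gt0) r0 => X0; nra.
Qed.

Lemma rad_cst_ge1 : 1 <= rad_cst. Proof. exact: tail_ge1 rad_gt0 rad_tail. Qed.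

Lemma rad_le i k : (i <= k)%N -> rad k <= rad_cst * rad i.
Proof.
move=> ik; apply: le_trans (rad_tail i k.+1); rewrite big_nat_recr//=.
by rewrite lerDr sumr_ge0// => m _; exact/ltW/rad_gt0.
Qed.

Lemma nu'_ge K k (A : set Z) (B : set Z') : 1 <= K ->
  measurable (A : set (borel b)) -> measurable (B : set (borel z')) ->
  A `<=` j @^-1` B ->
  (forall x, A x -> H x <= K * q ^+ k /\ q ^+ k <= K * H x) ->
  (((cmp (2 * K) `^ s)^-1 * wght k)%:E * nu A <= nu' B)%E.
Proof.
move=> K1 mA mB AB HA; rewrite nu'E//.
have mb := @borel_set1 _ _ b b.
have -> : nu A = nu (A `\ b).
  rewrite -[in LHS](setDUK (_ : A `&` [set b] `<=` A))//.
  rewrite measureU//; last 3 first.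
  - exact: measurableI.
  - by apply: measurableD => //; exact: measurableI.
  - by rewrite setDIK.
  rewrite [X in (X + _)%E](_ : _ = 0%E) ?add0e.
    congr (nu _); apply/seteqP; split => x [Ax xb]; split => //.
      by move=> xe; apply: xb.
    by move=> [_ /xb].
  apply/eqP; rewrite eq_le measure_ge0 andbT.
  rewrite -(nu_center nu_gt0 nu_fin nuD kappa_gt1 perfect).
  by apply: le_measure; rewrite ?inE//; exact: measurableI.
apply: lower_integral_ge_cst.
- exact: measurableD.
- by move=> x [Ax xb]; split => //; exact: AB.
- by rewrite mulr_ge0 ?invr_ge0 ?powR_ge0.
- by move=> x _; rewrite lee_fin powR_ge0.
- move=> x [Ax xb]; have [h1 h2] := HA x Ax.
  by rewrite lee_fin ler_pdivrMl ?powR_gt0//; have [] := wght_mdist K1 xb h1 h2.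
Qed.

Lemma nu'_le K k (B : set Z') : 1 <= K -> measurable (B : set (borel z')) ->
  (forall x, B (j x) -> H x <= K * q ^+ k /\ q ^+ k <= K * H x) ->
  (nu' B <= (cmp (2 * K) `^ s * wght k)%:E * nu (j @^-1` B))%E.
Proof.
move=> K1 mB HB; rewrite nu'E//.
have mjB : measurable (j @^-1` B : set (borel b)).
  by rewrite -[j @^-1` B]setTI; exact: (@continuous_measurable _ _ b _ z' j).
have mb := @borel_set1 _ _ b b.
have c0 : 0 <= cmp (2 * K) `^ s * wght k by rewrite mulr_ge0 ?powR_ge0.
apply: (@le_trans _ _ (\int[nu]_(x in (j @^-1` B) `\ b)
    (cmp (2 * K) `^ s * wght k)%:E)%E).
  apply: lower_integral_le => x [Bx xb]; first by rewrite lee_fin powR_ge0.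
  have [h1 h2] := HB x Bx; rewrite lee_fin.
  by have [] := wght_mdist K1 xb h1 h2.
rewrite integral_cst//; last exact: measurableD.
rewrite lee_wpmul2l ?lee_fin//.
by apply: le_measure; rewrite ?inE//; exact: measurableD.
Qed.

Lemma vol_b_le_mass i : vol nu b (q ^+ i) <= dbl (1 + 2 * kappa) * V i.
Proof.
by apply: (vol_le_mass nu_gt0 nu_fin nuD) => //; rewrite mdistxx mul1r addr0.
Qed.

Lemma notin_ball_hgt r (x : Z) : (~` ball b r) x = (r + 1 <= H x) :> Prop.
Proof.
rewrite /setC /= ballEmdist /= metric_sym; apply/propext.
by split; [move/negP; rewrite -leNgt /hgt lerD2r|rewrite /hgt lerD2r leNgt => /negP].
Qed.

Lemma mass_succ0 : V 1 <= dbl (q ^+ 2) * dbl (1 + 2 * kappa) * V 0.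
Proof.
apply: (@le_trans _ _ (dbl (q ^+ 2) * vol nu b (q ^+ 0))).
  by apply: (mass_le_vol nu_gt0 nu_fin nuD) => //; rewrite mdistxx expr0 addr0 mulr1.
by rewrite -mulrA ler_wpM2l ?vol_b_le_mass// ltW.
Qed.

Definition outer_cst : R := CD * cmp (2 * q) `^ s * dbl (1 + 2 * kappa).
Definition wV1_cst : R := cmp (q ^+ 1) `^ s * (dbl (q ^+ 2) * dbl (1 + 2 * kappa)).

Lemma outer_cst_gt0 : 0 < outer_cst.
Proof. by rewrite /outer_cst !mulr_gt0 ?powR_gt0. Qed.

Lemma wV1_cst_gt0 : 0 < wV1_cst.
Proof. by rewrite /wV1_cst !mulr_gt0 ?powR_gt0. Qed.

Let wV i : R := wght i * V i.

Lemma wV_gt0 i : 0 < wV i. Proof. by rewrite mulr_gt0 ?wght_gt0. Qed.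

Lemma wV1 : wV 1 <= wV1_cst * wV 0.
Proof.
have [_ h] := @wght_index 1 0 1 isT isT.
rewrite /wV1_cst mulrACA; apply: ler_pM => //; [exact/ltW/wght_gt0|exact: ltW|].
exact: mass_succ0.
Qed.

Let outer i : set Z := [set x : Z | q ^+ i <= H x].

(** This is [condD] at the radius [q ^+ i - 1], which is positive only for
    positive [i]. *)
Lemma rhoD_annulus i : (0 < i)%N ->
  (\int[nu]_(x in outer i) (rho (mdist (x : Z) b) `^ s)%:E
   <= (outer_cst * wV i)%:E)%E.
Proof.
move=> i0; have qi : 1 < q ^+ i.
  by rewrite exprn_egt1 -?lt0n//; have := q4; lra.
have r0 : 0 < q ^+ i - 1 by lra.
have -> : outer i = ~` ball b (q ^+ i - 1).
  by apply/seteqP; split => x; rewrite notin_ball_hgt subrK.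
apply: (le_trans (rhoD r0)).
rewrite subrK -(volE nu_fin)// -EFinM lee_fin.
have h : rho (q ^+ i - 1) <= cmp (2 * q) * rhoq i.
  by apply: (rho_cmp rho_gt0 rhoA) => //; have := q4; nra.
have h' := powR_le_mul s0 (ltW (rho_gt0 r0)) (ltW (cmp0 _)) (ltW (rhoq_gt0 i)) h.
rewrite /outer_cst /wV.
rewrite (_ : _ * (wght i * V i) = CD * (cmp (2 * q) `^ s * wght i) *
                                  (dbl (1 + 2 * kappa) * V i)); last by ring.
apply: ler_pM => //.
- by rewrite mulr_ge0 ?powR_ge0// ltW.
- by rewrite ltW// vol_gt0.
- by rewrite ler_wpM2l// ltW.
- exact: vol_b_le_mass.
Qed.

Definition wV_cst : R := 1 + (1 + cmp (2 * q) `^ s) * outer_cst * (1 + wV1_cst) + cmp (2 * q) `^ s.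

Lemma wV_cst_gt0 : 0 < wV_cst.
Proof.
by rewrite /wV_cst !addr_gt0// ?mulr_gt0 ?addr_gt0 ?powR_gt0 ?outer_cst_gt0 ?wV1_cst_gt0.
Qed.

(** The sum over the annuli from [i] on is an integral of the weight outside a
    ball, which [condD] controls for positive [i]; the first two annuli have
    comparable masses. *)
Lemma wV_tail i M : \sum_(i <= k < M) wV k <= wV_cst * wV i.
Proof.
have pos l : (0 < l)%N ->
    \sum_(l <= k < M) wV k <= cmp (2 * q) `^ s * outer_cst * wV l.
  move=> l0; have [Ml|lM] := leqP M l.
    rewrite big_geq//; apply: mulr_ge0; last exact/ltW/wV_gt0.
    by apply: mulr_ge0; [exact: powR_ge0|exact/ltW/outer_cst_gt0].
  have -> : \sum_(l <= m < M) wV m = \sum_(0 <= k < M - l) wV (l + k).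
    by rewrite -{1}[l]add0n big_addn; apply: eq_bigr => k _; rewrite addnC.
  pose c k := (cmp (2 * q) `^ s)^-1 * wght (l + k).
  have c0 k : 0 <= c k by rewrite mulr_ge0 ?invr_ge0 ?powR_ge0.
  have tF : trivIset setT (fun k => S (l + k)%N : set (borel b)).
    move=> k k' _ _ [x [h1 h2]]; have /eqP := annulus_inj kappa_gt1 h1 h2.
    by rewrite eqn_add2l => /eqP.
  have := @lower_integral_pieces _ _ R nu (outer l)
    (fun k => S (l + k)%N) c (fun x => (rho (mdist (x : Z) b) `^ s)%:E) (M - l)
    (fun k => measurable_annulus _ _ _) tF c0.
  move=> h; rewrite -mulrA -ler_pdivrMl ?powR_gt0// mulr_sumr -lee_fin.
  apply: le_trans (rhoD_annulus l0); rewrite -sumEFin.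
  under eq_bigr => k _.
    rewrite /wV mulrA EFinM (massE nu_fin)//.
    over.
  apply: h; first by move=> x _; rewrite lee_fin powR_ge0.
  move=> k x xk; have := xk => /andP[h1 h2].
  have lk : q ^+ l <= H x by apply: le_trans h1; apply: ler_qX => //; exact: leq_addr.
  split => //; have xb : x <> b.
    move=> xb; move: lk; rewrite xb /hgt mdistxx add0r leNgt => /negP; apply.
    by rewrite exprn_egt1 -?lt0n//; have := q4; lra.
  have h3 : H x <= q * q ^+ (l + k) by rewrite -exprS ltW.
  have h4 : q ^+ (l + k) <= q * H x.
    by rewrite (le_trans h1)// ler_peMl// ltW// hgt_gt0.
  by rewrite lee_fin /c ler_pdivrMl ?powR_gt0//; have [] := wght_mdist q1 xb h3 h4.
have a0 : 0 <= cmp (2 * q) `^ s by rewrite powR_ge0.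
have d0 := outer_cst_gt0; have e0 := wV1_cst_gt0; have w0 := wV_gt0 i.
have ad0 := mulr_ge0 a0 (ltW d0); have ade0 := mulr_ge0 ad0 (ltW e0).
have de0 := mulr_ge0 (ltW d0) (ltW e0).
case: i w0 => [|i] w0; last first.
  apply: (le_trans (pos i.+1 isT)); rewrite ler_wpM2r ?(ltW w0)// /wV_cst; nra.
have [M0|M0] := leqP M 0.
  by rewrite big_geq// mulr_ge0// ltW// wV_cst_gt0.
rewrite big_ltn//; have := pos 1%N isT; have := wV1; have := wV_gt0 1 => w1 h1 h2.
have : cmp (2 * q) `^ s * outer_cst * wV 1 <= cmp (2 * q) `^ s * outer_cst * (wV1_cst * wV 0).
  by rewrite ler_wpM2l.
have : 0 <= (outer_cst * wV1_cst +
    cmp (2 * q) `^ s + outer_cst + cmp (2 * q) `^ s * outer_cst) * wV 0.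
  by rewrite mulr_ge0 ?(ltW w0)//; lra.
rewrite /wV_cst; nra.
Qed.

(** This is [condD] again, for sets that need not come from annuli; the first
    annulus, where [condD] has nothing to say, is compared with the second. *)
Lemma nu'_tail i (B : set Z') : measurable (B : set (borel z')) ->
  (forall x, B (j x) -> q ^+ i <= H x) -> (nu' B <= (wV_cst * wV i)%:E)%E.
Proof.
move=> mB HB; rewrite nu'E//.
have a0 : 0 <= cmp (2 * q) `^ s by rewrite powR_ge0.
have d0 := outer_cst_gt0; have e0 := wV1_cst_gt0; have w0 := wV_gt0 i.
have ad0 := mulr_ge0 a0 (ltW d0); have ade0 := mulr_ge0 ad0 (ltW e0).
have de0 := mulr_ge0 (ltW d0) (ltW e0).
case: i HB w0 => [|i] HB w0; last first.
  apply: (@le_trans _ _ (outer_cst * wV i.+1)%:E); last first.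
    by rewrite lee_fin ler_wpM2r ?(ltW w0)// /wV_cst; nra.
  apply: le_trans (rhoD_annulus (isT : 0 < i.+1)%N).
  rewrite integral_mkcond [leRHS]integral_mkcond; apply: lower_integral_le => x _.
    by rewrite erestrict_ge0// => y _; rewrite lee_fin powR_ge0.
  rewrite /patch; case: ifPn => [/set_mem[Bx _]|_].
    by rewrite mem_set//; exact: HB.
  by case: ifPn => _ //; rewrite lee_fin powR_ge0.
rewrite integral_mkcond.
pose f (x : borel b) : \bar R := ((fun x : Z => (rho (mdist (x : Z) b) `^ s)%:E) \_
   (outer 1%N)) x.
pose g (x : borel b) : \bar R := ((cmp (2 * q) `^ s * wght 0)%:E * (\1_(S 0) x)%:E)%E.
have mS0 := measurable_annulus b kappa 0.
have mS : measurable_fun setT (fun x : borel b => (\1_(S 0) x)%:E : \bar R).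
  by apply/measurable_EFinP; exact: measurable_indic.
have c0 : 0 <= cmp (2 * q) `^ s * wght 0 by rewrite mulr_ge0 ?powR_ge0.
have g0 x : (0 <= g x)%E by rewrite /g -EFinM lee_fin mulr_ge0.
have f0 x : (0 <= f x)%E by rewrite /f erestrict_ge0// => y _; rewrite lee_fin powR_ge0.
apply: (@le_trans _ _ (\int[nu]_x (f x + g x))%E).
  apply: lower_integral_le => x _.
    by rewrite erestrict_ge0// => y _; rewrite lee_fin powR_ge0.
  rewrite /patch; case: ifPn => [/set_mem[Bx xb]|_]; last exact: adde_ge0.
  have [x1|x1] := leP (q ^+ 1) (H x).
    by rewrite /f /patch mem_set// leeDl.
  have xS : S 0 x by rewrite /annulus /= expr0 hgt_ge1.
  rewrite /g indicE mem_set// mule1; apply: (@le_trans _ _ (cmp (2 * q) `^ s * wght 0)%:E).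
    have h3 : H x <= q * q ^+ 0 by rewrite expr0 mulr1 ltW.
    have h4 : q ^+ 0 <= q * H x.
      by rewrite expr0; have := hgt_ge1 b x; have := q4; nra.
    by rewrite lee_fin; have [] := wght_mdist q1 xb h3 h4.
  by rewrite leeDr.
apply: (le_trans (lower_integralD _ f0 g0 _)); first exact: measurable_funeM.
have -> : (\int[nu]_x g x = (cmp (2 * q) `^ s * wV 0)%:E)%E.
  rewrite ge0_integralZl_EFin// integral_indic// setIT -(massE nu_fin)//.
  by rewrite -EFinM mulrA.
have : (\int[nu]_x f x <= (outer_cst * (wV1_cst * wV 0))%:E)%E.
  rewrite /f -integral_mkcond; apply: (le_trans (rhoD_annulus (isT : 0 < 1)%N)).
  by rewrite lee_fin ler_wpM2l ?wV1// ltW.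
move=> h; apply: (le_trans (leeD h (lexx _))); rewrite -EFinD lee_fin.
have : 0 <= (outer_cst + cmp (2 * q) `^ s * outer_cst +
    cmp (2 * q) `^ s * outer_cst * wV1_cst + 1) * wV 0.
  by rewrite mulr_ge0 ?(ltW w0)//; lra.
rewrite /wV_cst; nra.
Qed.

Lemma hgt_near i k x y : S i x -> S k y -> (k <= i.+1)%N -> H y <= q ^+ 2 * H x.
Proof.
move=> /andP[ix _] /andP[_ ky] ki; apply: (le_trans (ltW ky)).
apply: (@le_trans _ _ (q ^+ (2 + i))); first by apply: ler_qX => //; rewrite add2n ltnS.
by rewrite exprD ler_wpM2l// ltW.
Qed.

Definition dist_up : R := Cup (q ^+ 2) * cmp q.
Definition dist_lo : R := clo / (cmp q * (1 + q ^+ 2)).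
Definition rad_lo : R := clo / cmp q.

Lemma dist_up_gt0 : 0 < dist_up. Proof. by rewrite mulr_gt0. Qed.
Lemma dist_lo_gt0 : 0 < dist_lo. Proof. by rewrite divr_gt0// mulr_gt0// addr_gt0. Qed.
Lemma rad_lo_gt0 : 0 < rad_lo. Proof. by rewrite divr_gt0. Qed.

Lemma dist_near_le i k x y : S i x -> S k y -> (i <= k.+1)%N -> (k <= i.+1)%N ->
  mdist (j x) (j y) <= dist_up * rhoq i * mdist x y.
Proof.
move=> ix ky ik ki.
apply: (le_trans (jup (qX1 2) (hgt_near ky ix ik) (hgt_near ix ky ki))).
rewrite ler_wpM2r ?mdist_ge0// /dist_up -mulrA ler_wpM2l ?(ltW (Cup_gt0 _))//.
by have [] := rhoq_annulus ix.
Qed.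

Lemma mdist_near_hgt i k x y : S i x -> S k y -> (k <= i.+1)%N ->
  mdist x y <= (1 + q ^+ 2) * H x.
Proof.
move=> ix ky ki; have := hgt_near ix ky ki; have := mdist_le_hgt b x y.
by rewrite mulrDl mul1r; lra.
Qed.

Lemma dist_near_ge i k x y : S i x -> S k y -> (k <= i.+1)%N ->
  dist_lo * rhoq i * mdist x y <= mdist (j x) (j y).
Proof.
move=> ix ky ki; apply: le_trans (jlo x y).
have [_ h] := rhoq_annulus ix.
have Q0 : 0 < 1 + q ^+ 2 by rewrite addr_gt0.
have hm : mdist x y / (1 + q ^+ 2) <= Num.min (mdist x y) (H x).
  rewrite le_min; apply/andP; split; rewrite ler_pdivrMr//.
    by rewrite ler_peMr ?mdist_ge0// lerDl ltW.
  by rewrite mulrC; exact: mdist_near_hgt ix ky ki.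
have -> : dist_lo * rhoq i * mdist x y =
    clo * (rhoq i / cmp q) * (mdist x y / (1 + q ^+ 2)).
  by rewrite /dist_lo invfM; ring.
apply: ler_pM => //.
- by rewrite !mulr_ge0 ?invr_ge0 ?ltW// rhoq_gt0.
- by rewrite divr_ge0 ?mdist_ge0// ltW.
- by rewrite ler_wpM2l ?(ltW clo_gt0)// ler_pdivrMr// mulrC.
Qed.

Lemma mdist_far i k x y : S i x -> S k y -> (i.+2 <= k)%N ->
  q ^+ k / 2 <= mdist x y /\ H x <= mdist x y.
Proof.
move=> /andP[_ ix] /andP[ky _] ik; have := hgt_le b y x.
have h : q ^+ i.+2 <= q ^+ k by exact: ler_qX.
have e : 4 * q ^+ i.+1 <= q ^+ i.+2 by rewrite [leRHS]exprS ler_wpM2r// ltW.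
by rewrite metric_sym => yx; have := qX0 i.+1; split; lra.
Qed.

(** For annuli that are not adjacent the distance exceeds the height of the
    inner point, so that the minimum in the lower bound is this height. *)
Lemma dist_far_ge i k x y : S i x -> S k y -> (i.+2 <= k)%N ->
  rad_lo * rad i <= mdist (j x) (j y).
Proof.
move=> ix ky ik; apply: le_trans (jlo x y).
have [_ h] := mdist_far ix ky ik; rewrite min_r//.
have [_ h1] := rhoq_annulus ix; have /andP[h2 _] := ix.
have -> : rad_lo * rad i = clo * (rhoq i / cmp q) * q ^+ i by rewrite /rad_lo /rad; ring.
apply: ler_pM => //; first by rewrite !mulr_ge0 ?invr_ge0 ?ltW// rhoq_gt0.
  exact: ltW.
by rewrite ler_wpM2l ?(ltW clo_gt0)// ler_pdivrMr// mulrC.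
Qed.

Definition rad_up : R := 2 * q ^+ 2 * dist_up * cmp q * rad_cst.

(** A chain of points, one in each annulus, joins two points; its deformed
    length is a tail of the sum of the radii. *)
Lemma dist_le_rad i k x y : S i x -> S k y -> (i <= k)%N ->
  mdist (j x) (j y) <= rad_up * rad i.
Proof.
move=> ix ky ik; pose c := 2 * q ^+ 2 * dist_up * cmp q.
have c0 : 0 <= c by apply/ltW; rewrite /c !mulr_gt0 ?dist_up_gt0.
have step l m u v : S l u -> S m v -> (l <= m)%N -> (m <= l.+1)%N ->
    mdist (j u) (j v) <= c * rad m.
  move=> lu mv lm ml.
  apply: (le_trans (dist_near_le lu mv (leqW lm) ml)).
  have d : mdist u v <= 2 * q ^+ 2 * q ^+ m.
    have := mdist_le_hgt b u v; have /andP[_ u1] := lu; have /andP[_ v1] := mv.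
    have u2 : q ^+ l.+1 <= q ^+ m.+1 by apply: ler_qX.
    have e : q ^+ 2 * q ^+ m = q * q ^+ m.+1 by rewrite !exprS; ring.
    have : q ^+ m.+1 <= q * q ^+ m.+1 by rewrite ler_peMl// ltW.
    by rewrite -mulrA e; lra.
  have ml1 : (m <= l + 1)%N by rewrite addn1.
  have [r _] := rhoq_index lm ml1; rewrite expr1 in r.
  have -> : c * rad m = dist_up * (cmp q * rhoq m) * (2 * q ^+ 2 * q ^+ m).
    by rewrite /c /rad; ring.
  apply: ler_pM => //; [|exact: mdist_ge0|by rewrite ler_wpM2l// ltW// dist_up_gt0].
  by apply/ltW/mulr_gt0; [exact: dist_up_gt0|exact: rhoq_gt0].
have H1 n : forall v, S (i + n)%N v ->
    mdist (j x) (j v) <= c * \sum_(i <= m < (i + n).+1) rad m.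
  elim: n => [|n IHn] v iv.
    rewrite addn0 big_nat1; apply: step ix _ _ _ => //.
    by rewrite addn0 in iv.
  have [z [_ zn _]] := annulus_ball b kappa_gt1 perfect (i + n).
  have := IHn z zn; have := step _ _ z v zn iv; rewrite addnS leqnSn leqnn.
  move=> /(_ isT isT) h1 h2; rewrite big_nat_recr /=; last first.
    by apply: leqW; exact: leq_addr.
  by have := metric_triangle (j x) (j z) (j v); rewrite mulrDr; lra.
have := H1 (k - i)%N y; rewrite subnKC// => /(_ ky) h.
apply: (le_trans h); rewrite /rad_up -/c -mulrA ler_wpM2l//.
exact: rad_tail.
Qed.

Lemma rad_up_gt0 : 0 < rad_up.
Proof.
by rewrite /rad_up !mulr_gt0 ?dist_up_gt0// (lt_le_trans ltr01)// rad_cst_ge1.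
Qed.

Let cR1 : 1 <= rad_cst. Proof. exact: rad_cst_ge1. Qed.
Let cR0 : 0 < rad_cst. Proof. exact: lt_le_trans ltr01 cR1. Qed.
Let tau01 : 0 <= 1 - rad_cst^-1 < 1.
Proof. by rewrite subr_ge0 invf_le1// cR1 ltrBlDr ltrDl invr_gt0. Qed.

(** By [tail_decay] the radii have dropped by a prescribed factor after a number
    of annuli that depends on the constants only: by these annuli the deformed
    ball of [nu'_ball_rad], respectively [nu'_ball_near_le], is reached. *)
Definition gap_far : nat := xget 0%N [set n | rad_up * rad_cst * (1 - rad_cst^-1) ^+ n < rad_lo].
Definition gap_near : nat := xget 0%N [set n |
  dist_up * (1 + q ^+ 2) * q * rad_cst * (1 - rad_cst^-1) ^+ n < rad_lo].

Lemma gap_farP : rad_up * rad_cst * (1 - rad_cst^-1) ^+ gap_far < rad_lo.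
Proof.
have [n nP] := exprz_cvg0 (rad_up * rad_cst) tau01 rad_lo_gt0.
exact: (@xgetPex _ 0%N [set n | rad_up * rad_cst * (1 - rad_cst^-1) ^+ n < rad_lo]
  (ex_intro _ n nP)).
Qed.

Lemma gap_nearP : dist_up * (1 + q ^+ 2) * q * rad_cst * (1 - rad_cst^-1) ^+ gap_near < rad_lo.
Proof.
have [n nP] := exprz_cvg0 (dist_up * (1 + q ^+ 2) * q * rad_cst) tau01 rad_lo_gt0.
exact: (@xgetPex _ 0%N [set n |
  dist_up * (1 + q ^+ 2) * q * rad_cst * (1 - rad_cst^-1) ^+ n < rad_lo]
  (ex_intro _ n nP)).
Qed.

Lemma measurable_jball (y : Z) r : measurable (ball (j y) r : set (borel z')).
Proof. exact: borel_ball. Qed.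

Lemma measurable_preim_jball (y : Z) r :
  measurable (j @^-1` ball (j y) r : set (borel b)).
Proof.
rewrite -[X in measurable X]setTI.
by apply: (@continuous_measurable _ _ b _ z' j) => //; exact: borel_ball.
Qed.

(** The radius is small compared with the height of [y], so that all heights in
    the ball are comparable and [jup] applies with the ratio 2. *)
Lemma ball_sub_preim i y r t : S i y -> r <= H y / 2 ->
  Cup 2 * cmp q * rhoq i * r <= t -> ball y r `<=` j @^-1` ball (j y) t.
Proof.
move=> iy rH rt z; rewrite /= !ballEmdist /= => yz.
have := hgt_le b y z; have := hgt_le b z y; rewrite (metric_sym z) => h1 h2.
have Hy := hgt_gt0 b y.
have d : mdist (j y) (j z) <= Cup 2 * rho (H y) * mdist y z.
  by apply: jup; rewrite ?ler1n//; lra.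
apply: (le_lt_trans d); apply: lt_le_trans rt.
have [h _] := rhoq_annulus iy.
have C0 := Cup_gt0 2; have r0 := rho_gt0 Hy.
apply: (@lt_le_trans _ _ (Cup 2 * rho (H y) * r)); first by rewrite ltr_pM2l// mulr_gt0.
rewrite ler_wpM2r//; first by have := mdist_ge0 y z; lra.
by rewrite -mulrA ler_wpM2l// ltW.
Qed.

Lemma nu'_ball_sub_ge i y r (B : set Z') : S i y -> 0 < r -> r <= H y / 2 ->
  measurable (B : set (borel z')) -> ball y r `<=` j @^-1` B ->
  (((cmp (2 * (2 * q)) `^ s)^-1 * wght i * vol nu y r)%:E <= nu' B)%E.
Proof.
move=> iy r0 rH mB yB; rewrite EFinM (volE nu_fin)//.
apply: nu'_ge => //; first by have := q4; lra.
  exact: borel_ball.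
move=> z; rewrite ballEmdist /= => yz.
have := hgt_le b y z; have := hgt_le b z y; rewrite (metric_sym z) => h1 h2.
have /andP[y1 y2] := iy; rewrite exprS in y2.
have q0 : 0 < q by have := q4; lra.
have qq : 0 < q * q ^+ i by rewrite mulr_gt0.
have Hz := hgt_gt0 b z; split; first by rewrite -mulrA; lra.
by have := q4 => q4'; nra.
Qed.

Definition eps_far : R := Num.min 2^-1 (rad_lo / (Cup 2 * cmp q * rad_cst)).
Definition bmass_cst : R := cmp (2 * q) `^ s * cmp (2 * (2 * q)) `^ s * cmp (q ^+ gap_far) `^ s *
  dbl (2 * q / eps_far) * dbl (q + 2 * kappa).

Lemma eps_far_gt0 : 0 < eps_far.
Proof. by rewrite lt_min invr_gt0 ltr0n divr_gt0 ?rad_lo_gt0// !mulr_gt0. Qed.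

Lemma powR_ge1 (x : R) : 1 <= x -> 1 <= x `^ s.
Proof.
move=> x1; apply: (@le_trans _ _ (1 `^ s)); first by rewrite powR1.
by apply: ge0_ler_powR; rewrite ?nnegrE//; lra.
Qed.

Let P1 K : 1 <= cmp K `^ s. Proof. exact: powR_ge1. Qed.
Let P0 K : 0 < cmp K `^ s. Proof. exact: powR_gt0. Qed.

Lemma bmass_cst_gt0 : 0 < bmass_cst. Proof. by rewrite /bmass_cst !mulr_gt0. Qed.

(** Seen from a point further away, a ball of the radius of an annulus has at
    least the mass of this annulus: either the point is so far that the ball
    contains an annulus of bounded index difference, or it is at a comparable
    distance from [b]. *)
Lemma nu'_ball_rad i k y : S k y -> (i <= k)%N ->
  ((bmass_cst^-1 * wV i)%:E <= nu' (ball (j y) (rad_lo * rad i)))%E.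
Proof.
move=> ky ik; have c50 := bmass_cst_gt0; have wi := wght_gt0 i; have Vi := V0 i.
have [ink|kin] := leqP (i + gap_far) k.
- have sub : S (i + gap_far)%N `<=` j @^-1` ball (j y) (rad_lo * rad i).
    move=> z zn; rewrite /= ballEmdist /= metric_sym.
    apply: (le_lt_trans (dist_le_rad zn ky ink)).
    apply: (@le_lt_trans _ _ (rad_up * (rad_cst * (1 - rad_cst^-1) ^+ gap_far * rad i))).
      by rewrite ler_wpM2l ?(ltW rad_up_gt0)//; exact: tail_decay rad_gt0 rad_tail _ _.
    by rewrite [ltLHS]mulrA ltr_pM2r ?rad_gt0// mulrA; exact: gap_farP.
  have := nu'_ge q1 (measurable_annulus b kappa (i + gap_far)) (measurable_jball y _) sub _.
  move=> /(_ (i + gap_far)%N) h; apply: le_trans (h _); last first.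
    move=> x /andP[x1 x2]; rewrite -exprS ltW//; split => //.
    by rewrite (le_trans x1)// ler_peMl// ltW// hgt_gt0.
  rewrite -(massE nu_fin)// -EFinM lee_fin.
  have [h1 _] := wght_index (leq_addr gap_far i) (leqnn _).
  have h2 := mass_index (leq_addr gap_far i).
  rewrite ler_pdivrMl// mulrA [bmass_cst * _]mulrA.
  have -> : bmass_cst * (cmp (2 * q) `^ s)^-1 * wght (i + gap_far) * V (i + gap_far) =
     cmp (2 * (2 * q)) `^ s * dbl (2 * q / eps_far) *
     ((cmp (q ^+ gap_far) `^ s * wght (i + gap_far)) * (dbl (q + 2 * kappa) * V (i + gap_far))).
    rewrite /bmass_cst; have E (p1 p2 p3 d4 d5 w v : R) : 0 < p1 ->
        p1 * p2 * p3 * d4 * d5 * p1^-1 * w * v = p2 * d4 * ((p3 * w) * (d5 * v)).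
      by move=> /lt0r_neq0 p; field.
    exact: E.
  rewrite -[leLHS]mul1r; apply: ler_pM => //; first by rewrite mulr_ge0 ?ltW.
    by rewrite -[leLHS]mul1r ler_pM.
  by apply: ler_pM => //; exact: ltW.
- have [/andP[y1 y2] e0] := (ky, eps_far_gt0).
  have r0 : 0 < eps_far * q ^+ k by rewrite mulr_gt0.
  have e2 : eps_far <= 2^-1 by rewrite /eps_far ge_min lexx.
  have rH : eps_far * q ^+ k <= H y / 2.
    by rewrite mulrC; apply: ler_pM => //; exact: ltW.
  have C0 : 0 < Cup 2 * cmp q * rad_cst by rewrite !mulr_gt0.
  have rt : Cup 2 * cmp q * rhoq k * (eps_far * q ^+ k) <= rad_lo * rad i.
    have -> : Cup 2 * cmp q * rhoq k * (eps_far * q ^+ k) = (Cup 2 * cmp q * eps_far) * rad k.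
      by rewrite /rad; ring.
    apply: (@le_trans _ _ (Cup 2 * cmp q * eps_far * (rad_cst * rad i))).
      by rewrite ler_wpM2l ?rad_le// ltW// !mulr_gt0.
    rewrite mulrA ler_wpM2r ?(ltW (rad_gt0 _))//.
    rewrite mulrAC mulrC -ler_pdivlMr//.
    by rewrite /eps_far ge_min lexx orbT.
  apply: le_trans (nu'_ball_sub_ge ky r0 rH (measurable_jball y _)
    (ball_sub_preim ky rH rt)).
  rewrite lee_fin.
  have [h1 _] := wght_index ik (ltnW kin); have h2 := mass_index ik.
  have h3 : V k <= dbl (2 * q / eps_far) * vol nu y (eps_far * q ^+ k).
    apply: (mass_le_vol nu_gt0 nu_fin nuD) => //.
    have -> : 2 * q / eps_far * (eps_far * q ^+ k) = 2 * q ^+ k.+1.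
      by rewrite exprS; have := lt0r_neq0 e0 => e0'; field.
    by move: y2; rewrite /hgt; lra.
  have v0 : 0 < vol nu y (eps_far * q ^+ k) by exact: vol_gt0.
  rewrite ler_pdivrMl// /wV.
  have -> : bmass_cst * ((cmp (2 * (2 * q)) `^ s)^-1 * wght k * vol nu y (eps_far * q ^+ k)) =
     cmp (2 * q) `^ s * ((cmp (q ^+ gap_far) `^ s * wght k) * (dbl (q + 2 * kappa) *
       (dbl (2 * q / eps_far) * vol nu y (eps_far * q ^+ k)))).
    rewrite /bmass_cst; have E (p1 p2 p3 d4 d5 w v : R) : 0 < p2 ->
        p1 * p2 * p3 * d4 * d5 * (p2^-1 * w * v) = p1 * ((p3 * w) * (d5 * (d4 * v))).
      by move=> /lt0r_neq0 p; field.
    exact: E.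
  rewrite -[leLHS]mul1r; apply: ler_pM => //; first by rewrite mulr_ge0 ?ltW.
  apply: ler_pM => //; [exact: ltW|exact: ltW|].
  by apply: (le_trans h2); rewrite ler_wpM2l// ltW.
Qed.

Definition dfar_cst : R := bmass_cst * (rad_lo `^ s)^-1.
Lemma dfar_cst_gt0 : 0 < dfar_cst.
Proof. by rewrite /dfar_cst mulr_gt0 ?bmass_cst_gt0// invr_gt0 powR_gt0// rad_lo_gt0. Qed.

(** The point [z] is either of the two points [x] and [y]: both orders of the
    arguments of the kernel are bounded by the annulus nearer to [b]. *)
Lemma nu'_kernel_far i k l x y z : S i x -> S k y -> (i.+2 <= k)%N ->
  S l z -> (i <= l)%N ->
  ((dfar_cst^-1 * (wV i * rad i `^ s))%:E <=
   nu' (ball (j z) (mdist (j x) (j y))) * (mdist (j x) (j y) `^ s)%:E)%E.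
Proof.
move=> ix ky ik lz il; have h := dist_far_ge ix ky ik.
have -> : dfar_cst^-1 * (wV i * rad i `^ s) = (bmass_cst^-1 * wV i) * (rad_lo `^ s * rad i `^ s).
  by rewrite /dfar_cst invfM invrK; ring.
rewrite EFinM; apply: lee_pmul.
- by rewrite lee_fin mulr_ge0 ?invr_ge0 ?ltW ?bmass_cst_gt0 ?wV_gt0.
- by rewrite lee_fin mulr_ge0 ?powR_ge0.
- apply: le_trans (nu'_ball_rad lz il) _; apply: le_measure; rewrite ?inE.
  + exact: measurable_jball.
  + exact: measurable_jball.
  + by move=> w; rewrite !ballEmdist /= => /lt_le_trans; apply.
rewrite lee_fin -powRM ?(ltW rad_lo_gt0) ?(ltW (rad_gt0 _))//.
apply: ge0_ler_powR => //; rewrite nnegrE ?mdist_ge0//.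
by rewrite mulr_ge0// ltW ?rad_lo_gt0 ?rad_gt0.
Qed.

Definition far_cst : R := dbl (4 * q) * 2 `^ s.
Lemma far_cst_gt0 : 0 < far_cst. Proof. by rewrite /far_cst mulr_gt0// powR_gt0. Qed.

(** For the undeformed kernel it is the annulus further from [b] that
    counts. *)
Lemma nu_kernel_far i k l x y z : S i x -> S k y -> (i.+2 <= k)%N ->
  S l z -> (l <= k)%N ->
  far_cst^-1 * (V k * (q ^+ k) `^ s) <= vol nu z (mdist x y) * mdist x y `^ s.
Proof.
move=> ix ky ik lz lk; have [h1 h2] := mdist_far ix ky ik.
have d0 : 0 < mdist x y by apply: lt_le_trans h2; exact: hgt_gt0.
rewrite ler_pdivrMl ?far_cst_gt0//.
have -> : far_cst * (vol nu z (mdist x y) * mdist x y `^ s) =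
  (dbl (4 * q) * vol nu z (mdist x y)) * (2 `^ s * mdist x y `^ s).
  by rewrite /far_cst; ring.
apply: ler_pM; rewrite ?powR_ge0 ?(ltW (V0 k))//; last first.
  apply: powR_le_mul; rewrite ?mdist_ge0 ?(ltW (qX0 k))//.
  by lra.
apply: (mass_le_vol nu_gt0 nu_fin nuD) => //.
move: lz => /andP[_ z2]; have e : q ^+ l.+1 <= q ^+ k.+1 by apply: ler_qX.
have : 4 * q * (q ^+ k / 2) <= 4 * q * mdist x y.
  by rewrite ler_wpM2l//; have := q4; lra.
have ek := exprS q k; rewrite /hgt in z2.
by lra.
Qed.

Lemma wght_near i k : (i <= k.+1)%N -> (k <= i.+1)%N ->
  wght i <= cmp (q ^+ 1) `^ s * wght k.
Proof.
move=> ik ki; have [h|/ltnW h] := leqP i k.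
  by have [] := wght_index h (_ : k <= i + 1)%N; rewrite ?addn1.
by have [] := wght_index h (_ : i <= k + 1)%N; rewrite ?addn1.
Qed.

Definition eps_near : R := Num.min (2 * (1 + q ^+ 2))^-1 (dist_lo / (Cup 2 * cmp q)).
Definition nball_lo : R := cmp (2 * (2 * q)) `^ s * dbl eps_near^-1.

Let Q0 : 0 < 1 + q ^+ 2. Proof. by rewrite addr_gt0. Qed.

Lemma eps_near_gt0 : 0 < eps_near.
Proof.
by rewrite lt_min invr_gt0 mulr_gt0//= divr_gt0 ?dist_lo_gt0// mulr_gt0.
Qed.

Lemma nball_lo_gt0 : 0 < nball_lo. Proof. by rewrite mulr_gt0. Qed.

Lemma nu'_ball_near_ge i k x y : S i x -> S k y -> (k <= i.+1)%N ->
  0 < mdist x y ->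
  ((nball_lo^-1 * (wght i * vol nu x (mdist x y)))%:E <=
   nu' (ball (j x) (mdist (j x) (j y))))%E.
Proof.
move=> ix ky ki d0; have e0 := eps_near_gt0; set d := mdist x y in d0 *.
have r0 : 0 < eps_near * d by rewrite mulr_gt0.
have rH : eps_near * d <= H x / 2.
  have h1 : eps_near <= (2 * (1 + q ^+ 2))^-1 by rewrite /eps_near ge_min lexx.
  have h2 : d <= (1 + q ^+ 2) * H x by exact: mdist_near_hgt ix ky ki.
  apply: (@le_trans _ _ ((2 * (1 + q ^+ 2))^-1 * ((1 + q ^+ 2) * H x))).
    by apply: ler_pM => //; exact: ltW.
  by rewrite invfM -mulrA mulKf ?lt0r_neq0// mulrC.
have rt : Cup 2 * cmp q * rhoq i * (eps_near * d) <= mdist (j x) (j y).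
  apply: le_trans (dist_near_ge ix ky ki).
  have -> : Cup 2 * cmp q * rhoq i * (eps_near * d) = (Cup 2 * cmp q * eps_near) * (rhoq i * d).
    by ring.
  rewrite -[leRHS]mulrA ler_wpM2r//; first by rewrite mulr_ge0 ?ltW// rhoq_gt0.
  by rewrite mulrC -ler_pdivlMr ?mulr_gt0// /eps_near ge_min lexx orbT.
apply: le_trans (nu'_ball_sub_ge ix r0 rH (measurable_jball x _)
    (ball_sub_preim ix rH rt)).
rewrite lee_fin /nball_lo invfM -!mulrA ler_wpM2l ?invr_ge0 ?(ltW (P0 _))//.
rewrite mulrCA ler_wpM2l ?(ltW (wght_gt0 _))// ler_pdivrMl//.
apply: (vol_cmp nu_gt0 nu_fin nuD) => //.
by rewrite mdistxx addr0 mulKf// lt0r_neq0.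
Qed.

Definition spread : R := dist_up * cmp q / clo.
Definition nball_up : R := cmp (2 * (2 * q)) `^ s * dbl spread +
  wV_cst * (cmp (q ^+ gap_near.+1) `^ s * dbl (4 * q * spread)).

Lemma spread_gt0 : 0 < spread. Proof. by rewrite divr_gt0// mulr_gt0// dist_up_gt0. Qed.
Lemma nball_up_gt0 : 0 < nball_up. Proof. by rewrite addr_gt0 ?mulr_gt0// wV_cst_gt0. Qed.

(** If the deformed ball is not contained in a small original ball, then it may
    reach infinity, but not the much smaller neighbourhoods of [b]; its mass is
    then controlled by [condD]. *)
Lemma nu'_ball_near_le i k x y : S i x -> S k y -> (i <= k.+1)%N ->
  (k <= i.+1)%N -> 0 < mdist x y ->
  (nu' (ball (j x) (mdist (j x) (j y))) <=
   (nball_up * (wght i * vol nu x (mdist x y)))%:E)%E.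
Proof.
move=> ix ky ik ki d0; have c80 := spread_gt0.
have tle := dist_near_le ix ky ik ki; have dle := mdist_near_hgt ix ky ki.
set d := mdist x y in d0 tle dle *; set t := mdist (j x) (j y) in tle *.
have v0 : 0 < vol nu x d by exact: vol_gt0.
have w0 := wght_gt0 i; have r0 := rhoq_gt0 i; have Hx := hgt_gt0 b x.
have [/andP[x1 x2]] := ix; have [_ rx] := rhoq_annulus ix.
have close z : mdist (j x) (j z) < t -> Num.min (mdist x z) (H x) < spread * d.
  move=> zt; have := le_lt_trans (jlo x z) (lt_le_trans zt tle).
  set m := Num.min _ _ => h.
  have m0 : 0 <= m by rewrite le_min mdist_ge0 ltW.
  rewrite (_ : spread * d = d * (dist_up * cmp q) / clo); last by rewrite /spread; ring.
  rewrite ltr_pdivlMr// mulrC -(ltr_pM2l r0).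
  have : clo * rhoq i * m <= cmp q * (clo * rho (H x) * m).
    rewrite [leRHS](_ : _ = clo * (cmp q * rho (H x)) * m); last by ring.
    by rewrite ler_wpM2r// ler_wpM2l// ltW.
  have : cmp q * (clo * rho (H x) * m) < cmp q * (dist_up * rhoq i * d) by rewrite ltr_pM2l.
  move=> h1 h2; have := le_lt_trans h2 h1.
  rewrite (_ : cmp q * (dist_up * rhoq i * d) = rhoq i * (d * (dist_up * cmp q))); last by ring.
  by rewrite (_ : clo * rhoq i * m = rhoq i * (clo * m)); last by ring.
have [small|big] := leP (2 * spread * d) (H x).
- have sub z : mdist (j x) (j z) < t -> mdist x z < spread * d.
    move=> /close; rewrite gt_min => /orP[//|].
    have : 0 < spread * d by rewrite mulr_gt0.
    by lra.
  have c8d : 0 < spread * d by rewrite mulr_gt0.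
  apply: (le_trans (@nu'_le (2 * q) i _ _ (measurable_jball x _) _)).
  + by have := q4; lra.
  + move=> z; rewrite ballEmdist /= => /sub xz.
    have := hgt_le b x z; have := hgt_le b z x; rewrite (metric_sym z) => h1 h2.
    have qq : 0 < q * q ^+ i by rewrite mulr_gt0.
    rewrite exprS in x2; have Hz := hgt_gt0 b z.
    split; first by rewrite -mulrA; lra.
    by have := q4 => q4'; nra.
  apply: (@le_trans _ _ (cmp (2 * (2 * q)) `^ s * dbl spread * (wght i * vol nu x d))%:E).
    rewrite [X in (_ <= X%:E)%E](_ : _ =
      cmp (2 * (2 * q)) `^ s * wght i * (dbl spread * vol nu x d)); last by ring.
    rewrite [leRHS]EFinM; apply: lee_wpmul2l.
      by rewrite lee_fin ltW// mulr_gt0.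
    apply: (@le_trans _ _ (vol nu x (spread * d))%:E); last first.
      rewrite lee_fin; apply: (vol_cmp nu_gt0 nu_fin nuD) => //.
      by rewrite mdistxx addr0.
    rewrite (volE nu_fin)//; apply: le_measure; rewrite ?inE.
    + exact: measurable_preim_jball.
    + exact: borel_ball.
    + by move=> z; rewrite /= !ballEmdist; exact: sub.
  rewrite lee_fin ler_wpM2r ?(ltW (mulr_gt0 w0 v0))// /nball_up lerDl.
  by rewrite ltW// !mulr_gt0// wV_cst_gt0.
- pose l0 := (i - gap_near.+1)%N.
  have l0i : (l0 <= i)%N by rewrite leq_subr.
  have il0 : (i <= l0 + gap_near.+1)%N by rewrite addnC -leq_subLR.
  apply: (le_trans (@nu'_tail l0 _ (measurable_jball x _) _)).
    move=> z; rewrite ballEmdist /= => xz; have [l lz] := hgt_annulus b kappa_gt1 z.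
    have [ll|ll] := leqP l0 l.
      by move: lz => /andP[+ _]; apply: le_trans; exact: ler_qX.
    exfalso; have lni : (l + gap_near.+1 < i)%N by rewrite addnC -ltn_subRL.
    have li : (l.+2 <= i)%N by apply: leq_ltn_trans lni; rewrite addnS ltnS leq_addr.
    have := dist_far_ge lz ix li; rewrite leNgt metric_sym => /negP; apply.
    apply: (lt_trans xz); apply: (le_lt_trans tle).
    have nil : (gap_near <= i - l)%N.
      have lni' : (l + gap_near <= i)%N by apply: ltnW; apply: leq_ltn_trans lni; rewrite leq_add2l.
      by rewrite leq_subRL// (leq_trans (leq_addr gap_near l)).
    have := tail_decay rad_gt0 rad_tail l (i - l); rewrite subnKC; last first.
      by apply: leq_trans li; rewrite -addn2 leq_addr.
    move=> ri; have [/andP[t0 t1]] := tau01.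
    have tn : (1 - rad_cst^-1) ^+ (i - l) <= (1 - rad_cst^-1) ^+ gap_near.
      by apply: ler_wiXn2l => //; exact: ltW.
    have {}ri : rad i <= rad_cst * (1 - rad_cst^-1) ^+ gap_near * rad l.
      apply: (le_trans ri); rewrite ler_wpM2r ?(ltW (rad_gt0 _))//.
      by rewrite ler_wpM2l// ltW.
    have h : d <= (1 + q ^+ 2) * (q * q ^+ i).
      by apply: (le_trans dle); rewrite ler_wpM2l ?(ltW Q0)// -exprS ltW.
    apply: (@le_lt_trans _ _ (dist_up * (1 + q ^+ 2) * q * rad i)).
      rewrite (_ : dist_up * (1 + q ^+ 2) * q * rad i =
        dist_up * rhoq i * ((1 + q ^+ 2) * (q * q ^+ i))); last by rewrite /rad; ring.
      by rewrite ler_wpM2l// ltW// mulr_gt0// dist_up_gt0.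
    apply: (@le_lt_trans _ _ (dist_up * (1 + q ^+ 2) * q *
        (rad_cst * (1 - rad_cst^-1) ^+ gap_near * rad l))).
      by rewrite ler_wpM2l// ltW// !mulr_gt0// dist_up_gt0.
    by rewrite [ltLHS]mulrA ltr_pM2r ?rad_gt0// [ltLHS]mulrA; exact: gap_nearP.
  rewrite lee_fin.
  have [h1 _] := wght_index l0i il0.
  have h2 : V l0 <= dbl (4 * q * spread) * vol nu x d.
    apply: (mass_le_vol nu_gt0 nu_fin nuD) => //.
    have e : q ^+ l0.+1 <= q * q ^+ i by rewrite -exprS; apply: ler_qX.
    have : q * q ^+ i <= q * H x by rewrite ler_wpM2l// ltW.
    have : 2 * q * H x <= 2 * q * (2 * spread * d) by rewrite ler_wpM2l ?ltW// mulr_gt0.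
    rewrite exprS in x2; have : mdist x b <= q * q ^+ i by rewrite /hgt in x2; lra.
    lra.
  apply: (@le_trans _ _ (wV_cst * (cmp (q ^+ gap_near.+1) `^ s * dbl (4 * q * spread)) *
      (wght i * vol nu x d))).
    rewrite -mulrA ler_wpM2l ?(ltW wV_cst_gt0)//.
    rewrite [leRHS](_ : _ = cmp (q ^+ gap_near.+1) `^ s * wght i *
        (dbl (4 * q * spread) * vol nu x d)); last by ring.
    by apply: ler_pM => //; [exact/ltW/wght_gt0|exact: ltW].
  rewrite ler_wpM2r ?(ltW (mulr_gt0 w0 v0))// /nball_up lerDr.
  by rewrite ltW// !mulr_gt0.
Qed.

Definition kernel_lo : R := nball_lo^-1 * dist_lo `^ s / cmp (q ^+ 1) `^ s.
Definition kernel_up : R := nball_up * dist_up `^ s * cmp (q ^+ 1) `^ s.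

Lemma kernel_lo_gt0 : 0 < kernel_lo.
Proof.
by rewrite divr_gt0// mulr_gt0 ?invr_gt0 ?nball_lo_gt0// powR_gt0// dist_lo_gt0.
Qed.

Lemma kernel_up_gt0 : 0 < kernel_up.
Proof. by rewrite !mulr_gt0 ?nball_up_gt0// powR_gt0// dist_up_gt0. Qed.

(** On neighbouring annuli the deformed measure of a ball is the original one
    times [wght], and the power [s] of the deformed distance brings another
    factor [wght]. The two factors are the densities of the product measure, so
    that the energies of neighbouring annuli are comparable. *)
Lemma nu'_kernel_near i k x y : S i x -> S k y -> (i <= k.+1)%N ->
  (k <= i.+1)%N -> 0 < mdist x y ->
  ((kernel_lo * (wght i * wght k * (vol nu x (mdist x y) * mdist x y `^ s)))%:E <=
   nu' (ball (j x) (mdist (j x) (j y))) * (mdist (j x) (j y) `^ s)%:E)%E /\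
  (nu' (ball (j x) (mdist (j x) (j y))) * (mdist (j x) (j y) `^ s)%:E <=
   (kernel_up * (wght i * wght k * (vol nu x (mdist x y) * mdist x y `^ s)))%:E)%E.
Proof.
move=> ix ky ik ki d0.
have h1 := nu'_ball_near_ge ix ky ki d0.
have h2 := nu'_ball_near_le ix ky ik ki d0.
have h3 := dist_near_ge ix ky ki; have h4 := dist_near_le ix ky ik ki.
have w1 := wght_near ik ki; have w2 := wght_near ki ik.
have v0 : 0 < vol nu x (mdist x y) by exact: vol_gt0.
have wi := wght_gt0 i; have wk := wght_gt0 k; have ri := rhoq_gt0 i.
have ds : 0 < mdist x y `^ s by exact: powR_gt0.
have c20 := dist_lo_gt0; have c1p := dist_up_gt0.
have c70 := nball_lo_gt0; have c90 := nball_up_gt0.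
have c2s : 0 < dist_lo `^ s by exact: powR_gt0.
have c1s : 0 < dist_up `^ s by exact: powR_gt0.
have a0 := P0 (q ^+ 1).
set t := mdist (j x) (j y) in h1 h2 h3 h4 *.
have t0 : 0 <= t by exact: mdist_ge0.
have E c : 0 < c -> c `^ s * wght i * mdist x y `^ s = (c * rhoq i * mdist x y) `^ s.
  by move=> cp; rewrite !powRM ?mulr_ge0 ?mdist_ge0 ?(ltW cp) ?(ltW ri).
have E0 c : 0 < c -> 0 <= c * rhoq i * mdist x y.
  by move=> cp; rewrite !mulr_ge0 ?mdist_ge0 ?(ltW cp) ?(ltW ri).
have tlo : dist_lo `^ s * wght i * mdist x y `^ s <= t `^ s.
  by rewrite E//; apply: ge0_ler_powR => //; rewrite nnegrE// E0.
have tup : t `^ s <= dist_up `^ s * wght i * mdist x y `^ s.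
  by rewrite E//; apply: ge0_ler_powR => //; rewrite nnegrE// E0.
set d := mdist x y in d0 v0 ds h1 h2 tlo tup *.
split.
- apply: le_trans (lee_pmul _ _ h1 (_ : ((t `^ s)%:E <= (t `^ s)%:E)%E)).
  + rewrite -EFinM lee_fin.
    apply: (@le_trans _ _ (nball_lo^-1 * (wght i * vol nu x d) *
        (dist_lo `^ s * wght i * d `^ s))); last first.
      by rewrite ler_wpM2l// mulr_ge0 ?invr_ge0 ?mulr_ge0 ?ltW.
    rewrite /kernel_lo.
    rewrite [leLHS](_ : _ = nball_lo^-1 * dist_lo `^ s * wght i * (vol nu x d * d `^ s) *
        (wght k / cmp (q ^+ 1) `^ s)); last by ring.
    rewrite [leRHS](_ : _ = nball_lo^-1 * dist_lo `^ s * wght i * (vol nu x d * d `^ s) *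
        wght i); last by ring.
    rewrite ler_wpM2l//; last by rewrite ler_pdivrMr// mulrC.
    by rewrite ltW// !mulr_gt0// invr_gt0.
  + by rewrite lee_fin ltW// !mulr_gt0// invr_gt0.
  + by rewrite lee_fin powR_ge0.
  + by [].
- apply: (le_trans (lee_pmul _ _ h2 (_ : ((t `^ s)%:E <= (t `^ s)%:E)%E))) => //.
  + by rewrite lee_fin powR_ge0.
  rewrite -EFinM lee_fin.
  apply: (@le_trans _ _ (nball_up * (wght i * vol nu x d) *
      (dist_up `^ s * wght i * d `^ s))).
    by rewrite ler_wpM2l// mulr_ge0 ?mulr_ge0 ?ltW.
  rewrite /kernel_up.
  rewrite [leRHS](_ : _ = nball_up * dist_up `^ s * wght i * (vol nu x d * d `^ s) *
      (cmp (q ^+ 1) `^ s * wght k)); last by ring.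
  rewrite [leLHS](_ : _ = nball_up * dist_up `^ s * wght i * (vol nu x d * d `^ s) *
      wght i); last by ring.
  by rewrite ler_wpM2l// ltW// !mulr_gt0.
Qed.

Definition near_cst : R := dbl (3 * q ^+ 2 + 2 * kappa) * (2 * q ^+ 2) `^ s.

Lemma near_cst_gt0 : 0 < near_cst.
Proof. by rewrite mulr_gt0// powR_gt0// mulr_gt0. Qed.

Lemma nu_kernel_near i x y : S i x -> S i.+1 y -> 0 < mdist x y ->
  vol nu x (mdist x y) * mdist x y `^ s <= near_cst * (V i * (q ^+ i) `^ s).
Proof.
move=> ix iy d0; have := mdist_le_hgt b x y.
have [/andP[x1 x2] /andP[_ y2]] := (ix, iy); rewrite !exprS in x2 y2 => dle.
have e : q * q ^+ i <= q ^+ 2 * q ^+ i.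
  by rewrite expr2 -mulrA ler_wpM2l ?ler_peMl// ltW.
have qq : q ^+ 2 * q ^+ i = q * (q * q ^+ i) by rewrite expr2 mulrA.
rewrite (_ : near_cst * _ = dbl (3 * q ^+ 2 + 2 * kappa) * V i *
    ((2 * q ^+ 2) `^ s * (q ^+ i) `^ s)); last by rewrite /near_cst; ring.
apply: ler_pM; rewrite ?powR_ge0//; first exact/ltW/vol_gt0.
  apply: (vol_le_mass nu_gt0 nu_fin nuD) => //.
  by rewrite /hgt in x2 y2 dle; rewrite -mulrA; lra.
apply: powR_le_mul => //; rewrite ?mdist_ge0 ?ltW ?mulr_gt0//.
by rewrite -mulrA; lra.
Qed.

Lemma dist_bounded x y : mdist (j x) (j y) <= rad_up * (rad_cst * rad 0).
Proof.
have [i ix] := hgt_annulus b kappa_gt1 x; have [k ky] := hgt_annulus b kappa_gt1 y.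
wlog ik : x y i k ix ky / (i <= k)%N.
  move=> h; have [/h|/ltnW /h] := leqP i k; first exact.
  by rewrite metric_sym; exact.
apply: (le_trans (dist_le_rad ix ky ik)); rewrite ler_wpM2l ?(ltW rad_up_gt0)//.
exact: rad_le.
Qed.

Lemma nu'T_fin : (nu' setT < +oo)%E.
Proof.
apply: le_lt_trans (ltry (wV_cst * wV 0)); apply: nu'_tail => //.
by move=> x _; rewrite expr0 hgt_ge1.
Qed.

(** ** The two energies *)

Variables (p : R) (jinv : Z' -> Z).
Hypothesis p_ge1 : 1 <= p.
Hypothesis jK : cancel j jinv.
Hypothesis mjinv : measurable_fun setT (jinv : borel z' -> borel b).
Hypothesis mrange_j : measurable (range j : set (borel z')).

Let p_gt0 : 0 < p. Proof. exact: lt_le_trans p_ge1. Qed.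

Definition idx (x : Z) : nat := xget 0%N [set k | S k x].

Lemma idxP x : S (idx x) x.
Proof. exact: (@xgetPex _ 0%N [set k | S k x] (hgt_annulus b kappa_gt1 x)). Qed.

Let mS k : measurable (S k : set (borel b)). Proof. exact: measurable_annulus. Qed.
Let tS : trivIset setT (S : nat -> set (borel b)).
Proof. exact: trivIset_annulus. Qed.
Let cS : \bigcup_k (S k : set (borel b)) = setT.
Proof. exact: bigcup_annulus. Qed.
Let VE k : (V k)%:E = nu (S k). Proof. exact: (massE nu_fin). Qed.

Variable u : Z -> R.
Hypothesis mu_ : measurable_fun setT (u : borel b -> R).

Local Notation F := (osc (u : borel b -> R) p).

Let F_ge0 x y : (0 <= F x y)%E. Proof. exact: osc_ge0. Qed.
Let Fxx x : (F x x = 0)%E. Proof. by apply: oscxx; rewrite gt_eqF. Qed.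

Definition near (x y : Z) : bool :=
  (idx x <= (idx y).+1)%N && (idx y <= (idx x).+1)%N.

Definition nearF (x y : Z) : \bar R :=
  if near x y then (F x y * ((vol nu x (mdist x y) * mdist x y `^ s)^-1)%:E)%E
  else 0%E.

(** Both energies are compared with this one, which only counts the pairs of
    points in neighbouring annuli. *)
Definition near_energy : \bar R := (\int[nu]_x \int[nu]_y nearF x y)%E.

(** Symmetric in the two indices, since the kernels are taken at a pair of points
    in either order. *)
Definition far_weight (g : nat -> nat -> R) (i k : nat) : R :=
  if (i.+2 <= k)%N then g i k else if (k.+2 <= i)%N then g k i else 0.

(** Bounds for the two kernels on the other pairs of annuli. Since the measure
    [nu'] has the density [wght], up to constants, the deformed kernel is
    multiplied by two such factors. *)
Definition far0 : nat -> nat -> R :=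
  far_weight (fun i k => far_cst / (V k * (q ^+ k) `^ s)).

Definition far1 : nat -> nat -> R :=
  far_weight (fun i k => dfar_cst * (wght i * wght k) / (wV i * rad i `^ s)).

Definition K0 (x y : Z) : \bar R :=
  ((nu (ball x (mdist x y)) * (mdist x y `^ s)%:E)^-1)%E.

Definition K1 (x y : Z) : \bar R :=
  ((nu' (ball (j x) (mdist (j x) (j y))) * (mdist (j x) (j y) `^ s)%:E)^-1)%E.

Lemma far_weight_ge0 g i k : (forall i k, 0 <= g i k) -> 0 <= far_weight g i k.
Proof. by move=> g0; rewrite /far_weight; case: ifPn => // _; case: ifPn. Qed.

Lemma far_weight_sym g i k : far_weight g i k = far_weight g k i.
Proof.
rewrite /far_weight; case: ifPn => ik; case: ifPn => // ki.
by have := leq_trans ki (ltnW (ltnW ik)); rewrite ltnNge leqnSn.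
Qed.

Lemma far0_ge0 i k : 0 <= far0 i k.
Proof.
apply: far_weight_ge0 => l m; rewrite ltW// divr_gt0 ?far_cst_gt0//.
by rewrite mulr_gt0// powR_gt0.
Qed.

Lemma far1_ge0 i k : 0 <= far1 i k.
Proof.
apply: far_weight_ge0 => l m; apply/ltW/divr_gt0.
  by apply: mulr_gt0; [exact: dfar_cst_gt0|rewrite mulr_gt0 ?wght_gt0].
by apply: mulr_gt0; [exact: wV_gt0|exact/powR_gt0/rad_gt0].
Qed.

Lemma nearF_ge0 x y : (0 <= nearF x y)%E.
Proof.
rewrite /nearF; case: ifPn => // _; rewrite mule_ge0//.
by rewrite lee_fin invr_ge0 mulr_ge0 ?powR_ge0// fine_ge0.
Qed.

Lemma K0_ge0 x y : (0 <= K0 x y)%E.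
Proof. by rewrite inve_ge0 mule_ge0// lee_fin powR_ge0. Qed.

Lemma K1_ge0 x y : (0 <= K1 x y)%E.
Proof. by rewrite inve_ge0 mule_ge0// lee_fin powR_ge0. Qed.

Let d_gt0 (x y : Z) : x <> y -> 0 < mdist x y.
Proof. by move=> /eqP xy; rewrite mdist_gt0. Qed.

Lemma K0E (x y : Z) : x <> y ->
  K0 x y = ((vol nu x (mdist x y) * mdist x y `^ s)^-1)%:E.
Proof.
move=> xy; have d0 := d_gt0 xy.
rewrite /K0 -(volE nu_fin)// -EFinM inver ifF//.
by rewrite gt_eqF// mulr_gt0 ?powR_gt0//; exact: vol_gt0.
Qed.

(** Inverses in the extended reals, where the kernel takes the value [+oo] on
    the diagonal. *)
Lemma inve_le (c : R) (t : \bar R) : 0 < c -> (c%:E <= t)%E -> (t^-1 <= (c^-1)%:E)%E.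
Proof.
move=> c0 ct; have -> : (c^-1)%:E = (c%:E^-1)%E by rewrite inver gt_eqF.
rewrite lee_pV2// inE ?lee_fin ?(ltW c0)//.
by apply: le_trans ct; rewrite lee_fin ltW.
Qed.

Lemma inve_ge (c : R) (t : \bar R) : 0 < c -> (0 <= t)%E -> (t <= c%:E)%E ->
  ((c^-1)%:E <= t^-1)%E.
Proof.
move=> c0 t0 ct; have -> : (c^-1)%:E = (c%:E^-1)%E by rewrite inver gt_eqF.
by rewrite lee_pV2// inE// lee_fin ltW.
Qed.

Lemma nearF_le_K0 x y : (nearF x y <= F x y * K0 x y)%E.
Proof.
rewrite /nearF; have [->|/eqP xy] := eqVneq x y.
  by rewrite Fxx !mul0e; case: ifP.
case: ifPn => _; rewrite ?K0E// mule_ge0// lee_fin invr_ge0 mulr_ge0 ?powR_ge0//.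
by rewrite ltW// vol_gt0// d_gt0.
Qed.

Lemma not_nearP x y : ~~ near x y ->
  ((idx x).+2 <= idx y)%N \/ ((idx y).+2 <= idx x)%N.
Proof.
by rewrite negb_and -!ltnNge => /orP[]; [right|left].
Qed.

Lemma far_weightE1 g i k : (i.+2 <= k)%N -> far_weight g i k = g i k.
Proof. by rewrite /far_weight => ->. Qed.

Lemma far_weightE2 g i k : (i.+2 <= k)%N -> far_weight g k i = g i k.
Proof. by move=> ik; rewrite far_weight_sym far_weightE1. Qed.

Lemma K0_le x y :
  (F x y * K0 x y <= nearF x y + F x y * (far0 (idx x) (idx y))%:E)%E.
Proof.
have [->|/eqP xy] := eqVneq x y.
  by rewrite Fxx !mul0e adde0 nearF_ge0.
have [xny|xny] := boolP (near x y).
  by rewrite /nearF xny K0E// leeDl// mule_ge0// lee_fin far0_ge0.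
rewrite /nearF (negbTE xny) add0e lee_wpmul2l// K0E// lee_fin.
have c60 := far_cst_gt0.
have h i k x' y' z : (i.+2 <= k)%N -> S i x' -> S k y' -> (z = x' \/ z = y') ->
    mdist x' y' = mdist x y -> z = x ->
    (vol nu x (mdist x y) * mdist x y `^ s)^-1 <= far_cst / (V k * (q ^+ k) `^ s).
  move=> ik ix ky zz <- <-.
  have kp : 0 < V k * (q ^+ k) `^ s by rewrite mulr_gt0// powR_gt0.
  have dp : 0 < mdist x' y'.
    by have [_] := mdist_far ix ky ik; apply: lt_le_trans; exact: hgt_gt0.
  have vp : 0 < vol nu z (mdist x' y') * mdist x' y' `^ s.
    by rewrite mulr_gt0 ?powR_gt0//; exact: vol_gt0.
  rewrite -[far_cst / _]invf_div lef_pV2 ?posrE ?divr_gt0//.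
  rewrite [_ / far_cst]mulrC; case: zz => ->.
    exact: (nu_kernel_far ix ky ik ix (ltnW (ltnW ik))).
  exact: (nu_kernel_far ix ky ik ky (leqnn _)).
have [ik|ik] := not_nearP xny.
  by rewrite /far0 far_weightE1//; apply: (h _ _ x y x ik (idxP x) (idxP y)) => //; left.
rewrite /far0 far_weightE2//; apply: (h _ _ y x x ik (idxP y) (idxP x)) => //.
  by right.
exact: metric_sym.
Qed.

Lemma nearF_le_K1 x y :
  (nearF x y <= (kernel_up * (wght (idx x) * wght (idx y)))%:E * (F x y * K1 x y))%E.
Proof.
have W0 : 0 < kernel_up * (wght (idx x) * wght (idx y)).
  by apply: mulr_gt0; [exact: kernel_up_gt0|rewrite mulr_gt0 ?wght_gt0].
rewrite /nearF; have [->|/eqP xy] := eqVneq x y.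
  by rewrite Fxx !mul0e mule0; case: ifP.
case: ifPn => [/andP[xny ynx]|_]; last first.
  by rewrite !mule_ge0 ?K1_ge0// lee_fin ltW.
rewrite muleCA lee_wpmul2l//.
have [_ h] := nu'_kernel_near (idxP x) (idxP y) xny ynx (d_gt0 xy).
have v0 : 0 < vol nu x (mdist x y) * mdist x y `^ s.
  by rewrite mulr_gt0 ?powR_gt0 ?d_gt0//; apply: vol_gt0 => //; exact: d_gt0.
rewrite -lee_pdivrMl// -EFinM -invfM.
apply: inve_ge; first by rewrite mulr_gt0.
  by rewrite mule_ge0// lee_fin powR_ge0.
by rewrite -mulrA.
Qed.

Lemma K1_le x y :
  (F x y * K1 x y * (wght (idx x) * wght (idx y))%:E <=
   (kernel_lo^-1)%:E * nearF x y + F x y * (far1 (idx x) (idx y))%:E)%E.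
Proof.
have [->|/eqP xy] := eqVneq x y.
  by rewrite Fxx !mul0e adde0 mule_ge0 ?nearF_ge0// lee_fin invr_ge0 ltW// kernel_lo_gt0.
have W0 : 0 < wght (idx x) * wght (idx y) by rewrite mulr_gt0 ?wght_gt0.
have cl0 := kernel_lo_gt0.
have [xny|xny] := boolP (near x y).
  apply: (@le_trans _ _ ((kernel_lo^-1)%:E * nearF x y)%E); last first.
    by rewrite leeDl// mule_ge0// lee_fin far1_ge0.
  rewrite /nearF xny muleCA -muleA lee_wpmul2l//.
  have /andP[xny1 xny2] := xny.
  have [h _] := nu'_kernel_near (idxP x) (idxP y) xny1 xny2 (d_gt0 xy).
  have v0 : 0 < vol nu x (mdist x y) * mdist x y `^ s.
    by rewrite mulr_gt0 ?powR_gt0 ?d_gt0//; apply: vol_gt0 => //; exact: d_gt0.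
  have c0 : 0 < kernel_lo * (wght (idx x) * wght (idx y) *
      (vol nu x (mdist x y) * mdist x y `^ s)).
    by apply: mulr_gt0 => //; exact: mulr_gt0.
  have := inve_le c0 h => {}h.
  rewrite muleC; apply: (le_trans (lee_wpmul2l _ h)); first by rewrite lee_fin ltW.
  rewrite -EFinM lee_fin.
  have E (W c v : R) : W != 0 -> c != 0 -> v != 0 ->
      W * (c * (W * v))^-1 = c^-1 * v^-1.
    by move=> W1 cn v1; field; rewrite W1 cn v1.
  by rewrite E// lt0r_neq0.
rewrite /nearF (negbTE xny) mule0 add0e -muleA lee_wpmul2l//.
have cfar0 := dfar_cst_gt0.
have h i k l x' y' : (i.+2 <= k)%N -> S i x' -> S k y' -> S l x -> (i <= l)%N ->
    mdist (j x') (j y') = mdist (j x) (j y) ->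
    (K1 x y * (wght i * wght k)%:E <=
     (dfar_cst * (wght i * wght k) / (wV i * rad i `^ s))%:E)%E.
  move=> ik ix ky lx il e.
  have := nu'_kernel_far ix ky ik lx il; rewrite e => h.
  have r0 : 0 < wV i * rad i `^ s.
    by rewrite mulr_gt0 ?wV_gt0// powR_gt0// rad_gt0.
  have c0 : 0 < dfar_cst^-1 * (wV i * rad i `^ s) by rewrite mulr_gt0// invr_gt0.
  have := inve_le c0 h => {}h.
  rewrite muleC; apply: (le_trans (lee_wpmul2l _ h)).
    by rewrite lee_fin mulr_ge0// ltW// wght_gt0.
  by rewrite -EFinM lee_fin invfM invrK mulrCA mulrA.
have [ik|ik] := not_nearP xny.
  by rewrite /far1 far_weightE1//; apply: (h _ _ _ x y ik (idxP x) (idxP y) (idxP x)).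
rewrite /far1 far_weightE2// [(wght (idx x) * _)%R]mulrC.
apply: (h _ _ _ y x ik (idxP y) (idxP x) (idxP x)).
  by apply: ltnW; exact: ltnW.
exact: metric_sym.
Qed.

Local Notation blk := (block (nu : {measure set (borel b) -> \bar R})
  (S : nat -> set (borel b)) (u : borel b -> R) p).

(** Mean oscillations between annuli: these, unlike [blk], satisfy the
    triangle inequality with constants close to 1. *)
Definition nblk (i k : nat) : \bar R := (((V i * V k)^-1)%:E * blk i k)%E.

Let blk_ge0 i k : (0 <= blk i k)%E. Proof. exact: block_ge0. Qed.

Let VV0 i k : 0 < V i * V k. Proof. exact: mulr_gt0. Qed.

Lemma nblk_ge0 i k : (0 <= nblk i k)%E.
Proof. by rewrite mule_ge0// lee_fin invr_ge0 ltW. Qed.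

Lemma blkE i k : (blk i k = (V i * V k)%:E * nblk i k)%E.
Proof. by rewrite /nblk muleA -EFinM divff ?mul1e// lt0r_neq0. Qed.

Let blk_sym i k : blk i k = blk k i.
Proof. exact: (@block_sym _ (borel b) R nu S V u p mS cS VE mu_ i k). Qed.

Lemma nblk_sym i k : nblk i k = nblk k i.
Proof. by rewrite /nblk blk_sym [V i * _]mulrC. Qed.

Lemma nblk_tri e i l k : 0 < e ->
  (nblk i k <= ((1 + e) `^ p)%:E * nblk i l + ((1 + e^-1) `^ p)%:E * nblk l k)%E.
Proof.
move=> e0; have := @block_triangle _ (borel b) R nu S V u p mS cS VE V0 mu_ (ltW p_gt0) e i l k e0.
rewrite !blkE.
have tri_norm (A B C : \bar R) (vi vl vk Tc Cc : R) : 0 < vi -> 0 < vl -> 0 < vk ->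
    0 <= Tc -> 0 <= Cc -> (0 <= B)%E -> (0 <= C)%E ->
    (vl%:E * ((vi * vk)%:E * A) <= (Tc * vk)%:E * ((vi * vl)%:E * B) +
      (Cc * vi)%:E * ((vl * vk)%:E * C))%E ->
    (A <= Tc%:E * B + Cc%:E * C)%E.
  move=> vi0 vl0 vk0 T0 C0 B0 CC0; rewrite !muleA -!EFinM => h.
  have c0 : 0 < vi * vl * vk by rewrite !mulr_gt0.
  rewrite -(@lee_pmul2l _ (vi * vl * vk)%:E)// ?lte_fin//.
  rewrite ge0_muleDr ?mule_ge0// !muleA -!EFinM.
  rewrite (_ : vi * vl * vk = vl * (vi * vk)); last by ring.
  apply: (le_trans h); rewrite le_eqVlt; apply/orP; left; apply/eqP.
  by congr (_%:E * _ + _%:E * _)%E; ring.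
by apply: tri_norm => //; rewrite ?powR_ge0 ?nblk_ge0.
Qed.

(** The oscillation between consecutive annuli is part of the energy of
    neighbouring ones. *)
Lemma near_energy_ge M :
  (\sum_(0 <= k < M) ((near_cst * (V k * (q ^+ k) `^ s))^-1)%:E * blk k k.+1 <=
   near_energy)%E.
Proof.
pose c (i k : nat) : R := if k == i.+1 then (near_cst * (V i * (q ^+ i) `^ s))^-1 else 0.
have r0 i : 0 < near_cst * (V i * (q ^+ i) `^ s).
  by apply: mulr_gt0; [exact: near_cst_gt0|rewrite mulr_gt0// powR_gt0].
have c0 i k : 0 <= c i k by rewrite /c; case: ifPn => // _; rewrite invr_ge0 ltW.
apply: (@le_trans _ _ (\int[nu]_x \int[nu]_y (F x y * (c (idx x) (idx y))%:E))%E).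
  rewrite (@integral_osc_idx _ (borel b) R nu S V idx u p mS tS cS VE idxP mu_ c c0).
  have t0 i k : (0 <= (c i k)%:E * blk i k)%E by rewrite mule_ge0// lee_fin.
  apply: (@le_trans _ _ (\sum_(0 <= i < M) \sum_(k <oo) (c i k)%:E * blk i k)%E).
    apply: lee_sum => i _.
    apply: (@le_trans _ _ (\sum_(0 <= k < i.+2) (c i k)%:E * blk i k)%E); last first.
      exact: nneseries_lim_ge.
    have ci : c i i.+1 = (near_cst * (V i * (q ^+ i) `^ s))^-1 by rewrite /c eqxx.
    by rewrite big_nat_recr//= ci leeDr// sume_ge0.
  by apply: nneseries_lim_ge => i _ _; exact: nneseries_ge0.
apply: lower_integral_le => x _.
  by apply: integral_ge0 => y _; rewrite mule_ge0// lee_fin.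
apply: lower_integral_le => y _; first by rewrite mule_ge0// lee_fin.
have [->|/eqP xy] := eqVneq x y; first by rewrite Fxx mul0e nearF_ge0.
rewrite /c; case: ifPn => [/eqP yx|_]; last by rewrite mule0 nearF_ge0.
have xny : near x y by rewrite /near yx leqnn leqW// leqW.
rewrite /nearF xny lee_wpmul2l// lee_fin lef_pV2 ?posrE//.
  by apply: nu_kernel_near => //; [exact: idxP|rewrite -yx; exact: idxP|exact: d_gt0].
by rewrite mulr_gt0 ?powR_gt0 ?d_gt0//; apply: vol_gt0 => //; exact: d_gt0.
Qed.

Lemma mass_sum k : \sum_(0 <= i < k) V i <= dbl (1 + 2 * kappa) * V k.
Proof.
apply: le_trans (vol_b_le_mass k).
pose F' i : set (borel b) := if (i < k)%N then S i else set0.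
have mF' i : measurable (F' i) by rewrite /F'; case: ifP.
have tF' : trivIset setT F'.
  move=> i l _ _ [x []]; rewrite /F'; case: ifPn => // _ xi; case: ifPn => // _ xl.
  exact: (annulus_inj kappa_gt1 xi xl).
have := @lower_integral_pieces _ (borel b) R nu (ball b (q ^+ k)) F' (fun=> 1)
  (fun=> 1%E) k mF' tF' (fun=> ler01) (fun _ _ => lee01) _.
rewrite integral_cst ?mul1e; last exact: borel_ball.
rewrite -lee_fin -sumEFin (volE nu_fin)//.
move=> h; apply: le_trans (h _).
  rewrite !big_nat; apply: lee_sum => i /= ik.
  by rewrite mul1e /F' ik VE.
move=> i x; rewrite /F'; case: ifPn => // ik /andP[_ xi]; split => //.
rewrite ballEmdist /= metric_sym.
have := ler_qX kappa_gt1 ik; rewrite /hgt in xi; lra.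
Qed.

Lemma eta0_itv : 0 < (q `^ s)^-1 < 1.
Proof.
have h : 1 < q `^ s.
  have nn : q \in Num.nneg by rewrite nnegrE ltW.
  have q1' : 1 < q by have := q4; lra.
  by have := gt0_ltr_powR s_gt0 (rpred1 _) nn q1'; rewrite powR1.
by rewrite invr_gt0 invf_lt1 ?h ?(lt_trans ltr01)// (lt_trans _ h).
Qed.

Definition hardy0_cst : R := far_cst *
  (hardy_cst p (dbl (1 + 2 * kappa)) (q `^ s)^-1 * (dbl (q + 2 * kappa) * near_cst)).

Lemma hardy0_cst_ge0 : 0 <= hardy0_cst.
Proof.
apply: mulr_ge0; first exact: ltW far_cst_gt0.
apply: mulr_ge0.
  by rewrite ltW//; apply: hardy_cst_gt0 eta0_itv; exact: ltW.
by apply: mulr_ge0; [exact: ltW|exact: ltW near_cst_gt0].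
Qed.

(** For the undeformed kernel the weight of the pair [i < k] decays like
    [(q ^+ k) ^ (- s)], and the masses below [k] add up to a multiple of the mass
    of [k]. *)
Lemma far0_sum :
  (\sum_(i <oo) \sum_(k <oo) (far0 i k)%:E * blk i k <= 2%:E * (hardy0_cst%:E * near_energy))%E.
Proof.
have c60 := far_cst_gt0; have c100 := near_cst_gt0.
have t0 i k : (0 <= (far0 i k)%:E * blk i k)%E by rewrite mule_ge0// lee_fin far0_ge0.
have C00 : 0 <= dbl (1 + 2 * kappa) by exact: ltW.
have eta01 := eta0_itv.
have hc0 := hardy_cst_gt0 p C00 eta01.
pose Dw k := ((q ^+ k) `^ s)^-1.
have Dw0 k : 0 < Dw k by rewrite invr_gt0 powR_gt0.
apply: symmetric_sum_le; first exact: t0.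
- by move=> i k; rewrite /far0 far_weight_sym blk_sym.
- by move=> i; rewrite /far0 /far_weight ltnNge leqnSn /= mul0e.
move=> M; rewrite /hardy0_cst (EFinM far_cst) -(muleA far_cst%:E).
apply: (@le_trans _ _ (far_cst%:E *
    \sum_(0 <= k < M.+1) \sum_(0 <= i < k) (V i * Dw k)%:E * nblk i k)%E).
  rewrite ge0_sume_distrr; last first.
    by move=> k _; apply: sume_ge0 => i _; rewrite mule_ge0 ?nblk_ge0// lee_fin mulr_ge0 ?ltW.
  apply: lee_sum => k _; rewrite ge0_sume_distrr; last first.
    by move=> i _; rewrite mule_ge0 ?nblk_ge0// lee_fin mulr_ge0 ?ltW.
  rewrite !big_nat; apply: lee_sum => i /= ik.
  rewrite blkE (muleA (far0 i k)%:E) (muleA far_cst%:E) -!EFinM.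
  apply: lee_wpmul2r; first exact: nblk_ge0.
  rewrite lee_fin; have [ik2|ik2] := leqP i.+2 k.
    rewrite /far0 far_weightE1// /Dw le_eqVlt; apply/orP; left; apply/eqP.
    have v1 := lt0r_neq0 (V0 k); have v2 := lt0r_neq0 (powR_gt0 s (qX0 k)).
    by field; rewrite v1 v2.
  rewrite /far0 /far_weight leqNgt ik2 /= ifF ?mul0r ?mulr_ge0 ?ltW//.
  by apply/negbTE; rewrite -ltnNge; exact/leqW/leqW.
rewrite lee_wpmul2l ?lee_fin ?(ltW c60)//.
have := @hardy_up R nblk p (dbl (1 + 2 * kappa)) (q `^ s)^-1 M p_gt0 C00 eta01
  nblk_ge0 nblk_tri V Dw (fun k => ltW (V0 k)) (fun k => ltW (Dw0 k))
  (fun k _ => mass_sum k).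
have HD k : (k < M)%N -> Dw k.+1 <= (q `^ s)^-1 * Dw k.
  by move=> _; rewrite /Dw exprS powRM ?(ltW qpos) ?(ltW (qX0 k))// invfM.
move=> /(_ HD)/le_trans; apply.
rewrite (EFinM (hardy_cst _ _ _)) -(muleA (hardy_cst _ _ _)%:E).
rewrite lee_wpmul2l ?lee_fin ?(ltW hc0)//.
apply: (@le_trans _ _ ((dbl (q + 2 * kappa) * near_cst)%:E *
  \sum_(0 <= k < M) ((near_cst * (V k * (q ^+ k) `^ s))^-1)%:E * blk k k.+1)%E); last first.
  by rewrite lee_wpmul2l ?near_energy_ge// lee_fin mulr_ge0 ?ltW.
rewrite ge0_sume_distrr; last first.
  by move=> k _; rewrite mule_ge0// lee_fin invr_ge0 !mulr_ge0 ?powR_ge0 ?ltW.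
apply: lee_sum => k _; rewrite blkE (muleA (_^-1)%:E) (muleA (dbl _ * near_cst)%:E) -!EFinM.
apply: lee_wpmul2r; first exact: nblk_ge0.
rewrite lee_fin /Dw; set z := (q ^+ k) `^ s; have z0 : 0 < z by exact: powR_gt0.
rewrite [leRHS](_ : _ = dbl (q + 2 * kappa) * V k.+1 * z^-1); last first.
  have v1 := lt0r_neq0 (V0 k); have v2 := lt0r_neq0 z0; have v3 := lt0r_neq0 c100.
  by field; rewrite v1 v2 v3.
by rewrite ler_wpM2r ?invr_ge0 ?(ltW z0)// mass_index.
Qed.

(** The ratio of consecutive tails of the radii; the factor 2 keeps it
    positive. *)
Definition tau : R := 1 - (2 * rad_cst)^-1.

Lemma tau_itv : 0 < tau < 1.
Proof.
have C20 : 0 < 2 * rad_cst by rewrite mulr_gt0.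
rewrite /tau subr_gt0 invf_lt1// ltrBlDr ltrDl invr_gt0 C20 andbT.
by have := cR1; lra.
Qed.

Lemma eta1_itv : 0 < tau `^ s < 1.
Proof.
have /andP[tau0 tau1] := tau_itv.
rewrite powR_gt0//=; have nn : tau \in Num.nneg by rewrite nnegrE ltW.
by have := gt0_ltr_powR s_gt0 nn (rpred1 _) tau1; rewrite powR1.
Qed.

Definition hardy1_cst : R := dfar_cst * rad_cst `^ s * (hardy_cst p wV_cst (tau `^ s) * near_cst).

Lemma hardy1_cst_ge0 : 0 <= hardy1_cst.
Proof.
apply: mulr_ge0.
  by apply: mulr_ge0; [exact: ltW dfar_cst_gt0|exact: powR_ge0].
apply: mulr_ge0; last exact: ltW near_cst_gt0.
by rewrite ltW//; apply: hardy_cst_gt0 eta1_itv; exact: ltW wV_cst_gt0.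
Qed.

(** For the deformed kernel the roles of [b] and infinity are exchanged. The
    radii themselves may fail to decay from each annulus to the next, but their
    tails [I] do so by [tail_step], and they are comparable to the radii by
    [rad_tail]. *)
Lemma far1_sum :
  (\sum_(i <oo) \sum_(k <oo) (far1 i k)%:E * blk i k <= 2%:E * (hardy1_cst%:E * near_energy))%E.
Proof.
have cfar0 := dfar_cst_gt0; have c100 := near_cst_gt0; have cD0 := ltW wV_cst_gt0.
have t0 i k : (0 <= (far1 i k)%:E * blk i k)%E by rewrite mule_ge0// lee_fin far1_ge0.
have [tau0 tau1] := andP tau_itv; have eta01 := eta1_itv.
have hc0 := hardy_cst_gt0 p cD0 eta01.
apply: symmetric_sum_le; first exact: t0.
- by move=> i k; rewrite /far1 far_weight_sym blk_sym.
- by move=> i; rewrite /far1 /far_weight ltnNge leqnSn /= mul0e.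
move=> M; rewrite /hardy1_cst (EFinM (dfar_cst * _)) -(muleA (dfar_cst * _)%:E).
pose I i := \sum_(i <= m < M.+1) rad m.
have I0 i : 0 <= I i by apply: sumr_ge0 => m _; exact/ltW/rad_gt0.
have I1 i : (i <= M)%N -> rad i <= I i.
  move=> iM; rewrite /I big_ltn// lerDl sumr_ge0// => m _; exact/ltW/rad_gt0.
pose Dw i := (I i `^ s)^-1.
have Dw0 k : 0 <= Dw k by rewrite invr_ge0 powR_ge0.
have rp i : 0 < rad i `^ s by exact/powR_gt0/rad_gt0.
have Ip i : (i <= M)%N -> 0 < I i `^ s.
  by move=> iM; apply: powR_gt0; exact: lt_le_trans (rad_gt0 i) (I1 i iM).
have wV0 i : 0 < wV i by exact: wV_gt0.
apply: (@le_trans _ _ ((dfar_cst * rad_cst `^ s)%:E *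
    \sum_(0 <= k < M.+1) \sum_(0 <= i < k) (wV k * Dw i)%:E * nblk i k)%E).
  rewrite ge0_sume_distrr; last first.
    move=> k _; apply: sume_ge0 => i _.
    by rewrite mule_ge0 ?nblk_ge0// lee_fin mulr_ge0 ?(ltW (wV0 _)).
  rewrite !big_nat; apply: lee_sum => k /= kM; rewrite ge0_sume_distrr; last first.
    by move=> i _; rewrite mule_ge0 ?nblk_ge0// lee_fin mulr_ge0 ?(ltW (wV0 _)).
  rewrite !big_nat; apply: lee_sum => i /= ik.
  rewrite blkE (muleA (far1 i k)%:E) (muleA (dfar_cst * _)%:E) -!EFinM.
  have iM : (i <= M)%N by rewrite -ltnS; exact: ltn_trans ik kM.
  apply: lee_wpmul2r; first exact: nblk_ge0.
  have r0 : 0 <= dfar_cst * rad_cst `^ s * (wV k * Dw i).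
    by apply: mulr_ge0; apply: mulr_ge0 => //;
      [exact: ltW|exact: powR_ge0|exact: ltW (wV0 k)].
  rewrite lee_fin; have [ik2|ik2] := leqP i.+2 k; last first.
    rewrite /far1 /far_weight leqNgt ik2 /= ifF ?mul0r//.
    by apply/negbTE; rewrite -ltnNge; exact/leqW/leqW.
  have Ir : (rad i `^ s)^-1 <= rad_cst `^ s * Dw i.
    rewrite /Dw -ler_pdivrMr ?invr_gt0 ?Ip// invrK mulrC ler_pdivrMr//.
    by apply: powR_le_mul; rewrite ?(ltW (rad_gt0 _))// ?(ltW cR0)//; exact: rad_tail.
  rewrite /far1 far_weightE1//.
  have -> : dfar_cst * (wght i * wght k) / (wV i * rad i `^ s) * (V i * V k) =
      dfar_cst * wV k * (rad i `^ s)^-1.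
    rewrite /wV; have v1 := lt0r_neq0 (V0 i); have v2 := lt0r_neq0 (wght_gt0 i).
    have v3 := lt0r_neq0 (rp i); move: v1 v2 v3.
    move: (V i) (wght i) (rad i `^ s) => a1 a2 a3 v1 v2 v3.
    by field; rewrite v1 v2 v3.
  rewrite [leRHS](_ : _ = dfar_cst * wV k * (rad_cst `^ s * Dw i)); last by ring.
  by apply: ler_wpM2l => //; apply: mulr_ge0; [exact: ltW|exact: ltW (wV0 k)].
have cc0 : (0 <= (dfar_cst * rad_cst `^ s)%:E)%E.
  by rewrite lee_fin; apply: mulr_ge0; [exact: ltW|exact: powR_ge0].
apply: lee_wpmul2l => //.
have := @hardy_down R nblk p wV_cst (tau `^ s) M p_gt0 cD0 eta01
  nblk_ge0 nblk_sym nblk_tri wV Dw (fun k => ltW (wV0 k)) Dw0 (fun i _ => wV_tail i _).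
have HD k : (k < M)%N -> Dw k <= tau `^ s * Dw k.+1.
  move=> kM; rewrite /Dw -ler_pdivrMr ?invr_gt0 ?Ip// invrK mulrC.
  rewrite ler_pdivrMr ?Ip//; last exact: ltnW.
  apply: powR_le_mul => //; first exact: ltW.
  rewrite /I /tau; apply: tail_step => //; first exact: rad_gt0.
    move=> i N; apply: (le_trans (rad_tail i N)).
    by rewrite ler_wpM2r ?(ltW (rad_gt0 _))//; have := cR0; lra.
  by rewrite ltnS ltnW.
move=> /(_ HD)/le_trans; apply.
rewrite (EFinM (hardy_cst _ _ _)) -(muleA (hardy_cst _ _ _)%:E).
rewrite lee_wpmul2l ?lee_fin ?(ltW hc0)//.
apply: (@le_trans _ _ (near_cst%:E *
  \sum_(0 <= k < M) ((near_cst * (V k * (q ^+ k) `^ s))^-1)%:E * blk k k.+1)%E); last first.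
  by rewrite lee_wpmul2l ?near_energy_ge// lee_fin ltW.
rewrite ge0_sume_distrr; last first.
  by move=> k _; rewrite mule_ge0// lee_fin invr_ge0 !mulr_ge0 ?powR_ge0 ?ltW.
rewrite !big_nat; apply: lee_sum => k /= kM.
rewrite blkE (muleA (_^-1)%:E) (muleA near_cst%:E) -!EFinM.
apply: lee_wpmul2r; first exact: nblk_ge0.
rewrite lee_fin; set z := (q ^+ k) `^ s; have z0 : 0 < z by exact: powR_gt0.
rewrite [leRHS](_ : _ = V k.+1 * z^-1); last first.
  have v1 := lt0r_neq0 (V0 k); have v2 := lt0r_neq0 z0; have v3 := lt0r_neq0 c100.
  by field; rewrite v1 v2 v3.
have z1 : 0 < (q ^+ k.+1) `^ s by exact: powR_gt0.
have zz : z <= (q ^+ k.+1) `^ s.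
  apply: ge0_ler_powR; rewrite ?nnegrE ?(ltW (qX0 _))//.
  exact: ler_qX.
apply: (@le_trans _ _ (wV k.+1 * (rad k.+1 `^ s)^-1)).
  rewrite ler_wpM2l ?(ltW (wV0 _))// /Dw lef_pV2 ?posrE ?Ip//.
  by apply: ge0_ler_powR; rewrite ?nnegrE ?(ltW (rad_gt0 _)) ?I1.
rewrite /rad powRM ?(ltW (qX0 _)) ?(ltW (rhoq_gt0 _))// -/(wght k.+1) /wV invfM.
have w1 := lt0r_neq0 (wght_gt0 k.+1).
rewrite (_ : wght k.+1 * V k.+1 * (((q ^+ k.+1) `^ s)^-1 * (wght k.+1)^-1) =
  V k.+1 * ((q ^+ k.+1) `^ s)^-1); last first.
  have v2 := lt0r_neq0 z1; move: w1 v2.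
  move: (wght k.+1) ((q ^+ k.+1) `^ s) => a1 a2 a3 a4.
  by field; rewrite a3 a4.
by rewrite ler_wpM2l ?(ltW (V0 _))// lef_pV2 ?posrE.
Qed.

Definition wght_cst : R := cmp (2 * q) `^ s.

Let wght_cst_gt0 : 0 < wght_cst. Proof. exact: powR_gt0. Qed.

Let W (x : borel b) : \bar R := (wght (idx x))%:E.
Let Wi (x : borel z') : \bar R := ((wght (idx (jinv x)))^-1)%:E.

Let W_ge0 x : (0 <= W x)%E. Proof. by rewrite lee_fin ltW// wght_gt0. Qed.
Let Wi_ge0 x : (0 <= Wi x)%E.
Proof. by rewrite lee_fin invr_ge0 ltW// wght_gt0. Qed.

Let mj : measurable_fun setT (j : borel b -> borel z').
Proof. exact: continuous_measurable. Qed.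

Let midx (f : nat -> R) : measurable_fun setT ((f \o idx) : borel b -> R).
Proof. exact: (@measurable_idx _ (borel b) R S idx mS tS idxP f). Qed.

Let mW : measurable_fun setT W.
Proof. by apply/measurable_EFinP; exact: (midx wght). Qed.

Let mWi : measurable_fun setT Wi.
Proof.
apply/measurable_EFinP.
exact: (measurableT_comp (midx (fun k => (wght k)^-1)) mjinv).
Qed.

Let idx_hgt x : H x <= q * q ^+ idx x /\ q ^+ idx x <= q * H x.
Proof.
have /andP[x1 x2] := idxP x; rewrite exprS in x2; split; first exact: ltW.
by rewrite (le_trans x1)// ler_peMl// ltW// hgt_gt0.
Qed.

Lemma nu'_le_weight (B : set (borel z')) : measurable B ->
  (nu' B <= wght_cst%:E * \int[nu]_(x in j @^-1` B) W x)%E.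
Proof.
move=> mB; have mjB : measurable (j @^-1` B : set (borel b)).
  by rewrite -[j @^-1` B]setTI; exact: mj.
rewrite nu'E// -ge0_integralZl//; last 2 first.
- exact: measurable_funTS.
- by rewrite lee_fin ltW.
rewrite [leLHS]integral_mkcond [leRHS]integral_mkcond; apply: lower_integral_le => x _.
  by rewrite erestrict_ge0// => y _; rewrite lee_fin powR_ge0.
rewrite /patch; case: ifPn => [/set_mem[Bx xb]|_]; last first.
  by case: ifPn => // _; rewrite mule_ge0// lee_fin ltW.
rewrite mem_set// -EFinM lee_fin; have [h1 h2] := idx_hgt x.
by have [] := wght_mdist q1 xb h1 h2.
Qed.

(** Summation over the annuli, on each of which [nu'_ge] reverses the
    comparison of [nu'_le_weight]. *)
Lemma nu_le_weight (A : set (borel b)) : measurable A ->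
  (nu A <= wght_cst%:E * \int[nu']_(x in jinv @^-1` A) Wi x)%E.
Proof.
move=> mA; pose B k : set (borel z') := jinv @^-1` (A `&` S k).
have mAS k : measurable (A `&` S k : set (borel b)) by exact: measurableI.
have mB k : measurable (B k) by rewrite /B -[X in measurable X]setTI; exact: mjinv.
have tAS : trivIset setT (fun k => A `&` S k : set (borel b)).
  by apply: trivIset_setIl; exact: tS.
have tB : trivIset setT B.
  by move=> k l _ _ [x [xk xl]]; apply: (tAS k l) => //; exists (jinv x).
have AE : A = \bigcup_k (A `&` S k) by rewrite -setI_bigcupr cS setIT.
have BE : jinv @^-1` A = \bigcup_k B k by rewrite /B -preimage_bigcup -AE.
rewrite BE ge0_integral_bigcup//; last first.
  by apply: measurable_funTS.
rewrite {1}AE measure_bigcup// -nneseriesZl//; last first.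
  by move=> k _; exact: integral_ge0.
under eq_eseriesl do rewrite in_setT.
apply: lee_nneseries => // k _.
rewrite (eq_integral (fun _ => ((wght k)^-1)%:E)); last first.
  move=> x /set_mem[_ xk]; rewrite /Wi.
  by rewrite (annulus_inj kappa_gt1 (idxP (jinv x)) xk).
rewrite integral_cst//.
have w0 := wght_gt0 k.
have sub : A `&` S k `<=` j @^-1` B k by move=> x; rewrite /B /= jK.
have := nu'_ge q1 (mAS k) (mB k) sub (k := k).
have hA x : (A `&` S k) x -> H x <= q * q ^+ k /\ q ^+ k <= q * H x.
  move=> [_ xk]; have := idx_hgt x.
  by rewrite (annulus_inj kappa_gt1 (idxP x) xk).
move=> /(_ hA) h; rewrite muleA -EFinM.
have c0 : 0 < wght_cst * (wght k)^-1 by rewrite mulr_gt0// invr_gt0.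
rewrite -lee_pdivrMl//; apply: le_trans h.
by rewrite invfM invrK.
Qed.

Lemma nu'_range : nu' (~` range j : set (borel z')) = 0%E.
Proof.
rewrite nu'E; last exact: measurableC.
rewrite (_ : (j @^-1` _) `\ b = set0) ?integral_set0//.
by apply/seteqP; split => // x [/= nj _]; apply: nj; exists x.
Qed.

Definition energy0 : \bar R := (\int[nu]_x \int[nu]_y (F x y * K0 x y))%E.

Lemma near_energy_le0 : (near_energy <= energy0)%E.
Proof.
apply: lower_integral_le => x _.
  by apply: integral_ge0 => y _; exact: nearF_ge0.
by apply: lower_integral_le => y _; [exact: nearF_ge0|exact: nearF_le_K0].
Qed.

Let far_int (g : nat -> nat -> R) (c : R) (f : Z -> Z -> \bar R) : 0 < c ->
  (forall i k, 0 <= g i k) -> (forall x y, 0 <= f x y)%E ->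
  (forall x y, f x y <= c%:E * nearF x y + F x y * (g (idx x) (idx y))%:E)%E ->
  (\int[nu]_x \int[nu]_y f x y <=
   c%:E * near_energy + \sum_(i <oo) \sum_(k <oo) (g i k)%:E * blk i k)%E.
Proof.
move=> c0 g0 f0 H1.
have nF0 x y : (0 <= c%:E * nearF x y)%E.
  by rewrite mule_ge0 ?nearF_ge0// lee_fin ltW.
have h0 x y : (0 <= F x y * (g (idx x) (idx y))%:E)%E by rewrite mule_ge0// lee_fin.
have N0 x : (0 <= \int[nu]_y nearF x y)%E.
  by apply: integral_ge0 => y _; exact: nearF_ge0.
rewrite -(@integral_osc_idx _ (borel b) R nu S V idx u p mS tS cS VE idxP mu_ g g0).
rewrite /near_energy -lower_integralZl//.
pose G2 (x : borel b) := (\int[nu]_y (F x y * (g (idx x) (idx y))%:E))%E.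
apply: (@le_trans _ _ (\int[nu]_x (c%:E * (\int[nu]_y nearF x y) + G2 x))%E).
  apply: lower_integral_le => x _; first by apply: integral_ge0 => y _.
  apply: (@le_trans _ _ (\int[nu]_y (c%:E * nearF x y + F x y * (g (idx x) (idx y))%:E))%E).
    by apply: lower_integral_le.
  rewrite -lower_integralZl//; last exact: nearF_ge0.
  apply: lower_integralD => //.
  apply: emeasurable_funM; first exact: (@measurable_osc2 _ (borel b) R u p mu_ x).
  by apply/measurable_EFinP; exact: (midx (g (idx x))).
apply: lower_integralD.
- by move=> x; rewrite mule_ge0// lee_fin ltW.
- by move=> x; exact: integral_ge0.
- exact: (@measurable_inner _ (borel b) R nu S V idx u p mS tS cS VE idxP mu_ g g0).
Qed.

Definition e0_cst : R := 1 + 2 * hardy0_cst.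

Lemma energy0_le : (energy0 <= e0_cst%:E * near_energy)%E.
Proof.
have ne0 : (0 <= near_energy)%E.
  by apply: integral_ge0 => x _; apply: integral_ge0 => y _; exact: nearF_ge0.
apply: (le_trans (@far_int far0 1 _ ltr01 far0_ge0 _ _)).
- by move=> x y; rewrite mule_ge0 ?K0_ge0.
- by move=> x y; rewrite mul1e; exact: K0_le.
apply: (le_trans (leeD (lexx _) far0_sum)).
by rewrite muleA -EFinM -ge0_muleDl ?lee_fin// mulr_ge0// hardy0_cst_ge0.
Qed.

Variable v : Z' -> R.
Hypothesis vj : forall x, v (j x) = u x.

Definition G (x y : Z') : \bar R :=
  ((`|v y - v x| `^ p)%:E *
   (nu' (ball x (mdist x y)) * (mdist x y `^ s)%:E)^-1)%E.

Definition energy1 : \bar R := (\int[nu']_x \int[nu']_y G x y)%E.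

Lemma G_ge0 x y : (0 <= G x y)%E.
Proof.
by rewrite mule_ge0 ?lee_fin ?powR_ge0// inve_ge0 mule_ge0// lee_fin powR_ge0.
Qed.

Let Gj x y : G (j x) (j y) = (F x y * K1 x y)%E.
Proof. by rewrite /G !vj. Qed.

(** The integrals are moved to the original boundary, one variable at a time;
    the weights then turn the deformed kernel into the original one on
    neighbouring annuli, and [far1_sum] bounds the rest. *)
Lemma energy1_le :
  (energy1 <= ((wght_cst * wght_cst) * (kernel_lo^-1 + 2 * hardy1_cst))%:E * near_energy)%E.
Proof.
have cwe0 : (0 <= wght_cst%:E)%E by rewrite lee_fin ltW.
pose E2 := (\int[nu]_x \int[nu]_y (W x * (G (j x) (j y) * W y)))%E.
have G0 x y : (0 <= W x * (G (j x) (j y) * W y))%E.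
  by apply: mule_ge0 => //; apply: mule_ge0 => //; exact: G_ge0.
have I0 x : (0 <= \int[nu']_y G x y)%E by apply: integral_ge0 => y _; exact: G_ge0.
have inner x : (\int[nu']_y G (j x) y * W x <=
    wght_cst%:E * \int[nu]_y (W x * (G (j x) (j y) * W y)))%E.
  rewrite lower_integralZl ?wght_gt0//; last by move=> y; apply: mule_ge0 => //; exact: G_ge0.
  rewrite muleCA muleC lee_wpmul2l//.
  apply: (lower_integral_transport mj mW W_ge0 wght_cst_gt0 nu'_le_weight) => y.
  exact: G_ge0.
have h1 : (energy1 <= (wght_cst * wght_cst)%:E * E2)%E.
  apply: (le_trans (lower_integral_transport mj mW W_ge0 wght_cst_gt0 nu'_le_weight I0)).
  rewrite EFinM -muleA lee_wpmul2l// -lower_integralZl//; last first.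
    by move=> x; exact: integral_ge0.
  by apply: lower_integral_le => x _; [rewrite mule_ge0|exact: inner].
apply: (le_trans h1); rewrite (EFinM (wght_cst * wght_cst)) -muleA.
rewrite lee_wpmul2l ?lee_fin ?mulr_ge0 ?(ltW wght_cst_gt0)//.
have cN0 : 0 < kernel_lo^-1 by rewrite invr_gt0 kernel_lo_gt0.
apply: (le_trans (@far_int far1 _ _ cN0 far1_ge0 G0 _)).
  move=> x y; apply: le_trans (K1_le x y).
  by rewrite Gj muleCA -EFinM.
apply: (le_trans (leeD (lexx _) far1_sum)).
have cf10 := hardy1_cst_ge0.
by rewrite (muleA 2%:E) -EFinM -ge0_muleDl ?lee_fin ?(ltW cN0)// mulr_ge0.
Qed.

(** The converse transport, by the inverse of [j]; points outside the range of
    [j], among them infinity, form a null set. *)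
Lemma near_energy_le1 : (near_energy <= (wght_cst * wght_cst * kernel_up)%:E * energy1)%E.
Proof.
have cwe0 : (0 <= wght_cst%:E)%E by rewrite lee_fin ltW.
have cN0 := kernel_up_gt0.
have mN : measurable (~` range j : set (borel z')) by exact: measurableC.
have jinvK x : range j x -> j (jinv x) = x by move=> [y _ <-]; rewrite jK.
pose f x y := (Wi x * (nearF (jinv x) (jinv y) * Wi y))%E.
have f0 x y : (0 <= f x y)%E.
  by apply: mule_ge0 => //; apply: mule_ge0 => //; exact: nearF_ge0.
have I0 x : (0 <= \int[nu]_y nearF x y)%E.
  by apply: integral_ge0 => y _; exact: nearF_ge0.
have inner x : (\int[nu]_y nearF (jinv x) y * Wi x <= wght_cst%:E * \int[nu']_y f x y)%E.
  rewrite lower_integralZl ?invr_gt0 ?wght_gt0//; last first.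
    by move=> y; rewrite mule_ge0 ?nearF_ge0.
  rewrite muleCA muleC lee_wpmul2l//.
  apply: (lower_integral_transport mjinv mWi Wi_ge0 wght_cst_gt0 nu_le_weight) => y.
  exact: nearF_ge0.
apply: (le_trans (lower_integral_transport mjinv mWi Wi_ge0 wght_cst_gt0 nu_le_weight I0)).
rewrite EFinM EFinM -!muleA lee_wpmul2l//.
rewrite -[X in (_ <= wght_cst%:E * X)%E]lower_integralZl//; last first.
  by move=> x; apply: integral_ge0 => y _; exact: G_ge0.
rewrite -lower_integralZl//; last first.
  move=> x; rewrite mule_ge0 ?lee_fin ?(ltW cN0)//.
  by apply: integral_ge0 => y _; exact: G_ge0.
apply: (lower_integral_null mN nu'_range) => [x|x|x /contrapT jx].
- by rewrite mule_ge0.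
- rewrite mule_ge0// mule_ge0 ?lee_fin ?(ltW cN0)//.
  by apply: integral_ge0 => y _; exact: G_ge0.
apply: (le_trans (inner x)); rewrite lee_wpmul2l//.
rewrite -lower_integralZl//; last by move=> y; exact: G_ge0.
apply: (lower_integral_null mN nu'_range) => [y|y|y /contrapT jy].
- exact: f0.
- by rewrite mule_ge0 ?G_ge0// lee_fin ltW.
rewrite /f /Wi -[in leRHS](jinvK x)// -[in leRHS](jinvK y)// Gj.
have wx := wght_gt0 (idx (jinv x)); have wy := wght_gt0 (idx (jinv y)).
have w0 : wght (idx (jinv x)) * wght (idx (jinv y)) != 0.
  by rewrite mulf_neq0 ?lt0r_neq0.
rewrite muleCA -EFinM -invfM.
apply: (le_trans (lee_wpmul2r _ (nearF_le_K1 (jinv x) (jinv y)))).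
  by rewrite lee_fin invr_ge0 mulr_ge0 ?(ltW wx) ?(ltW wy).
by rewrite muleAC -EFinM mulfK.
Qed.

Definition equiv_cst : R :=
  1 + e0_cst * (wght_cst * wght_cst * kernel_up) +
  wght_cst * wght_cst * (kernel_lo^-1 + 2 * hardy1_cst).

Lemma e0_cst_ge1 : 1 <= e0_cst.
Proof. by rewrite lerDl mulr_ge0// hardy0_cst_ge0. Qed.

Let sum_ge0 : 0 <= e0_cst * (wght_cst * wght_cst * kernel_up) /\
  0 <= wght_cst * wght_cst * (kernel_lo^-1 + 2 * hardy1_cst).
Proof.
have h0 := lt_le_trans ltr01 e0_cst_ge1.
have h1 := kernel_up_gt0; have h2 := kernel_lo_gt0; have h3 := hardy1_cst_ge0.
have h4 := mulr_gt0 wght_cst_gt0 wght_cst_gt0.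
split; first by rewrite ltW//; apply: mulr_gt0 => //; exact: mulr_gt0.
apply: mulr_ge0; first exact: ltW.
by apply: addr_ge0; [rewrite invr_ge0 ltW|exact: mulr_ge0].
Qed.

Lemma energy0_le_energy1 : (energy0 <= equiv_cst%:E * energy1)%E.
Proof.
have e10 : (0 <= energy1)%E.
  by apply: integral_ge0 => x _; apply: integral_ge0 => y _; exact: G_ge0.
have e00 := lt_le_trans ltr01 e0_cst_ge1.
apply: (le_trans energy0_le).
apply: (@le_trans _ _ (e0_cst%:E * ((wght_cst * wght_cst * kernel_up)%:E * energy1))%E).
  by rewrite lee_wpmul2l ?near_energy_le1// lee_fin ltW.
rewrite (muleA e0_cst%:E) -EFinM lee_wpmul2r// lee_fin /equiv_cst.
by have [h1 h2] := sum_ge0; lra.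
Qed.

Lemma energy1_le_energy0 : (energy1 <= equiv_cst%:E * energy0)%E.
Proof.
have e00 : (0 <= energy0)%E.
  apply: integral_ge0 => x _; apply: integral_ge0 => y _.
  by apply: mule_ge0 => //; exact: K0_ge0.
have [h1 h2] := sum_ge0.
apply: (le_trans energy1_le).
apply: (@le_trans _ _ ((wght_cst * wght_cst * (kernel_lo^-1 + 2 * hardy1_cst))%:E * energy0)%E).
  by rewrite lee_wpmul2l ?near_energy_le0// lee_fin.
by rewrite lee_wpmul2r// lee_fin /equiv_cst; lra.
Qed.

Lemma range_j_gt0 : (0 < nu' (range j))%E.
Proof.
have hA x : S 0 x -> H x <= q * q ^+ 0 /\ q ^+ 0 <= q * H x.
  move=> x0; have := idx_hgt x.
  by rewrite (annulus_inj kappa_gt1 (idxP x) x0).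
have := nu'_ge q1 (mS 0) mrange_j (fun x _ => imageT j x) hA.
by apply: lt_le_trans; rewrite -VE mule_gt0// lte_fin// mulr_gt0 ?wght_gt0// invr_gt0 powR_gt0.
Qed.

Lemma energy1_fin_slice : (energy1 < +oo)%E ->
  exists x, (\int[nu']_y G (j x) y < +oo)%E.
Proof.
move=> efin; apply/not_existsP => H1.
have I0 x : (0 <= \int[nu']_y G x y)%E by apply: integral_ge0 => y _; exact: G_ge0.
have e10 : (0 <= energy1)%E by exact: integral_ge0.
have r0 := range_j_gt0.
have rfin : (nu' (range j) < +oo)%E.
  by apply: le_lt_trans nu'T_fin; apply: le_measure; rewrite ?inE.
have ra : 0 < fine (nu' (range j)) by rewrite fine_gt0// r0.
pose c := (fine energy1 + 1) / fine (nu' (range j)).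
have e1 : 0 <= fine energy1 by exact: fine_ge0.
have c0 : 0 <= c by rewrite divr_ge0 ?(ltW ra)// addr_ge0.
have : (c%:E * nu' (range j) <= energy1)%E.
  apply: lower_integral_ge_cst => // x [y _ <-].
  by have /negP := H1 y; rewrite -leNgt leye_eq => /eqP ->; rewrite leey.
rewrite -(fineK (_ : nu' (range j) \is a fin_num)) ?ge0_fin_numE//.
rewrite -(fineK (_ : energy1 \is a fin_num)) ?ge0_fin_numE//.
by rewrite -EFinM lee_fin /c divfK ?lt0r_neq0//; lra.
Qed.

(** Points of the sphericalized boundary lie at bounded distance and [nu'] is
    finite, so the kernel is bounded below and a single finite slice of the
    energy controls the integral of [`|v|^p]. *)
Lemma energy1_fin_Lp : (energy1 < +oo)%E ->
  (\int[nu']_x (`|v x| `^ p)%:E < +oo)%E.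
Proof.
move=> /energy1_fin_slice[x0 fin0].
have r0 := rad_gt0 0; have c30 := rad_up_gt0.
pose M := rad_up * (rad_cst * rad 0).
have M0 : 0 < M by apply: mulr_gt0 => //; exact: mulr_gt0.
pose t := fine (nu' setT) + 1.
have nT : (nu' setT <= t%:E)%E.
  by rewrite EFinD fineK ?leeDl ?lee01// ge0_fin_numE// nu'T_fin.
have t0 : 0 < t by rewrite /t ltr_wpDl// fine_ge0.
pose c := t * M `^ s.
have cpos : 0 < c by rewrite mulr_gt0// powR_gt0.
have Gge y : (c^-1%:E * (`|v (j y) - v (j x0)| `^ p)%:E <= G (j x0) (j y))%E.
  rewrite /G muleC lee_wpmul2l ?lee_fin ?powR_ge0//.
  apply: inve_ge => //; first by rewrite mule_ge0// lee_fin powR_ge0.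
  rewrite EFinM lee_pmul ?lee_fin ?powR_ge0//.
    by apply: le_trans nT; apply: le_measure; rewrite ?inE//; exact: measurable_jball.
  by apply: ge0_ler_powR; rewrite ?nnegrE ?mdist_ge0 ?(ltW M0)//; exact: dist_bounded.
pose T := (1 + 1) `^ p * c; pose T' := (1 + 1^-1) `^ p * `|v (j x0)| `^ p.
have T0 : 0 < T by rewrite mulr_gt0// powR_gt0.
have T'0 : 0 <= T' by rewrite mulr_ge0// powR_ge0.
have TG0 y : (0 <= T%:E * G (j x0) y + T'%:E)%E.
  by apply: adde_ge0; rewrite ?lee_fin// mule_ge0 ?G_ge0// lee_fin ltW.
have mN : measurable (~` range j : set (borel z')) by exact: measurableC.
apply: (@le_lt_trans _ _ (\int[nu']_y (T%:E * G (j x0) y + T'%:E))%E).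
  apply: (lower_integral_null mN nu'_range) => // y.
  move=> /contrapT[x _ <-].
  apply: (@le_trans _ _ (T%:E * (c^-1%:E * (`|v (j x) - v (j x0)| `^ p)%:E) + T'%:E)%E).
    rewrite -!EFinM -EFinD lee_fin /T /T' -mulrA (mulrA c) divff ?lt0r_neq0// mul1r.
    apply: le_trans (powR_add_le (ltW p_gt0) ltr01 _ _) => //.
    apply: ge0_ler_powR; rewrite ?nnegrE ?(ltW p_gt0)// ?addr_ge0//.
    by rewrite -{1}(subrK (v (j x0)) (v (j x))) ler_normD.
  by rewrite leeD2r// lee_wpmul2l// lee_fin ltW.
apply: le_lt_trans (lower_integralD _ _ _ _) _ => //.
  by move=> y; rewrite mule_ge0 ?G_ge0// lee_fin ltW.
rewrite lower_integralZl//; last by move=> y; exact: G_ge0.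
rewrite integral_cst// lte_add_pinfty//.
  by rewrite lte_mul_pinfty// lee_fin ltW.
by rewrite lte_mul_pinfty// nu'T_fin.
Qed.

End scales.

(** * Both energies on the boundary of the domain *)

Section identification.
Context {R : realType} {X : metricType R} (Omega : set X) (b : bdry Omega).
Variables (rho : R -> R) (CA CU : R).
Variables (Y : metricType R) (iota : set_type Omega -> Y).
Variables (j : bdry Omega -> bdry_rho iota) (infty : bdry_rho iota).
Hypothesis rho_gt0 : forall r, 0 < r -> 0 < rho r.
Hypothesis rhoA : condA rho CA.
Hypothesis OmegaU : uniform_domain Omega CU.
Hypothesis OmegaD : closure Omega = [set: X].
Hypothesis Omegaoo : unbounded Omega.
Hypothesis Xc : metric_complete [set: X].
Hypothesis iotaC : is_completion b rho iota.
Hypothesis jP : boundary_identification b j infty.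

Let j_inj : injective j.
Proof. exact: (boundary_inj rho_gt0 rhoA OmegaD iotaC jP). Qed.

(** A closed set is a countable union of closed sets of bounded height, whose
    images are closed. *)
Lemma measurable_closed_image (F : set (bdry Omega)) : closed F ->
  measurable (j @` F : set (borel infty)).
Proof.
move=> cF; pose B n := F `&` [set x | hgt b x <= n%:R].
have -> : F = \bigcup_n B n.
  apply/seteqP; split => [x Fx|x [n _ []//]].
  exists (Num.truncn (hgt b x)).+1 => //; split => //=; apply: ltW.
  by have /andP[_] := truncn_itv (ltW (hgt_gt0 b x)).
rewrite image_bigcup; apply: bigcup_measurable => n _; apply: borel_closed.
apply: (boundary_closed_image rho_gt0 rhoA OmegaU OmegaD Xc iotaC jP (M := n%:R)).
- apply: closedI => //; apply: (preimage_closed _ (@closed_le R n%:R)) => x _.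
  exact: hgt_continuous.
- by move=> x [].
Qed.

(** Outside the range of [j], which is a null set, the value [b] is arbitrary. *)
Definition bdry_inv (z : bdry_rho iota) : bdry Omega := xget b [set x | j x = z].

Lemma bdry_invK : cancel j bdry_inv.
Proof.
move=> x; apply: j_inj.
by apply: (@xgetPex _ b [set y | j y = j x]); exists x.
Qed.

Lemma measurable_bdry_inv :
  measurable_fun setT (bdry_inv : borel infty -> borel b).
Proof.
have closed_preim F : closed F ->
    measurable (bdry_inv @^-1` F : set (borel infty)).
  move=> cF; have mF := measurable_closed_image cF.
  have mr : measurable (range j : set (borel infty)).
    by apply: measurable_closed_image; exact: closedT.
  have out z : ~ range j z -> bdry_inv z = b.
    move=> nz; apply: xgetPN => x xz; apply: nz.
    by exists x.
  have [Fb|nFb] := pselect (F b).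
    rewrite (_ : _ @^-1` _ = j @` F `|` ~` range j).
      by apply: measurableU => //; exact: measurableC.
    apply/seteqP; split => z /=.
      have [[x _ <-]|nz _] := pselect (range j z); last by right.
      by rewrite bdry_invK => Fx; left; exists x.
    by move=> [[x Fx <-]|/out ->//]; rewrite bdry_invK.
  rewrite (_ : _ @^-1` _ = j @` F)//.
  apply/seteqP; split => z /=; last by move=> [x Fx <-]; rewrite bdry_invK.
  have [[x _ <-]|/out -> //] := pselect (range j z).
  by rewrite bdry_invK => Fx; exists x.
apply: (@measurability _ _ (borel infty) (borel b) setT bdry_inv (@open (bdry Omega))) => //.
move=> _ [B oB <-]; rewrite setTI -[B]setCK -preimage_setC.
by apply: measurableC; apply: closed_preim; exact: open_closedC.
Qed.

Lemma nu_rho_integral (p theta : R) (nu : {measure set (borel b) -> \bar R})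
    (nu_rho : {measure set (borel infty) -> \bar R}) :
  is_nu_rho nu rho p theta j nu_rho ->
  forall B : set (borel infty), measurable B ->
  nu_rho B = (\int[nu]_(x in (j @^-1` B) `\ b)
                (rho (mdist (x : bdry Omega) b) `^ (p - theta))%:E)%E.
Proof.
move=> [E Ejb Eoo] B mB.
have m1 := @borel_set1 _ _ infty.
pose N : set (borel infty) := [set j b] `|` [set infty].
have mN : measurable N by apply: measurableU.
have N0 : nu_rho N = 0%E.
  apply/eqP; rewrite eq_le measure_ge0 andbT.
  apply: (le_trans (measureU2 _ _ _)) => //.
  by rewrite [X in (X + _)%E]Ejb [X in (_ + X)%E]Eoo adde0.
have BI0 : nu_rho (B `&` N) = 0%E.
  apply/eqP; rewrite eq_le measure_ge0 andbT -N0.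
  by apply: le_measure; rewrite ?inE//; exact: measurableI.
have mBN : measurable (B `\` N) by exact: measurableD.
rewrite -[in LHS](setDUK (_ : B `&` N `<=` B))// measureU//; last 3 first.
- exact: measurableI.
- by apply: measurableD => //; exact: measurableI.
- by rewrite setDIK.
have -> : B `\` (B `&` N) = B `\` N.
  by apply/seteqP; split => z [Bz nz]; split => // Nz; apply: nz; [split|case: Nz].
rewrite [X in (X + _)%E]BI0 add0e.
apply: (etrans (E _ mBN _ _)).
- by move=> [_ nN]; apply: nN; left.
- by move=> [_ nN]; apply: nN; right.
congr (integral _ _ _).
apply/seteqP; split => x /=.
  by move=> [Bx nN]; split => // xb; apply: nN; left; rewrite xb.
move=> [Bx xb]; split => // -[/j_inj//|].
exact: (boundary_neq_infty rho_gt0 rhoA OmegaD Omegaoo iotaC jP).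
Qed.

End identification.

Lemma poweR_inv_le {R : realType} (p C : R) (x y : \bar R) : 1 <= p -> 1 <= C ->
  (0 <= x)%E -> (0 <= y)%E -> (x <= C%:E * y)%E ->
  (x `^ p^-1 <= C%:E * y `^ p^-1)%E.
Proof.
move=> p1 C1 x0 y0 xy; have p0 : 0 < p by lra.
have C0 : 0 <= C by lra.
apply: (@le_trans _ _ ((C%:E * y) `^ p^-1)%E).
  apply: gt0_ler_poweR => //; [by rewrite invr_ge0 ltW|by rewrite in_itv/= x0 leey|].
  by rewrite in_itv/= leey andbT mule_ge0.
rewrite poweRM ?lee_fin//; apply: lee_wpmul2r; first exact: poweR_ge0.
rewrite poweR_EFin lee_fin -[leRHS]powRr1//; apply: ler_powR => //.
by rewrite invf_le1.
Qed.

(** Codimensionality turns the doubling of [mu] into that of [nu]. It forces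
    [Ctheta] to be nonnegative, and for [Ctheta = 0] it leaves the zero measure
    only. *)
Lemma doubling_codimensional {R : realType} {X : metricType R} (Omega : set X)
    (b : bdry Omega) (mu : {measure set (borel (\val b)) -> \bar R})
    (nu : {measure set (borel b) -> \bar R}) (Cmu theta Ctheta : R) :
  doubling mu Cmu -> unbounded (~` Omega) -> codimensional mu nu theta Ctheta ->
  [/\ 0 <= Ctheta,
      0 < Ctheta -> forall (x : bdry Omega) r, 0 < r -> [/\ (0 < nu (ball x r))%E,
        (nu (ball x r) < +oo)%E &
        (nu (ball x (2 * r)) <= (Ctheta ^+ 2 * 2 `^ (- theta) * Cmu)%:E * nu (ball x r))%E]
    & Ctheta = 0 -> nu setT = 0%E].
Proof.
move=> muD bdoo cod.
have diamE : diam [set: bdry Omega] = +oo%E.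
  rewrite -bdoo /unbounded /diam; congr ereal_sup; apply/seteqP; split.
    move=> _ [x _ [y _ <-]]; exists (val x); first exact: set_valP.
    by exists (val y) => //; exact: set_valP.
  move=> _ [x Ox [y Oy <-]]; exists (exist _ x (mem_set Ox)) => //.
  by exists (exist _ y (mem_set Oy)).
have {}cod (x : bdry Omega) r : 0 < r ->
    ((Ctheta^-1 * r `^ (- theta))%:E * mu (ball (\val x) r) <= nu (ball x r))%E
    /\ (nu (ball x r) <= (Ctheta * r `^ (- theta))%:E * mu (ball (\val x) r))%E.
  by move=> r0; apply: cod => //; rewrite diamE gt0_muley ?ltry ?lte_fin.
have mu0 (x : X) r : 0 < r -> (0 < mu (ball x r))%E.
  move=> r0; have r20 : 0 < r / 2 by rewrite divr_gt0.
  by have [h _ _] := muD x _ r20; rewrite (_ : r = 2 * (r / 2)) //; lra.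
have muf (x : X) r : 0 < r -> (mu (ball x r) < +oo)%E by move=> /(muD x)[].
have muE (x : X) r : 0 < r -> exists2 m : R, 0 < m & mu (ball x r) = m%:E.
  move=> r0; exists (fine (mu (ball x r))); first by rewrite fine_gt0// mu0//= muf.
  by rewrite fineK// ge0_fin_numE// muf.
split.
- have [m m0 mE] := muE (\val b) 1 ltr01.
  have [_] := cod b 1 ltr01; rewrite mE powR1 mulr1 -EFinM => h.
  have := le_trans (measure_ge0 nu _) h; rewrite lee_fin => h'.
  by rewrite -(pmulr_lge0 _ m0).
- move=> C0 x r r0; have [h1 h2] := cod x r r0.
  have [m m0 mE] := muE (\val x) r r0; rewrite mE -EFinM in h1 h2.
  have a0 : 0 < r `^ (- theta) by exact: powR_gt0.
  have n1 : (0 < nu (ball x r))%E.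
    by apply: lt_le_trans h1; rewrite lte_fin !mulr_gt0// invr_gt0.
  have n2 : (nu (ball x r) < +oo)%E by apply: le_lt_trans h2 _; exact: ltry.
  split => //.
  have nE : nu (ball x r) = (fine (nu (ball x r)))%:E.
    by rewrite fineK// ge0_fin_numE.
  have r20 : 0 < 2 * r by rewrite mulr_gt0.
  have [_ h3] := cod x _ r20.
  have [m' m'0 m'E] := muE (\val x) _ r20.
  have [_ h4 _] := muD (\val x) r r0; rewrite m'E mE -EFinM lee_fin in h4.
  apply: (le_trans h3); rewrite m'E nE in h1 *; rewrite -!EFinM !lee_fin in h1 *.
  rewrite powRM ?(ltW r0)//; set t := 2 `^ _; set a := r `^ _ in h1 a0 *.
  have t0 : 0 < t by exact: powR_gt0.
  have Cmu0 : 0 < Cmu by rewrite -(pmulr_lgt0 _ m0) (lt_le_trans m'0).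
  apply: (@le_trans _ _ (Ctheta * (t * a) * (Cmu * m))).
    by rewrite ler_wpM2l// !mulr_ge0// ltW.
  have -> : Ctheta * (t * a) * (Cmu * m) =
      Ctheta ^+ 2 * t * Cmu * (Ctheta^-1 * a * m).
    by field; rewrite lt0r_neq0.
  by rewrite ler_wpM2l// !mulr_ge0 ?exprn_ge0// ltW.
- move=> C0; have b0 n : nu (ball b n.+1%:R) = 0%E.
    have [_] := cod b n.+1%:R (ltr0Sn _ _).
    by rewrite C0 !mul0r mul0e => h; apply/eqP; rewrite eq_le h measure_ge0.
  apply/eqP; rewrite eq_le measure_ge0 andbT.
  apply: (@le_trans _ _ (\sum_(0 <= n <oo) nu (ball b n.+1%:R))%E).
    apply: measure_sigma_subadditive => // [n|x _]; first exact: borel_ball.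
    exists (Num.truncn (mdist b x)) => //=.
    by rewrite ballEmdist /=; have /andP[_] := truncn_itv (mdist_ge0 b x).
  by rewrite eseries0.
Qed.

Lemma integral_null_space d (T : measurableType d) (R : realType)
    (mu : {measure set T -> \bar R}) (f : T -> \bar R) :
  mu setT = 0%E -> (forall x, 0 <= f x)%E -> (\int[mu]_x f x = 0)%E.
Proof.
move=> mu0 f0; apply/eqP; rewrite eq_le integral_ge0// andbT.
rewrite -[leRHS](@integral0 _ _ _ mu setT).
by apply: (lower_integral_null measurableT mu0) => // x /(_ I).
Qed.

Lemma besov_energy_ge0 {R : realType} {Z : metricType R} {z : Z}
    (mu : {measure set (borel z) -> \bar R}) (p Theta : R) (u : Z -> R) :
  (0 <= besov_energy mu p Theta u)%E.
Proof.
apply: integral_ge0 => x _; apply: integral_ge0 => y _.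
by rewrite mule_ge0 ?lee_fin ?powR_ge0// inve_ge0 mule_ge0// lee_fin powR_ge0.
Qed.

Lemma besov_energy_null_space {R : realType} {Z : metricType R} {z : Z}
    (mu : {measure set (borel z) -> \bar R}) (p Theta : R) (u : Z -> R) :
  mu setT = 0%E -> besov_energy mu p Theta u = 0%E.
Proof.
move=> mu0; apply: integral_null_space => // x; apply: integral_ge0 => y _.
by rewrite mule_ge0 ?lee_fin ?powR_ge0// inve_ge0 mule_ge0// lee_fin powR_ge0.
Qed.

(** The maximum with 1 covers the zero measure, where the second constant may be
    smaller. *)
Definition besov_cst {R : realType}
    (p theta kappa CU Cmu Ctheta CA CB CD : R) : R :=
  Num.max 1 (equiv_cst (Ctheta ^+ 2 * 2 `^ (- theta) * Cmu) kappa CA CB CD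
    (blo_cst CA) (p - theta) (bup_cst CA CU) p).
Theorem theorem5p4 (R : realType)
    (p theta lam kappa CU Cmu CP Ctheta CA CB CC CD : R) :
  1 <= p -> 0 < theta -> theta < p -> 1 <= lam -> 1 < kappa -> 0 < CP ->
  0 < CA -> 0 < CB -> 0 < CC -> 0 < CD ->
  exists C : R, 1 <= C /\
  forall (X : metricType R) (Omega : set X) (b : bdry Omega)
    (mu : {measure set (borel (\val b)) -> \bar R})
    (nu : {measure set (borel b) -> \bar R})
    (rho : R -> R)
    (Y : metricType R) (iota : set_type Omega -> Y)
    (j : bdry Omega -> bdry_rho iota) (infty : bdry_rho iota)
    (nu_rho : {measure set (borel infty) -> \bar R}),
  unbounded [set: X] -> metric_complete [set: X] ->
  doubling mu Cmu -> poincare mu p CP lam ->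
  unbounded Omega -> uniform_domain Omega CU -> closure Omega = [set: X] ->
  unbounded (~` Omega) -> uniformly_perfect kappa (~` Omega) ->
  radon nu -> codimensional mu nu theta Ctheta ->
  (forall r, 0 < r -> 0 < rho r) ->
  lower_semicontinuous (fun r : set_type (`]0%R, +oo[%classic : set R) => (rho (\val r))%:E) ->
  condA rho CA -> condB rho CB -> condC mu rho p CC ->
  condD nu rho p theta CD ->
  is_completion b rho iota -> boundary_identification b j infty ->
  is_nu_rho nu rho p theta j nu_rho ->
  hom_besov nu p (1 - theta / p) =
    [set v \o j | v in besov nu_rho p (1 - theta / p)] /\
  forall (u : bdry Omega -> R) (v : bdry_rho iota -> R),
    hom_besov nu p (1 - theta / p) u -> u = v \o j ->
    ((C^-1)%:E * besov_norm nu p (1 - theta / p) u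
       <= besov_norm nu_rho p (1 - theta / p) v)%E /\
    (besov_norm nu_rho p (1 - theta / p) v
       <= C%:E * besov_norm nu p (1 - theta / p) u)%E.
Proof.
move=> p1 theta0 thetap _ kappa1 _ CA0 CB0 _ CD0.
exists (besov_cst p theta kappa CU Cmu Ctheta CA CB CD).
have C1 : 1 <= besov_cst p theta kappa CU Cmu Ctheta CA CB CD.
  by rewrite le_max lexx.
split => // X Omega b mu nu rho Y iota j infty nu_rho.
move=> _ Xc muD _ Omegaoo OmegaU OmegaD bdoo perf _ cod rho_gt0 _ rhoA rhoB _ rhoD.
move=> iotaC jP nurho.
set C := besov_cst _ _ _ _ _ _ _ _ _ in C1 *.
have pT : p * (1 - theta / p) = p - theta.
  by field; rewrite lt0r_neq0// (lt_le_trans ltr01 p1).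
have nurhoE := nu_rho_integral rho_gt0 rhoA OmegaD Omegaoo iotaC jP nurho.
have mj : measurable_fun setT (j : borel b -> borel infty).
  apply: continuous_measurable.
  exact: (boundary_continuous rho_gt0 rhoA OmegaU OmegaD iotaC jP).
have jK := bdry_invK rho_gt0 rhoA OmegaD iotaC jP.
have mjinv := measurable_bdry_inv rho_gt0 rhoA OmegaU OmegaD Xc iotaC jP.
have mrange : measurable (range j : set (borel infty)).
  apply: (measurable_closed_image rho_gt0 rhoA OmegaU OmegaD Xc iotaC jP).
  exact: closedT.
have key (u : bdry Omega -> R) (v : bdry_rho iota -> R) :
    measurable_fun setT (u : borel b -> R) -> (forall x, v (j x) = u x) ->
    [/\ (besov_energy nu p (1 - theta / p) u <=
           C%:E * besov_energy nu_rho p (1 - theta / p) v)%E,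
        (besov_energy nu_rho p (1 - theta / p) v <=
           C%:E * besov_energy nu p (1 - theta / p) u)%E &
        (besov_energy nu_rho p (1 - theta / p) v < +oo)%E ->
          (\int[nu_rho]_x (`|v x| `^ p)%:E < +oo)%E].
  move=> mu_ vj.
  have [Ct0 reg degen] := doubling_codimensional muD bdoo cod.
  move: Ct0; rewrite le_eqVlt => /predU1P[/esym Ct0|Ct0].
    have nu0 := degen Ct0.
    have nurho0 : nu_rho setT = 0%E.
      rewrite nurhoE// integral_mkcond; apply: integral_null_space => // x.
      by rewrite erestrict_ge0// => y _; rewrite lee_fin powR_ge0.
    rewrite !besov_energy_null_space// !mule0 !lexx; split => // _.
    by rewrite integral_null_space// => x; rewrite lee_fin powR_ge0.
  have nu_gt0 (x : bdry Omega) r : 0 < r -> (0 < nu (ball x r))%E.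
    by move=> /(reg Ct0 x)[].
  have nu_fin (x : bdry Omega) r : 0 < r -> (nu (ball x r) < +oo)%E.
    by move=> /(reg Ct0 x)[].
  have nuD (x : bdry Omega) r : 0 < r ->
      (nu (ball x (2 * r)) <=
       (Ctheta ^+ 2 * 2 `^ (- theta) * Cmu)%:E * nu (ball x r))%E.
    by move=> /(reg Ct0 x)[].
  have perfect (a : bdry Omega) r : 0 < r ->
      exists z, r <= mdist a z /\ mdist a z < kappa * r.
    move=> r0; have [|z [[zk zr] Oz]] := perf (val a) r (set_valP a) r0.
      move=> sub; have [z Oz] := unbounded_height b (height b (val a) + r) bdoo.
      have := sub z Oz; rewrite ballEmdist /= => az.
      by have := height_le b z (val a); rewrite (metric_sym z); lra.
    exists (exist _ z (mem_set Oz)); rewrite mdist_val /=.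
    rewrite ballEmdist /= in zk; split => //.
    by rewrite leNgt; apply/negP => h; apply: zr; rewrite ballEmdist.
  have s0 : 0 < p - theta by rewrite subr_gt0.
  have Cup0 := bup_cst_gt0 CU rho_gt0 rhoA.
  have clo0 := blo_cst_gt0 rho_gt0 rhoA.
  have jcont := boundary_continuous rho_gt0 rhoA OmegaU OmegaD iotaC jP.
  have jup K (x y : bdry Omega) : 1 <= K -> hgt b x <= K * hgt b y ->
      hgt b y <= K * hgt b x ->
      mdist (j x) (j y) <= bup_cst CA CU K * rho (hgt b x) * mdist x y.
    exact: (boundary_dist_le rho_gt0 rhoA OmegaU OmegaD iotaC jP).
  have jlo (x y : bdry Omega) :
      blo_cst CA * rho (hgt b x) * Num.min (mdist x y) (hgt b x) <= mdist (j x) (j y).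
    exact: (boundary_dist_ge rho_gt0 rhoA OmegaD iotaC jP).
  have le_C (e : \bar R) : (0 <= e)%E ->
      ((equiv_cst (Ctheta ^+ 2 * 2 `^ (- theta) * Cmu) kappa CA CB CD
         (blo_cst CA) (p - theta) (bup_cst CA CU) p)%:E * e <= C%:E * e)%E.
    by move=> e0; rewrite lee_wpmul2r// lee_fin le_max lexx orbT.
  have E0 := energy0_le_energy1 nu_gt0 nu_fin nuD kappa1 perfect rho_gt0 rhoA
    rhoB CB0 CD0 rhoD s0 Cup0 clo0 jcont jup jlo nurhoE p1 jK mjinv mrange mu_ vj.
  have E1 := energy1_le_energy0 nu_gt0 nu_fin nuD kappa1 perfect rho_gt0 rhoA
    rhoB CB0 CD0 rhoD s0 Cup0 clo0 jcont jup jlo nurhoE p1 mu_ vj.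
  have EL := energy1_fin_Lp (v := v) nu_gt0 nu_fin nuD kappa1 perfect rho_gt0
    rhoA rhoB CB0 CD0 rhoD s0 Cup0 jup nurhoE p1 mrange.
  have e0E : besov_energy nu p (1 - theta / p) u = energy0 nu (p - theta) p u.
    by rewrite /besov_energy pT.
  have e1E : besov_energy nu_rho p (1 - theta / p) v = energy1 nu_rho (p - theta) p v.
    by rewrite /besov_energy pT.
  split; last by rewrite e1E.
  - rewrite e0E; apply: (le_trans E0); rewrite -e1E.
    by apply: le_C; exact: besov_energy_ge0.
  - rewrite e1E; apply: (le_trans E1); rewrite -e0E.
    by apply: le_C; exact: besov_energy_ge0.
have lt_C (e e' : \bar R) : (e <= C%:E * e')%E -> (e' < +oo)%E -> (e < +oo)%E.
  move=> h e'oo; apply: (le_lt_trans h); apply: lte_mul_pinfty => //.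
  by rewrite lee_fin; lra.
split.
  apply/seteqP; split => [u [mu_ ufin]|_ [v [[mv vfin] _] <-]].
    have vj x : (u \o bdry_inv b j) (j x) = u x by rewrite /= jK.
    exists (u \o bdry_inv b j); last exact/funext.
    have [_ h1 h2] := key _ _ mu_ vj; have vfin := lt_C _ _ h1 ufin.
    by split; [split => //; exact: (measurableT_comp mu_ mjinv)|exact: h2].
  have mu_ : measurable_fun setT (v \o j : borel b -> R).
    exact: (measurableT_comp mv mj).
  by have [h _ _] := key _ v mu_ (fun=> erefl); split => //; exact: lt_C h vfin.
move=> u v [mu_ _] uv.
have [h1 h2 _] := key u v mu_ (fun x => esym (congr1 (@^~ x) uv)).
have C0 : 0 < C by lra.
have e0 := besov_energy_ge0 nu p (1 - theta / p) u.
have e1 := besov_energy_ge0 nu_rho p (1 - theta / p) v.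
split; last exact: (poweR_inv_le p1 C1 e1 e0 h2).
rewrite -lee_pdivlMl ?invr_gt0// invrK.
exact: (poweR_inv_le p1 C1 e0 e1 h1).
Qed.
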